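(* For any surface $\Sigma$ and any integer $k\geq 6$, there is (up to isomorphism) a finite number of $(k+1)$-dicritical digraphs embeddable on $\Sigma$.
   Context: All surfaces are closed (and connected). Digraphs are finite, without loops and without parallel arcs, but digons (pairs of oppositely directed arcs between the same two vertices) are allowed; so there are at most two arcs between any two vertices. A digraph is embeddable on a surface if its underlying simple graph is embeddable on that surface. A $k$-dicolouring of a digraph is a partition of its vertex set into $k$ subsets each inducing an acyclic subdigraph (no directed cycle; a digon is a directed cycle of length $2$); the dichromatic number $\vec{\chi}(D)$ is the least $k$ such that $D$ has a $k$-dicolouring. A digraph $D$ is $k$-dicritical if $\vec{\chi}(D)=k$ and $\vec{\chi}(H)<k$ for every proper subdigraph $H$ of $D$. *)

(* Defs.v *)
From HB Require Import structures.
From mathcomp Require Import all_boot all_order all_algebra.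
From mathcomp Require Import all_classical all_reals all_analysis.
Import Order.TTheory GRing.Theory Num.Theory.
Import numFieldNormedType.Exports.

Set Implicit Arguments.
Unset Strict Implicit.
Unset Printing Implicit Defensive.

Local Open Scope classical_set_scope.
Local Open Scope ring_scope.

(* ** Digraphs *)

(* Since arcs form a relation, there are no parallel arcs; digons are allowed. *)
Record digraph := Digraph {
  vertex :> finType;
  arc : rel vertex;
  arc_irrefl : irreflexive arc }.

Definition digraph_iso (D D' : digraph) : Prop :=
  exists f : D -> D', bijective f /\ forall x y, arc (f x) (f y) = arc x y.

Record subdigraph (D : digraph) := Subdigraph {
  sub_vertices : {set D};
  sub_arcs : {set D * D};
  sub_arcsP : forall x y, (x, y) \in sub_arcs ->
    [/\ arc x y, x \in sub_vertices & y \in sub_vertices] }.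

Definition proper_subdigraph (D : digraph) (H : subdigraph D) : Prop :=
  ~ (sub_vertices H = finset.setT /\ sub_arcs H = [set a : D * D | arc a.1 a.2]%SET).

Section DigraphOfSubdigraph.
Variables (D : digraph) (H : subdigraph D).

Definition sub_arc : rel {x : D | x \in sub_vertices H} :=
  fun x y => (val x, val y) \in sub_arcs H.

Lemma sub_arc_irrefl : irreflexive sub_arc.
Proof.
move=> x; apply/negP => /(sub_arcsP (s := H)) [].
by rewrite arc_irrefl.
Qed.

Definition digraph_of_sub : digraph := Digraph sub_arc_irrefl.

End DigraphOfSubdigraph.

Coercion digraph_of_sub : subdigraph >-> digraph.

(* ** Dicolourings *)

(* A directed cycle is given by its nonempty duplicate-free cyclic list of
   vertices; a digon is one of length 2, and length 1 is excluded by [arc_irrefl]. *)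
Definition directed_cycle (D : digraph) (s : seq D) : Prop :=
  s != [::] /\ ucycle (@arc D) s.

Definition acyclic_on (D : digraph) (A : {set D}) : Prop :=
  forall s : seq D, directed_cycle s -> ~ {subset s <= A}.

(* The partition is given by its class function; classes may be empty, which
   does not change the least k. *)
Definition dicolouring (D : digraph) (k : nat) (c : D -> 'I_k) : Prop :=
  forall i : 'I_k, acyclic_on [set x | c x == i]%SET.

Definition dicolourable (D : digraph) (k : nat) : Prop :=
  exists c : D -> 'I_k, dicolouring c.

Lemma dicolourable_ex (D : digraph) : exists k, `[< dicolourable D k >].
Proof.
exists #|D|; apply/asboolP; exists enum_rank => i s [s0 /andP[cs us]] sA.
case: s s0 cs us sA => [//|x [|y s]] _ /= cs us sA.
  by rewrite arc_irrefl in cs.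
have := sA y; have := sA x; rewrite !inE !eqxx orbT => /(_ isT)/eqP xi.
move=> /(_ isT)/eqP yi.
have xy : x = y by apply: enum_rank_inj; rewrite xi yi.
by rewrite xy mem_head in us.
Qed.

Definition dichromatic_number (D : digraph) : nat := ex_minn (dicolourable_ex D).

Definition dicritical (k : nat) (D : digraph) : Prop :=
  dichromatic_number D = k /\
  forall H : subdigraph D, proper_subdigraph H -> (dichromatic_number H < k)%N.

(* ** Simple graphs *)

Record sgraph := SGraph {
  svertex :> finType;
  adj : rel svertex;
  adj_sym : symmetric adj;
  adj_irrefl : irreflexive adj }.

Definition edges (G : sgraph) : {set {set G}} :=
  [set e : {set G} | [exists x, exists y, adj x y && (e == [set x; y])]]%SET.

Section Underlying.
Variable D : digraph.

Definition underlying_adj : rel D := fun x y => arc x y || arc y x.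

Lemma underlying_sym : symmetric underlying_adj.
Proof. by move=> x y; rewrite /underlying_adj orbC. Qed.

Lemma underlying_irrefl : irreflexive underlying_adj.
Proof. by move=> x; rewrite /underlying_adj !arc_irrefl. Qed.

Definition underlying : sgraph := SGraph underlying_sym underlying_irrefl.

End Underlying.

(* ** Surfaces and embeddings *)

(* Every point has an open neighbourhood U homeomorphic to the plane, via
   mutually inverse maps phi : U -> R^2 (values outside U are irrelevant)
   and psi : R^2 -> U. *)
Definition locally_plane (R : realType) (S : topologicalType) : Prop :=
  forall x : S, exists U : set S, [/\ open U, U x &
    exists (phi : S -> R * R) (psi : R * R -> S),
      [/\ {within U, continuous phi}, continuous psi,
          forall z, U (psi z),
          forall y, U y -> psi (phi y) = y &
          forall z, phi (psi z) = z]].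

(* Second countability follows from compactness and [locally_plane]. *)
Definition closed_surface (R : realType) (S : topologicalType) : Prop :=
  [/\ [set: S] !=set0, hausdorff_space S, compact [set: S],
      connected [set: S] & locally_plane R S].

Definition simple_arc (R : realType) (S : topologicalType) (g : R -> S) : Prop :=
  {within `[0, 1], continuous g} /\ {in `[0, 1] &, injective g}.

(* p places the vertices and g e is the curve drawing the edge e; curves
   of distinct edges may meet only at common endpoints. *)
Definition embedding (R : realType) (S : topologicalType) (G : sgraph)
    (p : G -> S) (g : {set G} -> R -> S) : Prop :=
  [/\ injective p,
      forall e, e \in edges G ->
        simple_arc (g e) /\ [set g e 0; g e 1] = p @` [set` e],
      forall e, e \in edges G ->
        forall (t : R) v, t \in `]0, 1[ -> g e t <> p v &
      forall e f, e \in edges G -> f \in edges G -> e <> f ->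
        forall s t : R, s \in `]0, 1[ -> t \in `]0, 1[ -> g e s <> g f t].

Definition graph_embeddable (R : realType) (S : topologicalType) (G : sgraph) : Prop :=
  exists (p : G -> S) (g : {set G} -> R -> S), embedding p g.

Definition embeddable (R : realType) (S : topologicalType) (D : digraph) : Prop :=
  graph_embeddable R S (underlying D).

Definition finitely_many_up_to_iso (P : digraph -> Prop) : Prop :=
  exists (n : nat) (F : 'I_n -> digraph),
    forall D, P D -> exists i : 'I_n, digraph_iso D (F i).

(* Main.v *)
Require Import Defs.
From mathcomp Require Import all_boot all_order all_algebra.
From mathcomp Require Import all_classical all_reals all_analysis.
From mathcomp Require Import lra zify.
(* [arc] is the arc relation of digraphs, not that of [path] *)
Import Defs.
Import Order.TTheory GRing.Theory Num.Theory.
Import numFieldNormedType.Exports.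

(** Only finitely many digraphs have a given order ([finitely_many_of_order]), so
    it suffices to bound the order of a [k.+1]-dicritical digraph on the surface.

    Every degree of its underlying graph is at least [k] ([leq_card_nbr]), while
    Euler's formula allows at most [3 * n + M] edges on [n] vertices, with [M]
    depending on the surface only ([edge_bound]). For [k > 6] this bounds [n]. For
    [k = 6] all but boundedly many vertices have degree exactly [6]; such a
    vertex is called low. If the other vertices are coloured, a low vertex sees
    every colour once, and all its edges are digons. So the uncoloured vertex can
    be moved along paths of low vertices ([shift]), and around a loop of them this
    rotates the colours ([rotate]). It follows that a vertex of the loop with a
    third neighbour on it is adjacent to the whole loop ([loop_all]), and that the
    end of a longest path of low vertices belongs to a terminal clique
    ([terminal_block]). The cliques have at most six vertices, so the low
    vertices induce on average at most [8/3] edges per vertex ([low_density]) and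
    must send many edges to the few other vertices ([critical_order]).

    The edge bound is a count of edge sets by topology with coefficients in the
    field of two elements. Cohomology in degree one is described by double
    covers, given by locally constant functions that are defined locally and
    compared on overlaps ([cocycle]). Its tools are homotopy invariance
    ([homotopy_cocycle]), the computation for the punctured plane
    ([punctured_class], [kappa_loop]) and Mayer-Vietoris splittings
    ([plane_split]). They yield the only planar separation theory that is
    needed: an arc does not separate and has no jump at its end
    ([arc_nonseparating], [arc_end]), and [n] arms that leave a point separate
    its neighbourhood as [n] segments do ([star], [surface_star]). Hence the
    edges at which a function on the complement of the drawing jumps form a
    cyclic set, that is, one with even degrees ([jumps_cyclic]). Conversely a
    cyclic set defines a cocycle on the surface, and two cyclic sets with
    cohomologous cocycles differ by the jumps of a function
    ([cycles_difference]). As the surface is compact it has finitely many classes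
    ([finitely_many_classes]), and the number of jump sets is at most [2 ^ f],
    where [f] is the number of faces, each with at least three sides
    ([card_jump_sets]). *)

Set Implicit Arguments.
Unset Strict Implicit.
Unset Printing Implicit Defensive.

Local Open Scope classical_set_scope.
Local Open Scope ring_scope.

(** * Locally constant functions, cocycles and homotopy invariance *)

Ltac xor_atom t :=
  lazymatch t with
  | addb ?a ?b => first [xor_atom a | xor_atom b]
  | true => fail
  | false => fail
  | _ => move: (t) => []
  end.
Ltac xor_ring := rewrite /= ?addbF ?addFb; repeat
  match goal with
  | |- context [addb ?a ?b] => first [xor_atom a | xor_atom b]
  end; try done.

Lemma zero01 (R : realType) : 0 <= (0 : R) <= 1.
Proof. by rewrite lexx ler01. Qed.

Lemma one01 (R : realType) : 0 <= (1 : R) <= 1.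
Proof. by rewrite lexx ler01. Qed.

(** Subdivision of the unit interval, by the supremum of the [t] with [P 0 t]. *)
Lemma interval_ind (R : realType) (P : R -> R -> Prop) :
  (forall t, 0 <= t <= 1 -> exists2 e, 0 < e & forall u v, 0 <= u -> v <= 1 ->
     t - e < u -> u <= v -> v < t + e -> P u v) ->
  (forall u w v, 0 <= u -> u <= w -> w <= v -> v <= 1 -> P u w -> P w v -> P u v) ->
  P 0 1.
Proof.
move=> loc add.
pose E := [set t | 0 <= t <= 1 /\ P 0 t].
have E0 : E 0.
  have [|e e0 he] := loc 0; first by rewrite lexx ler01.
  split; first by rewrite lexx ler01.
  by apply: he; rewrite ?lexx ?ler01 //; lra.
have ubE : ubound E 1 by move=> t [/andP[]].
have hasE : has_sup E by split; [exists 0|exists 1].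
have s0 : 0 <= sup E by apply: ub_le_sup E0; exists 1.
have s1 : sup E <= 1 by apply: ge_sup => //; exists 0.
have [|e e0 he] := loc (sup E); first by rewrite s0 s1.
have [t [/andP[t0 t1] Pt] lt_t] := sup_adherent e0 hasE.
have tE : t <= sup E by apply: ub_le_sup; [exists 1|split; rewrite ?t0 ?t1].
have grow v : t <= v -> v <= 1 -> v < sup E + e -> P 0 v.
  by move=> tv v1 ve; apply: (add 0 t v) => //; exact: he.
have [lt1|] := ltP 1 (sup E + e); first by apply: grow.
move=> le1; suff : E (sup E + e / 2) by move=> /(ub_le_sup (ex_intro _ 1 ubE)); lra.
by split; [lra|apply: grow; lra].
Qed.

Section Locst.
Variable T : topologicalType.
Implicit Types (s t : T -> bool) (x : T).

Definition locst s x := \forall z \near x, s z = s x.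

Lemma locst_cst b x : locst (fun=> b) x.
Proof. exact: nearW. Qed.

Lemma locstP s x b : (\forall z \near x, s z = b) -> locst s x.
Proof. by move=> h; have /= sx := nbhs_singleton h; rewrite /locst sx. Qed.

Lemma eq_locst s t x : (\forall z \near x, s z = t z) -> locst s x -> locst t x.
Proof.
rewrite /locst => st sx; have /= e := nbhs_singleton st.
by apply: filterS2 st sx => z <- ->.
Qed.

Lemma eq_locstW s t x : s =1 t -> locst s x -> locst t x.
Proof. by move=> st; apply: eq_locst; exact: nearW. Qed.

Lemma locstD s t x : locst s x -> locst t x -> locst (fun z => s z (+) t z) x.
Proof. by rewrite /locst => sx tx; apply: filterS2 sx tx => z -> ->. Qed.

End Locst.

(** Continuity at a point in the shape in which it is used below: images of
    neighbourhoods, without going through the filter of images. *)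
Definition cnt (T U : topologicalType) (f : T -> U) (x : T) :=
  forall A : set U, nbhs (f x) A -> nbhs x [set z | A (f z)].

Lemma cntP (T U : topologicalType) (f : T -> U) (x : T) :
  f z @[z --> x] --> f x <-> cnt f x.
Proof. by split=> fx A /fx. Qed.

Lemma cnt_comp (T U V : topologicalType) (f : T -> U) (g : U -> V) x :
  cnt f x -> cnt g (f x) -> cnt (g \o f) x.
Proof. by move=> fx gfx A /gfx /fx. Qed.

Lemma locst_comp (T U : topologicalType) (f : T -> U) (s : U -> bool) x :
  cnt f x -> locst s (f x) -> locst (s \o f) x.
Proof. by move=> fx /fx. Qed.

Section Cocycle.
Variable T : topologicalType.
Implicit Types (W : set T) (c : T -> T -> bool).

(** Classes are represented by functions [c x], each given near [x] only, whose
    differences are locally constant: they describe a double cover of [W], and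
    a trivialization is a global function with the same local differences. *)
Definition cocycle W c :=
  forall x, W x -> \forall y \near x, locst (fun z => c x z (+) c y z) y.

Definition trivializes W c (f : T -> bool) :=
  forall x, W x -> locst (fun z => f z (+) c x z) x.

End Cocycle.

Lemma near_seq (T : topologicalType) (I : eqType) (L : seq I) (P : I -> T -> Prop) (x : T) :
  (forall i, i \in L -> \forall y \near x, P i y) ->
  \forall y \near x, forall i, i \in L -> P i y.
Proof.
elim: L => [|j L IH] HL; first by apply: nearW => z i; rewrite in_nil.
have nj := HL j (mem_head _ _).
have nL : \forall y \near x, forall i, i \in L -> P i y.
  by apply: IH => i iL; apply: HL; rewrite inE iL orbT.
by apply: filterS2 nj nL => z zj zL i; rewrite inE => /orP[/eqP->|/zL].
Qed.

Section NearPair.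
Variables T U : topologicalType.

Lemma near_fst (x : T) (y : U) (P : T -> Prop) :
  (\forall z \near x, P z) -> \forall a \near (x, y), P a.1.
Proof. by move=> xP; exists (P, setT) => //=; [split=> //; exact: filterT|move=> [a b] []]. Qed.

Lemma near_snd (x : T) (y : U) (P : U -> Prop) :
  (\forall z \near y, P z) -> \forall a \near (x, y), P a.2.
Proof. by move=> yP; exists (setT, P) => //=; [split=> //; exact: filterT|move=> [a b] []]. Qed.

Lemma near_slice (x : T) (y : U) (P : T * U -> Prop) :
  (\forall a \near (x, y), P a) -> \forall z \near x, P (z, y).
Proof.
move=> [[A B] /= [nA nB] AB]; apply: filterS nA => z Az.
by apply: AB; split=> //=; exact: nbhs_singleton.
Qed.

Lemma near_slice2 (x : T) (y : U) (P : T * U -> Prop) :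
  (\forall a \near (x, y), P a) -> \forall z \near y, P (x, z).
Proof.
move=> [[A B] /= [nA nB] AB]; apply: filterS nB => z Bz.
by apply: AB; split=> //=; exact: nbhs_singleton.
Qed.

End NearPair.

Section Homotopy.
Variables (R : realType) (T U : topologicalType).
Variables (Phi : T -> R -> U) (W : set T) (W' : set U) (c : U -> U -> bool).
Hypothesis openW : open W.
Hypothesis cc : cocycle W' c.
Hypothesis PhiW : forall z t, W z -> 0 <= t <= 1 -> W' (Phi z t).
Hypothesis Phi_cont : forall z t, W z -> 0 <= t <= 1 ->
  cnt (fun a : T * R => Phi a.1 a.2) (z, t).

(** [h z] is a trivialization along the part from [u] to [v] of the path
    [Phi z] of the pullback of [c], locally uniform in [z]. *)
Let lift (h : T -> R -> bool) (u v : R) (z : T) := forall t : R, u <= t <= v ->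
  \forall a \near (z, t), u <= a.2 <= v ->
    h a.1 a.2 (+) c (Phi z t) (Phi a.1 a.2) = h z t (+) c (Phi z t) (Phi z t).

Let liftable (z : T) (u v : R) := exists h, \forall z' \near z, lift h u v z'.

Let local_lift z : W z -> forall t, 0 <= t <= 1 ->
  exists2 e, 0 < e & forall u v, 0 <= u -> v <= 1 ->
   t - e < u -> u <= v -> v < t + e -> liftable z u v.
Proof.
move=> Wz t t01.
have : \forall a \near (z, t),
    locst (fun w => c (Phi z t) w (+) c (Phi a.1 a.2) w) (Phi a.1 a.2).
  exact: (Phi_cont Wz t01 (cc (PhiW Wz t01))).
have nW : \forall z' \near z, W z' by exact: open_nbhs_nbhs.
move=> [[A B] /= [nA]] /nbhs_ballP[e /= e0 Be] AB.
exists e => // u v u0 v1 ue uv ve.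
exists (fun z' t' => c (Phi z t) (Phi z' t')).
apply: filterS2 nW nA => z' Wz' Az' t' /andP[ut' t'v].
have t'01 : 0 <= t' <= 1 by lra.
have Bt' : B t' by apply: Be; rewrite /ball /= ltr_norml; lra.
have /(Phi_cont Wz' t'01) := AB (z', t') (conj Az' Bt').
by apply: filterS => a /= -> _.
Qed.

Let glue_lift z u w v : W z -> u <= w -> w <= v ->
  liftable z u w -> liftable z w v -> liftable z u v.
Proof.
move=> Wz uw wv [h Hh] [k Hk].
(* [d] makes the two lifts agree at time [w]; it is locally constant *)
pose d z' := h z' w (+) k z' w.
exists (fun z' t => if t <= w then h z' t else k z' t (+) d z').
apply: filterS2 Hh Hk => z' Hh Hk t /andP[ut tv].
have Hhw : \forall x \near z', h x w (+) c (Phi z' w) (Phi x w) =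
    h z' w (+) c (Phi z' w) (Phi z' w).
  have /Hh/near_slice : u <= w <= w by rewrite uw lexx.
  by apply: filterS => x /= ->//; rewrite uw lexx.
have Hkw : \forall x \near z', k x w (+) c (Phi z' w) (Phi x w) =
    k z' w (+) c (Phi z' w) (Phi z' w).
  have /Hk/near_slice : w <= w <= v by rewrite wv lexx.
  by apply: filterS => x /= ->//; rewrite wv lexx.
have dloc : \forall a \near (z', t), d a.1 = d z'.
  apply: (@near_fst _ _ z' t (fun x => d x = d z')).
  apply: filterS2 Hhw Hkw => x; rewrite /d.
  by move: (h x w) (k x w) (h z' w) (k z' w) (c _ _) (c _ _) => [] [] [] [] [] [].
have [tw|wt|tw] := ltgtP t w.
- have /Hh : u <= t <= w by rewrite ut ltW.
  have := @near_snd _ _ z' t _ (lt_nbhsl tw).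
  apply: filterS2 => a /= aw ha /andP[ua av].
  by rewrite (ltW aw) ha// ua ltW.
- have /Hk : w <= t <= v by rewrite tv ltW.
  have := @near_snd _ _ z' t _ (lt_nbhsr wt).
  move: dloc; apply: filterS3 => a /= da aw ha /andP[ua av].
  have := ha; rewrite (ltW aw) av => /(_ isT).
  have -> : (a.2 <= w) = false by rewrite leNgt aw.
  rewrite da.
  by move: (k _ _) (c _ _) (k _ _) (c _ _) (d _) => [] [] [] [] [].
- move: dloc; have /Hh : u <= t <= w by rewrite ut tw lexx.
  have /Hk : w <= t <= v by rewrite tv tw lexx.
  apply: filterS3 => a /= ka ha da /andP[ua av].
  case: ifP => aw; first by rewrite ha ?ua.
  have /ka : w <= a.2 <= v by rewrite av andbT ltW// ltNge aw.
  rewrite da /d tw.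
  move: (k _ _) (c _ _) (h _ _) (k _ _) (c _ _) => [] [] [] [] [] //.
Qed.

Let lift_unique h k z : W z -> lift h 0 1 z -> lift k 0 1 z ->
  h z 0 (+) h z 1 = k z 0 (+) k z 1.
Proof.
move=> Wz Hh Hk.
have : h z 0 (+) k z 0 = h z 1 (+) k z 1; last first.
  by move: (h _ _) (h _ _) (k _ _) (k _ _) => [] [] [] [].
pose Q u v := h z u (+) k z u = h z v (+) k z v.
apply: (@interval_ind _ Q) => [t t01|u w v _ _ _ _]; last first.
  by rewrite /Q => -> ->.
have := Hk t t01; have := Hh t t01.
move=> /near_slice2 Ht /near_slice2 Kt.
have /nbhs_ballP[e /= e0 He] : \forall t' \near t, 0 <= t' <= 1 ->
    h z t' (+) k z t' = h z t (+) k z t.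
  apply: filterS2 Ht Kt => x + + x01 => /(_ x01) + /(_ x01).
  by move: (h _ _) (k _ _) (h _ _) (k _ _) (c _ _) (c _ _) => [] [] [] [] [] [].
exists e => // u v u0 v1 ue uv ve; rewrite /Q !He//.
- by rewrite /ball /= ltr_norml; lra.
- by rewrite v1 (le_trans u0).
- by rewrite /ball /= ltr_norml; lra.
- by rewrite u0 (le_trans uv).
Qed.

(** Transport of [c] along the paths [Phi z] identifies its two pullbacks:
    the value of [f] at [z] is the difference between the ends of any
    trivialization along the path of [z], which the path determines. *)
Lemma homotopy_cocycle : exists f : T -> bool, forall z, W z ->
  locst (fun x => f x (+) (c (Phi z 0) (Phi x 0) (+) c (Phi z 1) (Phi x 1))) z.
Proof.
have lift01 z : W z -> exists h, \forall z' \near z, lift h 0 1 z'.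
  move=> Wz; apply: (@interval_ind _ (liftable z)); first exact: local_lift.
  by move=> u w v _ uw wv _; exact: glue_lift.
pose g z : T -> R -> bool := if pselect (W z) is left Wz then sval (cid (lift01 z Wz)) else
  fun _ _ => false.
have gP z : W z -> \forall z' \near z, lift (g z) 0 1 z'.
  by rewrite /g; case: pselect => // Wz _; case: cid.
exists (fun z => g z z 0 (+) g z z 1) => z Wz.
have nW : \forall z' \near z, W z' by exact: open_nbhs_nbhs.
have lz := nbhs_singleton (gP z Wz).
have h0 := near_slice (lz 0 (zero01 R)); have h1 := near_slice (lz 1 (one01 R)).
apply: (@locstP _ _ _ (g z z 0 (+) c (Phi z 0) (Phi z 0) (+) (g z z 1 (+) c (Phi z 1) (Phi z 1)))).
have gPz := gP z Wz; move: nW gPz; apply: filterS3 (filterI h0 h1) => x [/= h0x h1x] Wx lx.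
rewrite -(h0x (zero01 R)) -(h1x (one01 R)).
rewrite (lift_unique Wx (nbhs_singleton (gP x Wx)) lx).
by xor_ring.
Qed.

End Homotopy.

(** * The plane: convex sets and the branched double cover *)

Section Cnt.
Variables (R : realType) (T U V : topologicalType).

Lemma cnt_cst (u : U) (x : T) : cnt (fun=> u) x.
Proof. by apply/cntP; exact: cvg_cst. Qed.

Lemma cnt_id (x : T) : cnt id x.
Proof. by []. Qed.

Lemma cnt_fst (x : T * U) : cnt (@fst T U) x.
Proof. by apply/cntP; exact: cvg_fst. Qed.

Lemma cnt_snd (x : T * U) : cnt (@snd T U) x.
Proof. by apply/cntP; exact: cvg_snd. Qed.

Lemma cnt_pair (f : T -> U) (g : T -> V) x :
  cnt f x -> cnt g x -> cnt (fun a => (f a, g a)) x.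
Proof. by move=> /cntP fx /cntP gx; apply/cntP; exact: cvg_pair. Qed.

Lemma cntD (f g : T -> R) x : cnt f x -> cnt g x -> cnt (fun a => f a + g a) x.
Proof. by move=> /cntP fx /cntP gx; apply/cntP; exact: (@cvgD _ R^o). Qed.

Lemma cntB (f g : T -> R) x : cnt f x -> cnt g x -> cnt (fun a => f a - g a) x.
Proof. by move=> /cntP fx /cntP gx; apply/cntP; exact: (@cvgB _ R^o). Qed.

Lemma cntM (f g : T -> R) x : cnt f x -> cnt g x -> cnt (fun a => f a * g a) x.
Proof. by move=> /cntP fx /cntP gx; apply/cntP; exact: cvgM. Qed.

End Cnt.

Section PathConst.
Variables (R : realType) (T : topologicalType).

Lemma locst_path (s : T -> bool) (g : R -> T) (a b : R) : a <= b ->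
  (forall t, a <= t <= b -> cnt g t) ->
  (forall t, a <= t <= b -> locst s (g t)) -> s (g a) = s (g b).
Proof.
move=> ab gc sl; pose m t := a + t * (b - a).
have mab t : 0 <= t <= 1 -> a <= m t <= b.
  move=> /andP[t0 t1]; rewrite /m lerDl mulr_ge0 ?subr_ge0//=.
  by rewrite -lerBrDl ler_piMl ?subr_ge0.
have mc t : cnt m t.
  by rewrite /m; apply: cntD; [exact: cnt_cst|apply: cntM; [exact: cnt_id|exact: cnt_cst]].
have -> : a = m 0 by rewrite /m mul0r addr0.
have -> : b = m 1 by rewrite /m mul1r addrC subrK.
apply: (@interval_ind _ (fun u v => s (g (m u)) = s (g (m v)))); last first.
  by move=> u w v _ _ _ _ -> ->.
move=> t t01.
have : \forall u \near t, s (g (m u)) = s (g (m t)).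
  exact: (mc t _ (gc _ (mab t t01) _ (sl _ (mab t t01)))).
move=> /nbhs_ballP[e /= e0 He]; exists e => // u v u0 v1 ue uv ve.
by rewrite !He // /ball /= ltr_norml; lra.
Qed.

End PathConst.

Section Plane.
Variable R : realType.
Implicit Types (x y z p q w : R * R) (W : set (R * R)).

Definition box x (e : R) z := (`|z.1 - x.1| < e) && (`|z.2 - x.2| < e).

Lemma near_box x (P : R * R -> Prop) :
  (\forall z \near x, P z) <-> exists2 e, 0 < e & forall z, box x e z -> P z.
Proof.
split=> [[[A B] /= [/nbhs_ballP[e /= e0 Ae] /nbhs_ballP[d /= d0 Bd]] AB]|].
  exists (Num.min e d); first by rewrite lt_min e0 d0.
  move=> z; rewrite /box !lt_min => /andP[/andP[z1 _] /andP[_ z2]].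
  apply: AB; split=> /=; [apply: Ae|apply: Bd]; rewrite /ball /= distrC //.
move=> [e e0 He]; exists (ball x.1 e, ball x.2 e) => /=.
  by split; exact: nbhsx_ballx.
move=> z [/= z1 z2]; apply: He; rewrite /box (distrC z.1) (distrC z.2).
by move: z1 z2; rewrite /ball /= => -> ->.
Qed.

Lemma box_self x e : 0 < e -> box x e x.
Proof. by move=> e0; rewrite /box !subrr normr0 e0. Qed.

Lemma boxE x e z : box x e z =
  [&& x.1 - e < z.1, z.1 < x.1 + e, x.2 - e < z.2 & z.2 < x.2 + e].
Proof. by rewrite /box !ltr_distl -!andbA. Qed.

Lemma box_open x e : open (box x e : set (R * R)).
Proof.
rewrite openE => z bz; have : box x e z by exact: bz.
rewrite boxE => /and4P[z1 z2 z3 z4].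
apply/near_box.
exists (Num.min (Num.min (z.1 - (x.1 - e)) (x.1 + e - z.1))
  (Num.min (z.2 - (x.2 - e)) (x.2 + e - z.2))).
  by rewrite !lt_min !subr_gt0 z1 z2 z3 z4.
move=> w; rewrite {1}/box !lt_min !ltr_distl => ?.
by have : box x e w by rewrite boxE; lra.
Qed.

Lemma near_in_box x e : 0 < e -> \forall z \near x, box x e z.
Proof. by move=> e0; apply/near_box; exists e. Qed.

Definition seg x y (t : R) : R * R :=
  (x.1 + t * (y.1 - x.1), x.2 + t * (y.2 - x.2)).

Lemma seg0 x y : seg x y 0 = x.
Proof. by rewrite /seg !mul0r !addr0 -surjective_pairing. Qed.

Lemma seg1 x y : seg x y 1 = y.
Proof. by rewrite /seg !mul1r !subrKC -surjective_pairing. Qed.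

Definition cvx W := forall x y t, W x -> W y -> 0 <= t <= 1 -> W (seg x y t).

Lemma cnt_seg x z t : cnt (fun a : (R * R) * R => seg x a.1 a.2) (z, t).
Proof.
apply: cnt_pair; apply: cntD; do ?exact: cnt_cst; apply: cntM.
- exact: cnt_snd.
- by apply: cntB; [apply: (@cnt_comp _ _ _ fst fst); exact: cnt_fst|exact: cnt_cst].
- exact: cnt_snd.
- apply: cntB; last exact: cnt_cst.
  by apply: (@cnt_comp _ _ _ fst snd); [exact: cnt_fst|exact: cnt_snd].
Qed.

Lemma cnt_seg1 x y t : cnt (seg x y) t.
Proof.
apply: (@cnt_comp _ _ _ (fun t => (y, t)) (fun a : (R * R) * R => seg x a.1 a.2)).
  by apply: cnt_pair; [exact: cnt_cst|exact: cnt_id].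
exact: cnt_seg.
Qed.

Lemma locst_cvx W (s : R * R -> bool) x y : cvx W -> (forall z, W z -> locst s z) ->
  W x -> W y -> s x = s y.
Proof.
move=> cW sW Wx Wy; rewrite -[x](seg0 x y) -[in RHS](seg1 x y).
apply: locst_path => // t t01; [exact: cnt_seg1|exact: sW (cW _ _ _ Wx Wy t01)].
Qed.

(** Convex sets are contractible, so [homotopy_cocycle] applies. *)
Lemma cvx_trivial W c : open W -> cvx W -> cocycle W c ->
  exists f, trivializes W c f.
Proof.
move=> oW cW cc; have [[w Ww]|W0] := pselect (W !=set0); last first.
  by exists (fun=> false) => x Wx; exfalso; apply: W0; exists x.
have [f Hf] := @homotopy_cocycle R _ _ (seg w) W W c oW cc
  (fun z t Wz t01 => cW _ _ _ Ww Wz t01) (fun z t _ _ => @cnt_seg w z t).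
exists f => x Wx; have := locstD (Hf x Wx) (locst_cst (c w w) x).
by apply: eq_locstW => z; rewrite !seg0 !seg1; xor_ring.
Qed.

(** The double cover of the plane branched at [p], cut along the ray that leaves
    [p] to the right: near a point of the ray, the sheets are exchanged between
    its two sides, so the local trivialization there is the indicator of the
    upper side. *)
Definition kappa p x z : bool := [&& p.1 < x.1, x.2 == p.2 & p.2 <= z.2].

Lemma near_gt1 x a : a < x.1 -> \forall z \near x, a < z.1.
Proof. by move=> ax; apply: (cnt_fst (lt_nbhsr ax)). Qed.
Lemma near_lt1 x a : x.1 < a -> \forall z \near x, z.1 < a.
Proof. by move=> ax; apply: (cnt_fst (lt_nbhsl ax)). Qed.
Lemma near_gt2 x a : a < x.2 -> \forall z \near x, a < z.2.
Proof. by move=> ax; apply: (cnt_snd (lt_nbhsr ax)). Qed.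
Lemma near_lt2 x a : x.2 < a -> \forall z \near x, z.2 < a.
Proof. by move=> ax; apply: (cnt_snd (lt_nbhsl ax)). Qed.

Lemma kappa_far p x : ~~ ((p.1 < x.1) && (x.2 == p.2)) -> kappa p x =1 fun=> false.
Proof. by move=> /negbTE nr z; rewrite /kappa andbA nr. Qed.

Lemma near_not_ray p x : x <> p -> ~~ ((p.1 < x.1) && (x.2 == p.2)) ->
  \forall y \near x, ~~ ((p.1 < y.1) && (y.2 == p.2)).
Proof.
move=> xp nr; have [x2|x2|x2] := ltgtP x.2 p.2.
- by apply: filterS (near_lt2 x2) => y y2; rewrite negb_and (lt_eqF y2) orbT.
- by apply: filterS (near_gt2 x2) => y y2; rewrite negb_and (gt_eqF y2) orbT.
- move: nr; rewrite x2 eqxx andbT -leNgt le_eqVlt => /orP[/eqP x1|x1].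
    by exfalso; apply: xp; rewrite [x]surjective_pairing [p]surjective_pairing x1 x2.
  by apply: filterS (near_lt1 x1) => y y1; rewrite negb_and -leNgt ltW.
Qed.

Lemma locst_ge2 a x : x.2 != a -> locst (fun z => a <= z.2) x.
Proof.
move=> x2; have [x2a|x2a|x2a] := ltgtP x.2 a.
- by apply: (@locstP _ _ _ false); apply: filterS (near_lt2 x2a) => z za; rewrite leNgt za.
- by apply: (@locstP _ _ _ true); apply: filterS (near_gt2 x2a) => z za; rewrite ltW.
- by rewrite x2a eqxx in x2.
Qed.

Lemma kappa_cocycle p : cocycle (~` [set p]) (kappa p).
Proof.
move=> x /= xp; have [/andP[x1 /eqP x2]|nr] := boolP ((p.1 < x.1) && (x.2 == p.2)).
  apply: filterS (near_gt1 x1) => y y1.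
  have [y2|y2] := eqVneq y.2 p.2.
    apply: eq_locstW (locst_cst false y) => z.
    by rewrite /kappa x1 y1 x2 y2 eqxx addbb.
  apply: eq_locstW (locst_ge2 y2) => z.
  by rewrite /kappa x1 x2 eqxx (negbTE y2) andbF addbF.
apply: filterS (near_not_ray xp nr) => y nry.
by apply: eq_locstW (locst_cst false y) => z; rewrite (kappa_far nr) (kappa_far nry).
Qed.

End Plane.

(** * Classes of the punctured plane *)

Section Glue.
Variable T : topologicalType.
Implicit Types (U V : set T) (c : T -> T -> bool) (f g : T -> bool).

Lemma trivializes_diff c f g x : locst (fun z => f z (+) c x z) x ->
  locst (fun z => g z (+) c x z) x -> locst (fun z => f z (+) g z) x.
Proof. by move=> fx gx; apply: eq_locstW (locstD fx gx) => z; xor_ring. Qed.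

Lemma trivializes_glue U V c f g b : open U -> open V ->
  trivializes U c f -> trivializes V c g ->
  (forall z, U z -> V z -> f z (+) g z = b) ->
  exists h, [/\ trivializes (U `|` V) c h, forall z, U z -> h z = f z &
    forall z, V z -> h z = g z (+) b].
Proof.
move=> oU oV fU gV fg.
pose h z := if `[< U z >] then f z else g z (+) b.
have hU z : U z -> h z = f z by rewrite /h; case: asboolP.
have hV z : V z -> h z = g z (+) b.
  by rewrite /h; case: asboolP => // Uz Vz; rewrite -(fg z Uz Vz); xor_ring.
exists h; split=> // x [Ux|Vx].
  apply: eq_locst (fU x Ux); have : \forall z \near x, U z by exact: open_nbhs_nbhs.
  by apply: filterS => z /hU ->.
apply: eq_locst (locstD (gV x Vx) (locst_cst b x)).
have : \forall z \near x, V z by exact: open_nbhs_nbhs.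
by apply: filterS => z /hV ->; xor_ring.
Qed.

End Glue.

Section Plane.
Variable R : realType.
Implicit Types (x y z p q w : R * R) (W : set (R * R)).

Lemma open_gt1 (a : R) : open [set z : R * R | a < z.1].
Proof. by rewrite openE => z az; have := @near_gt1 R z a az. Qed.
Lemma open_lt1 (a : R) : open [set z : R * R | z.1 < a].
Proof. by rewrite openE => z az; have := @near_lt1 R z a az. Qed.
Lemma open_gt2 (a : R) : open [set z : R * R | a < z.2].
Proof. by rewrite openE => z az; have := @near_gt2 R z a az. Qed.
Lemma open_lt2 (a : R) : open [set z : R * R | z.2 < a].
Proof. by rewrite openE => z az; have := @near_lt2 R z a az. Qed.

Lemma cvxI W W' : cvx W -> cvx W' -> cvx (W `&` W').
Proof.
by move=> cW cW' x y t [? ?] [? ?] t01; split; [apply: cW|apply: cW'].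
Qed.

Lemma mid_lt (a b c t : R) : 0 <= t <= 1 -> a < b -> a < c -> a < b + t * (c - b).
Proof.
move=> /andP[t0 t1] ab ac.
have : 0 <= (1 - t) * (b - a) by rewrite mulr_ge0 ?subr_ge0// ltW.
have : 0 <= t * (c - a) by rewrite mulr_ge0 ?subr_ge0// ltW.
have [->|t_neq1] := eqVneq t 1; first by rewrite mul1r; lra.
have : 0 < (1 - t) * (b - a) by rewrite mulr_gt0 ?subr_gt0// lt_neqAle t_neq1.
lra.
Qed.

Lemma mid_gt (a b c t : R) : 0 <= t <= 1 -> b < a -> c < a -> b + t * (c - b) < a.
Proof.
move=> t01 ba ca; have := @mid_lt (- a) (- b) (- c) t t01.
by rewrite !ltrN2 => /(_ ba ca); lra.
Qed.

Lemma cvx_gt1 (a : R) : cvx [set z : R * R | a < z.1].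
Proof. by move=> x y t /= *; exact: mid_lt. Qed.
Lemma cvx_lt1 (a : R) : cvx [set z : R * R | z.1 < a].
Proof. by move=> x y t /= *; exact: mid_gt. Qed.
Lemma cvx_gt2 (a : R) : cvx [set z : R * R | a < z.2].
Proof. by move=> x y t /= *; exact: mid_lt. Qed.
Lemma cvx_lt2 (a : R) : cvx [set z : R * R | z.2 < a].
Proof. by move=> x y t /= *; exact: mid_gt. Qed.

Lemma cvx_box x e : cvx (box x e : set (R * R)).
Proof.
move=> y z t by_ bz t01.
have {by_} : box x e y by exact: by_.
have {bz} : box x e z by exact: bz.
have : box x e y -> box x e z -> box x e (seg y z t); last by move=> h bz by_; exact: h.
rewrite !boxE => /and4P[? ? ? ?] /and4P[? ? ? ?].
by apply/and4P; split; [apply: mid_lt|apply: mid_gt|apply: mid_lt|apply: mid_gt].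
Qed.

Lemma const_cvx W (s : R * R -> bool) : cvx W -> (forall z, W z -> locst s z) ->
  exists b, forall z, W z -> s z = b.
Proof.
move=> cW sW; have [[w Ww]|W0] := pselect (W !=set0).
  by exists (s w) => z Wz; exact: (locst_cvx cW sW).
by exists false => z Wz; exfalso; apply: W0; exists z.
Qed.

Lemma trivializes_sub (T : topologicalType) (V V' : set T) c f : V' `<=` V ->
  trivializes V c f -> trivializes V' c f.
Proof. by move=> VV fV x /VV; exact: fV. Qed.

Lemma cocycle_sub (T : topologicalType) (V V' : set T) c : V' `<=` V ->
  cocycle V c -> cocycle V' c.
Proof. by move=> VV fV x /VV; exact: fV. Qed.

(** The punctured convex set is a union of a left, an upper, a lower and a right
    convex part. The first three glue without obstruction to a slit set, which
    meets the right part in an upper and a lower piece: the only freedom is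
    whether the two transition constants agree. *)
Lemma punctured_class W p c : open W -> cvx W -> cocycle (W `\ p) c ->
  exists f e, trivializes (W `\ p) (fun x z => c x z (+) (e && kappa p x z)) f.
Proof.
move=> oW cW cc.
have piece (H : set (R * R)) : open H -> cvx H -> ~ H p ->
    exists f, trivializes (W `&` H) c f.
  move=> oH cH Hp; apply: cvx_trivial; [exact: openI|exact: cvxI|].
  by apply: cocycle_sub cc => z [Wz Hz]; split=> // zp; rewrite zp in Hz.
have [/=|fL HL] := piece _ (@open_lt1 p.1) (@cvx_lt1 p.1); first by rewrite ltxx.
have [/=|fU HU] := piece _ (@open_gt2 p.2) (@cvx_gt2 p.2); first by rewrite ltxx.
have [/=|fD HD] := piece _ (@open_lt2 p.2) (@cvx_lt2 p.2); first by rewrite ltxx.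
have [/=|fR HR] := piece _ (@open_gt1 p.1) (@cvx_gt1 p.1); first by rewrite ltxx.
have cst2 (H H' : set (R * R)) f g : cvx H -> cvx H' ->
    trivializes (W `&` H) c f -> trivializes (W `&` H') c g ->
    exists b, forall z, (W `&` H) z -> (W `&` H') z -> f z (+) g z = b.
  move=> cH cH' Hf Hg.
  have [|z hz|b hb] := @const_cvx ((W `&` H) `&` (W `&` H')) (fun z => f z (+) g z).
  - by apply: cvxI; apply: cvxI.
  - by case: hz => hz hz'; apply: trivializes_diff (Hf z hz) (Hg z hz').
  - by exists b => z hz hz'; apply: hb.
have [b1 Hb1] := cst2 _ _ _ _ (@cvx_lt1 p.1) (@cvx_gt2 p.2) HL HU.
have oWL : open (W `&` [set z | z.1 < p.1]) by apply: openI => //; exact: open_lt1.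
have oWU : open (W `&` [set z | p.2 < z.2]) by apply: openI => //; exact: open_gt2.
have oWD : open (W `&` [set z | z.2 < p.2]) by apply: openI => //; exact: open_lt2.
have oWR : open (W `&` [set z | p.1 < z.1]) by apply: openI => //; exact: open_gt1.
have [h [Hh hL hU]] := trivializes_glue oWL oWU HL HU Hb1.
have [b2 Hb2] := cst2 _ _ _ _ (@cvx_lt1 p.1) (@cvx_lt2 p.2) HL HD.
have [|k [Hk kLU kD]] := @trivializes_glue _ _ _ c h fD b2 (openU oWL oWU) oWD Hh HD.
  move=> z [[Wz z1]|[Wz z2]] Dz; first by rewrite hL//; apply: Hb2.
  by case: Dz => _ /=; rewrite ltNge (ltW z2).
have [b3 Hb3] := cst2 _ _ _ _ (@cvx_gt2 p.2) (@cvx_gt1 p.1) HU HR.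
have [b4 Hb4] := cst2 _ _ _ _ (@cvx_lt2 p.2) (@cvx_gt1 p.1) HD HR.
have kU z : W z -> p.2 < z.2 -> p.1 < z.1 -> k z = fR z (+) (b1 (+) b3).
  move=> Wz z2 z1; rewrite kLU; last by right.
  by rewrite hU// -(Hb3 z)//; xor_ring.
have kD' z : W z -> z.2 < p.2 -> p.1 < z.1 -> k z = fR z (+) (b2 (+) b4).
  by move=> Wz z2 z1; rewrite kD// -(Hb4 z)//; xor_ring.
(* the two transitions to the right part differ by [e] *)
pose e := (b1 (+) b3) (+) (b2 (+) b4).
pose onray z := (p.1 < z.1) && (z.2 == p.2).
pose F z := if onray z then fR z (+) (b2 (+) b4) (+) e else k z.
exists F, e => x [Wx /= xp].
have [nr|/negPn ray] := boolP (~~ onray x); last first.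
  have /andP[x1 /eqP x2] := ray.
  have nW : \forall z \near x, W z by exact: open_nbhs_nbhs.
  apply: eq_locst (locstD (HR x (conj Wx x1)) (locst_cst (b2 (+) b4) x)).
  apply: filterS2 nW (near_gt1 x1) => z Wz z1.
  rewrite /F /onray z1 /kappa x1 x2 eqxx /=.
  have [z2|z2|z2] := ltgtP z.2 p.2.
  - by rewrite kD'// andbF addbF; xor_ring.
  - by rewrite kU// andbT /e; xor_ring.
  - by rewrite andbT; xor_ring.
have kx : locst (fun z => k z (+) c x z) x.
  apply: Hk; rewrite /onray in nr.
  have [x2|x2|x2] := ltgtP x.2 p.2; [by right|by left; right|].
  left; left; split=> //=.
  rewrite x2 eqxx andbT -leNgt le_eqVlt in nr; case/orP: nr => // /eqP x1.
  by exfalso; apply: xp; rewrite [x]surjective_pairing [p]surjective_pairing x1 x2.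
apply: eq_locst kx; apply: filterS (near_not_ray xp nr) => z nrz.
by rewrite /F /onray (negbTE nrz) kappa_far// andbF addbF.
Qed.

Lemma locst_vert (s : R * R -> bool) (x a b : R) : a <= b ->
  (forall t, a <= t <= b -> locst s (x, t)) -> s (x, a) = s (x, b).
Proof.
move=> ab h; apply: (@locst_path _ _ s (fun t => (x, t)) a b ab) => // t _.
by apply: cnt_pair; [exact: cnt_cst|exact: cnt_id].
Qed.

Lemma locst_horz (s : R * R -> bool) (x a b : R) : a <= b ->
  (forall t, a <= t <= b -> locst s (t, x)) -> s (a, x) = s (b, x).
Proof.
move=> ab h; apply: (@locst_path _ _ s (fun t => (t, x)) a b ab) => // t _.
by apply: cnt_pair; [exact: cnt_id|exact: cnt_cst].
Qed.

Definition square x (r : R) z := Num.max `|z.1 - x.1| `|z.2 - x.2| = r.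

(** Walking once around the square from above the ray to below it, a
    trivialization stays constant, while it must change across the ray. *)
Lemma kappa_loop x p r f : box x r p -> trivializes (square x r) (kappa p) f -> False.
Proof.
rewrite boxE => /and4P[p1 p2 p3 p4] Hf.
have r0 : 0 < r by lra.
have sqE z : square x r z <-> (`|z.1 - x.1| <= r /\ `|z.2 - x.2| <= r /\
    (`|z.1 - x.1| = r \/ `|z.2 - x.2| = r)).
  rewrite /square; case: (leP `|z.1 - x.1| `|z.2 - x.2|) => h.
    split=> [<-|[_ [h2 [h1|//]]]]; first by split=> //; split=> //; right.
    by apply/eqP; rewrite eq_le h2 -h1 h.
  split=> [<-|[h1 [_ [//|h2]]]]; first by split=> //; split; [exact: ltW|left].
  by apply/eqP; rewrite eq_le h1 -h2 ltW.
have off z : square x r z -> ~~ ((p.1 < z.1) && (z.2 == p.2)) -> locst f z.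
  by move=> /Hf fz nr; apply: eq_locstW fz => w; rewrite kappa_far// addbF.
pose w := (x.1 + r, p.2).
have sr t : x.2 - r <= t <= x.2 + r -> square x r (x.1 + r, t).
  move=> /andP[t1 t2]; apply/sqE => /=; rewrite addrAC subrr add0r (gtr0_norm r0).
  by rewrite ler_norml; split; [|split; [lra|left]].
have sl t : x.2 - r <= t <= x.2 + r -> square x r (x.1 - r, t).
  move=> /andP[t1 t2]; apply/sqE => /=; rewrite addrAC subrr add0r normrN (gtr0_norm r0).
  by rewrite ler_norml; split; [|split; [lra|left]].
have su t : x.1 - r <= t <= x.1 + r -> square x r (t, x.2 + r).
  move=> /andP[t1 t2]; apply/sqE => /=; rewrite (addrAC x.2) subrr add0r (gtr0_norm r0).
  by rewrite ler_norml; split; [lra|split; [|right]].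
have sd t : x.1 - r <= t <= x.1 + r -> square x r (t, x.2 - r).
  move=> /andP[t1 t2]; apply/sqE => /=; rewrite (addrAC x.2) subrr add0r normrN (gtr0_norm r0).
  by rewrite ler_norml; split; [lra|split; [|right]].
have /Hf : square x r w by apply: sr; lra.
move=> /near_box[e e0 He].
pose d := Num.min (e / 2) (Num.min (x.2 + r - p.2) (p.2 - (x.2 - r))).
have d0 : 0 < d by rewrite !lt_min; lra.
have [de du dd] : [/\ d <= e / 2, d <= x.2 + r - p.2 & d <= p.2 - (x.2 - r)].
  by split; rewrite /d !ge_min lexx ?orbT.
have up := He (x.1 + r, p.2 + d); have dn := He (x.1 + r, p.2 - d).
have fup : f (x.1 + r, p.2 + d) = f (x.1 + r, x.2 + r).
  apply: locst_vert; first by lra.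
  by move=> t /andP[t1 t2]; apply: off; [apply: sr; lra|rewrite negb_and /= gt_eqF ?orbT//; lra].
have fdn : f (x.1 + r, x.2 - r) = f (x.1 + r, p.2 - d).
  apply: locst_vert; first by lra.
  by move=> t /andP[t1 t2]; apply: off; [apply: sr; lra|rewrite negb_and /= lt_eqF ?orbT//; lra].
have ftop : f (x.1 - r, x.2 + r) = f (x.1 + r, x.2 + r).
  apply: locst_horz; first by lra.
  by move=> t /andP[t1 t2]; apply: off; [apply: su; lra|rewrite negb_and /= gt_eqF ?orbT//; lra].
have fbot : f (x.1 - r, x.2 - r) = f (x.1 + r, x.2 - r).
  apply: locst_horz; first by lra.
  by move=> t /andP[t1 t2]; apply: off; [apply: sd; lra|rewrite negb_and /= lt_eqF ?orbT//; lra].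
have fleft : f (x.1 - r, x.2 - r) = f (x.1 - r, x.2 + r).
  apply: locst_vert; first by lra.
  by move=> t /andP[t1 t2]; apply: off; [apply: sl; lra|rewrite negb_and /= -leNgt; apply/orP; left; lra].
move: up dn; rewrite fup -ftop -fleft fbot fdn.
have kup : kappa p w (x.1 + r, p.2 + d) by rewrite /kappa /= eqxx /=; lra.
have kdn : kappa p w (x.1 + r, p.2 - d) = false.
  by rewrite /kappa /= eqxx /=; apply/negbTE/negP; lra.
rewrite kup kdn !boxE /= => up dn.
have {}up : _ := up ltac:(by apply/and4P; split; lra).
have {}dn : _ := dn ltac:(by apply/and4P; split; lra).
by move: up; rewrite -dn; case: (f _).
Qed.

End Plane.

(** * Mayer-Vietoris splitting; arcs do not separate a square *)

Section Arc.
Variables (R : realType) (T : topologicalType).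
Implicit Type b : R -> T.

Definition arc_set b (u v : R) : set T := [set z | exists2 t, u <= t <= v & b t = z].

Lemma arc_closed b u v : hausdorff_space T -> (forall t, cnt b t) -> closed (arc_set b u v).
Proof.
move=> hT bc; have -> : arc_set b u v = b @` `[u, v].
  by rewrite eqEsubset; split=> [z [t uv <-]|z [t uv <-]]; exists t;
    rewrite //= in_itv /= in uv *.
apply: compact_closed => //; apply: continuous_compact; last exact: segment_compact.
by apply: continuous_subspaceT => t; apply/cntP; exact: bc.
Qed.

Lemma near_off (A : set T) (x : T) : closed A -> ~ A x -> \forall z \near x, ~ A z.
Proof. by move=> cA Ax; apply: open_nbhs_nbhs; split=> //; exact: closed_openC. Qed.

End Arc.

Section MayerVietoris.
Variable T : topologicalType.
Implicit Types (A W : set T) (s f : T -> bool).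

Definition zero_on A s z := if `[< A z >] then false else s z.

Lemma zero_on_near A s x : closed A -> ~ A x -> \forall z \near x, zero_on A s z = s z.
Proof.
by move=> cA Ax; apply: filterS (near_off cA Ax) => z Az; rewrite /zero_on asboolF.
Qed.

(** The connecting map of the Mayer-Vietoris sequence for the complements of
    [A1] and [A2]: near the complement of [A1] it is [s] extended by zero. *)
Definition connecting A1 A2 s (x z : T) := if `[< A1 x >] then false else zero_on A2 s z.

Lemma connecting_cocycle W A1 A2 s : open W -> closed A1 -> closed A2 ->
  (forall x, W x -> ~ A1 x -> ~ A2 x -> locst s x) ->
  cocycle (W `\` (A1 `&` A2)) (connecting A1 A2 s).
Proof.
move=> oW c1 c2 sl x [Wx A12]; have [A1x|A1x] := pselect (A1 x).
  have A2x : ~ A2 x by move=> A2x; apply: A12.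
  have nW : \forall z \near x, W z by exact: open_nbhs_nbhs.
  apply: filterS2 nW (near_off c2 A2x) => y Wy A2y.
  have [A1y|A1y] := pselect (A1 y).
    by apply: eq_locstW (locst_cst false y) => z; rewrite /connecting !asboolT.
  apply: eq_locst (sl y Wy A1y A2y); apply: filterS (zero_on_near s c2 A2y) => z <-.
  by rewrite /connecting asboolT// asboolF.
apply: filterS (near_off c1 A1x) => y A1y.
by apply: eq_locstW (locst_cst false y) => z; rewrite /connecting !asboolF// addbb.
Qed.

Lemma connecting_split W A1 A2 s f (k : T -> T -> bool) : closed A2 ->
  (forall x, W x -> ~ A1 x -> ~ A2 x -> locst s x) ->
  trivializes (W `\` (A1 `&` A2)) (fun x z => connecting A1 A2 s x z (+) k x z) f ->
  [/\ trivializes (W `\` A1) k (fun z => f z (+) zero_on A2 s z),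
      trivializes (W `\` A2) k f &
      forall z, ~ A2 z -> s z = (f z (+) zero_on A2 s z) (+) f z].
Proof.
move=> c2 sl fP; split=> [x [Wx A1x]|x [Wx A2x]|z A2z].
- have : (W `\` (A1 `&` A2)) x by split=> // -[].
  by move=> /fP; apply: eq_locstW => z; rewrite /connecting asboolF//; xor_ring.
- have /fP : (W `\` (A1 `&` A2)) x by split=> // -[].
  have [A1x|A1x] := pselect (A1 x).
    by apply: eq_locstW => z; rewrite /connecting asboolT//; xor_ring.
  move=> h; apply: eq_locst (locstD h (sl x Wx A1x A2x)).
  apply: filterS (zero_on_near s c2 A2x) => z sz.
  by rewrite /connecting asboolF// sz; xor_ring.
- by rewrite /zero_on asboolF//; xor_ring.
Qed.

End MayerVietoris.

Section Plane.
Variable R : realType.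
Implicit Types (x y z p q w : R * R) (W A : set (R * R)) (s f : R * R -> bool).

Lemma plane_hausdorff : hausdorff_space (R * R)%type.
Proof.
move=> p q pq; apply: contrapT => neq.
have [e e0 disj] : exists2 e : R, 0 < e & forall z, box p e z -> box q e z -> False.
  have [p1|p1] := eqVneq p.1 q.1; last first.
    exists (`|p.1 - q.1| / 2); first by rewrite divr_gt0 ?normr_gt0 ?subr_eq0.
    move=> z; rewrite /box => /andP[z1 _] /andP[z2 _].
    by have := ler_distD z.1 p.1 q.1; rewrite (distrC p.1 z.1); lra.
  have p2 : p.2 != q.2.
    by apply/eqP => p2; apply: neq; rewrite [p]surjective_pairing p1 p2 -surjective_pairing.
  exists (`|p.2 - q.2| / 2); first by rewrite divr_gt0 ?normr_gt0 ?subr_eq0.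
  move=> z; rewrite /box => /andP[_ z1] /andP[_ z2].
  by have := ler_distD z.2 p.2 q.2; rewrite (distrC p.2 z.2); lra.
have [z [zp zq]] := pq _ _ (near_in_box p e0) (near_in_box q e0).
exact: disj zp zq.
Qed.

Let pair0 : R * R := (0, 0).

Lemma kappa_transl p x z : kappa p x z = kappa pair0 (x.1 - p.1, x.2 - p.2) (z.1 - p.1, z.2 - p.2).
Proof. by rewrite /kappa /= subr_gt0 subr_eq0 subr_ge0. Qed.

Lemma pairP x y : x.1 = y.1 -> x.2 = y.2 -> x = y.
Proof. by move=> h1 h2; rewrite [x]surjective_pairing h1 h2 -surjective_pairing. Qed.

(** Moving the branch point from one end of a path to the other is a homotopy
    away from the path. *)
Lemma kappa_path (b : R -> R * R) (u v : R) : u <= v -> (forall t, cnt b t) ->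
  exists f, trivializes (~` arc_set b u v)
    (fun x z => kappa (b u) x z (+) kappa (b v) x z) f.
Proof.
move=> uv bc; pose m t := u + t * (v - u).
have muv t : 0 <= t <= 1 -> u <= m t <= v.
  move=> /andP[t0 t1]; rewrite /m lerDl mulr_ge0 ?subr_ge0//=.
  by rewrite -lerBrDl ler_piMl ?subr_ge0.
pose Phi z t : R * R := (z.1 - (b (m t)).1, z.2 - (b (m t)).2).
have bm (a : (R * R) * R) : cnt (fun a : (R * R) * R => b (m a.2)) a.
  apply: (@cnt_comp _ _ _ (fun a : (R * R) * R => m a.2) b); last exact: bc.
  rewrite /m; apply: cntD; first exact: cnt_cst.
  by apply: cntM; [exact: cnt_snd|exact: cnt_cst].
have [||z t Wz t01|z t _ _|f fP] := @homotopy_cocycle R _ _ Phi (~` arc_set b u v)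
  (~` [set pair0]) (kappa pair0).
- by apply: closed_openC; apply: arc_closed => //; exact: plane_hausdorff.
- exact: kappa_cocycle.
- move=> /= [/eqP z1 /eqP z2]; apply: Wz; exists (m t); first exact: muv.
  by rewrite !subr_eq0 in z1 z2; apply: pairP; apply/esym/eqP.
- apply: cnt_pair; apply: cntB.
  + by apply: (@cnt_comp _ _ _ fst fst); exact: cnt_fst.
  + by apply: (@cnt_comp _ _ _ (fun a : (R * R) * R => b (m a.2)) fst); [exact: bm|exact: cnt_fst].
  + by apply: (@cnt_comp _ _ _ fst snd); [exact: cnt_fst|exact: cnt_snd].
  + by apply: (@cnt_comp _ _ _ (fun a : (R * R) * R => b (m a.2)) snd); [exact: bm|exact: cnt_snd].
exists f => x Wx; apply: eq_locstW (fP x Wx) => z.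
have -> : u = m 0 by rewrite /m mul0r addr0.
have -> : v = m 1 by rewrite /m mul1r subrKC.
by rewrite !(kappa_transl _ x z).
Qed.

(** By [punctured_class] the obstruction to a splitting is a multiple [e] of the
    cover branched at the only common point [q] of the two sets. By [kappa_loop]
    it vanishes as soon as a square around [q] avoids one of them. *)
Lemma plane_split W A1 A2 q s : open W -> cvx W -> closed A1 -> closed A2 ->
  A1 q -> (forall z, A1 z -> A2 z -> z = q) ->
  (forall x, W x -> ~ A1 x -> ~ A2 x -> locst s x) ->
  exists s1 s2 e, [/\ trivializes (W `\` A1) (fun x z => e && kappa q x z) s1,
    trivializes ((W `\ q) `\` A2) (fun x z => e && kappa q x z) s2 &
    forall z, ~ A2 z -> s z = s1 z (+) s2 z].
Proof.
move=> oW cW c1 c2 A1q A12 sl.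
have [|f [e fP]] := @punctured_class _ W q (connecting A1 A2 s) oW cW.
  apply: cocycle_sub (connecting_cocycle oW c1 c2 sl) => z [Wz zq].
  by split=> // -[h /(A12 _ h)].
have [||h1 h2 h3] := @connecting_split _ (W `\ q) A1 A2 s f (fun x z => e && kappa q x z) c2.
- by move=> x [Wx _]; exact: sl.
- by move=> x [[Wx xq] _]; apply: fP.
exists (fun z => f z (+) zero_on A2 s z), f, e; split=> //.
by apply: trivializes_sub h1 => z [Wz A1z]; split=> //; split=> // zq; apply: A1z; rewrite zq.
Qed.

Section Outside.
Variables (x a : R * R) (r d e : R) (s : R * R -> bool).
Hypothesis ade : box x (r - e) a.
Hypothesis lt_de : d < e.
Hypothesis d0 : 0 <= d.
Hypothesis sl : forall z, box x r z -> ~~ ((`|z.1 - a.1| <= d) && (`|z.2 - a.2| <= d)) -> locst s z.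

(** The box minus a square is covered by four half-planes, consecutive ones of
    which share a corner of a larger square. *)
Lemma outside_const y : box x r y -> ~~ ((`|y.1 - a.1| <= d) && (`|y.2 - a.2| <= d)) ->
  s y = s (a.1 + e, a.2 + e).
Proof.
have de : d < e by exact: lt_de.
have e0 : 0 < e by exact: le_lt_trans d0 lt_de.
have corner b c : b = e \/ b = - e -> c = e \/ c = - e -> box x r (a.1 + b, a.2 + c).
  move: ade; rewrite !boxE /= => /and4P[? ? ? ?] [|] -> [|] ->; lra.
have half (H : set (R * R)) : cvx H -> (forall z, H z ->
    [|| a.1 + d < z.1, z.1 < a.1 - d, a.2 + d < z.2 | z.2 < a.2 - d]) ->
    forall z w, box x r z -> box x r w -> H z -> H w -> s z = s w.
  move=> cH HP z w bz bw Hz Hw; apply: (@locst_cvx _ (box x r `&` H)) => //.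
    by apply: cvxI => //; exact: cvx_box.
  by move=> v [bv /HP h]; apply: sl => //; rewrite !ler_distl; lra.
have cR := half _ (@cvx_gt1 _ (a.1 + d)) (fun v vh => introT or4P (Or41 _ _ _ vh)).
have cL := half _ (@cvx_lt1 _ (a.1 - d)) (fun v vh => introT or4P (Or42 _ _ _ vh)).
have cU := half _ (@cvx_gt2 _ (a.2 + d)) (fun v vh => introT or4P (Or43 _ _ _ vh)).
have cD := half _ (@cvx_lt2 _ (a.2 - d)) (fun v vh => introT or4P (Or44 _ _ _ vh)).
have bNE : box x r (a.1 + e, a.2 + e) by apply: corner; left.
have bNW : box x r (a.1 - e, a.2 + e) by apply: corner; [right|left].
have bSE : box x r (a.1 + e, a.2 - e) by apply: corner; [left|right].
move=> by_; rewrite !ler_distl => hy.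
have : [|| a.1 + d < y.1, y.1 < a.1 - d, a.2 + d < y.2 | y.2 < a.2 - d] by lra.
move=> /or4P[h|h|h|h].
- by apply: cR => //=; lra.
- by rewrite (cL y (a.1 - e, a.2 + e))//=; [apply: cU => //=; lra|lra].
- by apply: cU => //=; lra.
- by rewrite (cD y (a.1 + e, a.2 - e))//=; [apply: cR => //=; lra|lra].
Qed.

End Outside.

Lemma sq_box x r r' z : square x r z -> r < r' -> box x r' z.
Proof.
rewrite /square /box => <- h; apply/andP; split; apply: le_lt_trans h.
  by rewrite le_max lexx.
by rewrite le_max lexx orbT.
Qed.

Lemma sq_notbox x r z : square x r z -> ~~ box x r z.
Proof. by rewrite /square /box -gt_max => ->; rewrite ltxx. Qed.

Lemma box_excl x q : x <> q -> exists2 r : R, 0 < r & ~~ box x r q.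
Proof.
move=> xq; have [q1|q1] := eqVneq q.1 x.1.
  have q2 : q.2 != x.2 by apply/eqP => q2; apply: xq; apply/esym/pairP.
  exists `|q.2 - x.2|; first by rewrite normr_gt0 subr_eq0.
  by rewrite /box ltxx andbF.
exists `|q.1 - x.1|; first by rewrite normr_gt0 subr_eq0.
by rewrite /box ltxx.
Qed.

Lemma far_neq x w : w <> x -> exists2 d, 0 < d &
  ~~ ((`|w.1 - x.1| <= d) && (`|w.2 - x.2| <= d)).
Proof.
move=> wx; have [d d0 hd] := box_excl (fun e => wx (esym e)).
exists (d / 2); first by lra.
by apply: contra hd => /andP[h1 h2]; apply/andP; split; lra.
Qed.

(** A twist would be seen on a square between the two boxes. *)
Lemma no_twist x q r0 r A e f : r0 < r -> box x r0 q -> A `<=` box x r0 ->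
  trivializes (box x r `\` A) (fun y z => e && kappa q y z) f -> e = false.
Proof.
move=> r0r bq Ab H; apply/negP => et; rewrite et in H; pose r1 := (r0 + r) / 2.
have b1 z : box x r0 z -> box x r1 z by rewrite !boxE /r1 => /and4P[*]; lra.
apply: (kappa_loop (b1 q bq) (f := f)); apply: trivializes_sub H => z sz.
split; first by apply: (sq_box sz); rewrite /r1; lra.
by move=> /Ab/b1 bz; have /negP := sq_notbox sz; apply.
Qed.

Lemma arc_cut (b : R -> R * R) (u w v : R) z : {in `[0, 1] &, injective b} ->
  0 <= u -> v <= 1 -> u <= w <= v ->
  arc_set b u w z -> arc_set b w v z -> z = b w.
Proof.
move=> binj u0 v1 /andP[uw wv] [t /andP[t1 t2] <-] [t' /andP[t'1 t'2] btt'].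
have tt' : t = t' by apply: binj; rewrite ?in_itv /=; [lra|lra|].
by congr b; apply/eqP; rewrite eq_le t2 tt' t'1.
Qed.

(** Two points separated by an arc are separated by one of its halves, as the
    halves meet in a single point and [plane_split] applies; so they would be
    separated by arbitrarily short pieces, which lie in small squares. *)
Lemma arc_nonseparating x (r0 r : R) (b : R -> R * R) s : r0 < r ->
  (forall t, cnt b t) -> {in `[0, 1] &, injective b} ->
  (forall t, 0 <= t <= 1 -> box x r0 (b t)) ->
  (forall z, box x r z -> ~ arc_set b 0 1 z -> locst s z) ->
  forall y y', box x r y -> box x r y' -> ~ arc_set b 0 1 y -> ~ arc_set b 0 1 y' ->
  s y = s y'.
Proof.
move=> r0r bc binj bbox sl y y' Wy Wy' Ay Ay'.
pose P u v := forall s, (forall z, box x r z -> ~ arc_set b u v z -> locst s z) -> s y = s y'.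
suff : P 0 1 by apply.
apply: interval_ind => [t t01|u w v u0 uw wv v1 Puw Pwv {}s {}sl].
  have far z : ~ arc_set b 0 1 z -> exists2 d, 0 < d &
      ~~ ((`|z.1 - (b t).1| <= d) && (`|z.2 - (b t).2| <= d)).
    by move=> Az; apply: far_neq => zb; apply: Az; exists t.
  have [d1 d10 h1] := far y Ay; have [d2 d20 h2] := far y' Ay'.
  pose e := r - r0; have e0 : 0 < e by rewrite subr_gt0.
  pose d := Num.min (Num.min d1 d2) (e / 2).
  have d0 : 0 < d by rewrite !lt_min d10 d20 /=; lra.
  have [dd1 dd2 de] : [/\ d <= d1, d <= d2 & d <= e / 2].
    by split; rewrite /d !ge_min lexx ?orbT.
  have /nbhs_ballP[eps /= eps0 Heps] := bc t _ (near_in_box (b t) d0).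
  exists eps => // u v u0 v1 ue uv ve {}s {}sl.
  have sl' z : box x r z -> ~~ ((`|z.1 - (b t).1| <= d) && (`|z.2 - (b t).2| <= d)) -> locst s z.
    move=> bz hz; apply: sl => // -[t' /andP[ut' t'v] bt'z].
    have : box (b t) d (b t') by apply: Heps; rewrite /ball /= ltr_norml; lra.
    rewrite bt'z /box => /andP[z1 z2].
    by move: hz; rewrite (ltW z1) (ltW z2).
  have bxe : box x (r - e) (b t) by rewrite /e opprB addrC subrK; exact: bbox.
  (* a square of radius [d] contains the short piece but neither [y] nor [y'] *)
  have de' : d < e by lra.
  have out := outside_const bxe de' (ltW d0) sl'.
  rewrite (out y)//; last by apply/negP => /andP[? ?]; move/negP: h1; apply; lra.
  rewrite (out y')//; by apply/negP => /andP[? ?]; move/negP: h2; apply; lra.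
have bt t : u <= t <= v -> box x r0 (b t) by move=> ?; apply: bbox; lra.
have Auw : arc_set b u w (b w) by exists w; rewrite ?uw ?lexx.
have common z : arc_set b u w z -> arc_set b w v z -> z = b w.
  by apply: arc_cut; rewrite ?uw.
have oW : open (box x r : set (R * R)) by exact: box_open.
have cW : cvx (box x r : set (R * R)) by exact: cvx_box.
have c1 : closed (arc_set b u w) by apply: arc_closed => //; exact: plane_hausdorff.
have c2 : closed (arc_set b w v) by apply: arc_closed => //; exact: plane_hausdorff.
have [|s1 [s2 [e [H1 H2 H]]]] := @plane_split _ _ _ (b w) s oW cW c1 c2 Auw common.
  move=> z bz A1z A2z; apply: sl => // -[t /andP[t1 t2] btz].
  by have [tw|wt] := leP t w; [apply: A1z|apply: A2z]; exists t; rewrite ?t1 ?t2 ?(ltW wt).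
have e0 : e = false.
  apply: no_twist r0r _ _ H1; first by apply: bt; rewrite uw.
  by move=> _ [t /andP[t1 t2] <-]; apply: bt; rewrite t1 (le_trans t2).
have s1y : s1 y = s1 y'.
  by apply: Puw => z Wz Az; apply: eq_locstW (H1 z _) => [w'|]; rewrite ?e0 ?addbF.
have s2y : s2 y = s2 y'.
  apply: Pwv => z Wz Az; apply: eq_locstW (H2 z _) => [w'|]; rewrite ?e0 ?addbF//.
  by split=> //; split=> // zb; apply: Az; rewrite zb; exists w; rewrite ?lexx.
have sub z : ~ arc_set b 0 1 z -> ~ arc_set b w v z.
  by move=> h [t /andP[? ?] ?]; apply: h; exists t => //; lra.
by rewrite (H y) ?(H y') ?s1y ?s2y//; exact: sub.
Qed.

End Plane.

(** * Ends of arcs *)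

Section Arms.
Variable R : realType.
Implicit Types (x y z p q w : R * R) (W A : set (R * R)) (s f : R * R -> bool)
  (b : R -> R * R).

Definition arm x b :=
  [/\ forall t, cnt b t, b 0 = x & {in `[0, 1] &, injective b}].

Lemma near_ball (T : topologicalType) (g : R -> T) t (A : set T) : cnt g t -> nbhs (g t) A ->
  exists2 e, 0 < e & forall u, `|u - t| < e -> A (g u).
Proof.
move=> gt /gt /nbhs_ballP[e /= e0 He]; exists e => // u ut.
by apply: He; rewrite /ball /= distrC.
Qed.

Lemma plane_arc_closed b u v : (forall t, cnt b t) -> closed (arc_set b u v).
Proof. by move=> bc; apply: arc_closed => //; exact: plane_hausdorff. Qed.

Lemma initial_nonseparating x (t r0 r : R) b s : 0 < t -> t <= 1 -> r0 < r -> arm x b ->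
  (forall u, 0 <= u <= t -> box x r0 (b u)) ->
  (forall z, box x r z -> ~ arc_set b 0 t z -> locst s z) ->
  exists c, forall z, box x r z -> ~ arc_set b 0 t z -> s z = c.
Proof.
move=> t0 t1 r0r [bc b0 binj] bbox sl.
pose b' u := b (t * u).
have arcE z : arc_set b' 0 1 z <-> arc_set b 0 t z.
  split=> [[u /andP[u0 u1] <-]|[u /andP[u0 u1] <-]].
    by exists (t * u) => //; rewrite mulr_ge0 ?(ltW t0)//= ler_piMr ?(ltW t0).
  exists (u / t); last by rewrite /b' mulrCA divff ?gt_eqF ?mulr1.
  by rewrite divr_ge0 ?(ltW t0)//= ler_pdivrMr ?mul1r.
have b'c u : cnt b' u.
  apply: (@cnt_comp _ _ _ (fun u => t * u) b); last exact: bc.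
  by apply: cntM; [exact: cnt_cst|exact: cnt_id].
have b'inj : {in `[0, 1] &, injective b'}.
  move=> u v; rewrite !in_itv /= => /andP[u0 u1] /andP[v0 v1] /binj.
  have in01 (w : R) : 0 <= w -> w <= 1 -> t * w \in `[0, 1].
    move=> w0 w1; rewrite in_itv /= mulr_ge0 ?(ltW t0)//=.
    by rewrite (le_trans _ t1)// ler_piMr ?(ltW t0).
  by move=> /(_ (in01 _ u0 u1) (in01 _ v0 v1)); apply: mulfI; rewrite gt_eqF.
have b'box u : 0 <= u <= 1 -> box x r0 (b' u).
  move=> /andP[u0 u1]; apply: bbox; rewrite mulr_ge0 ?(ltW t0)//=.
  by rewrite ler_piMr ?(ltW t0).
have sl' z : box x r z -> ~ arc_set b' 0 1 z -> locst s z.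
  by move=> bz Az; apply: sl => // /arcE.
have sc := @arc_nonseparating R x r0 r b' s r0r b'c b'inj b'box sl'.
have [[z0 [bz0 Az0]]|no] := pselect (exists z, box x r z /\ ~ arc_set b' 0 1 z).
  by exists (s z0) => z bz Az; apply: sc => //; move=> /arcE.
by exists false => z bz Az; exfalso; apply: no; exists z; split=> // /arcE.
Qed.

(** Cut the arc near its end [x] and split the function accordingly: the short
    initial piece does not separate a square around it, so the first summand is
    constant, and the second is constant near [x], which the rest avoids. *)
Lemma arc_end x (r : R) b s : 0 < r -> arm x b ->
  (forall z, box x r z -> ~ arc_set b 0 1 z -> locst s z) ->
  exists c, \forall z \near x, ~ arc_set b 0 1 z -> s z = c.
Proof.
move=> r0 xb sl; have [bc b0 binj] := xb.
have r20 : 0 < r / 2 by lra.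
have r2r : r / 2 < r by lra.
have [|e e0 He] := near_ball (bc 0) (A := box x (r / 2)).
  by rewrite b0; exact: near_in_box.
pose t := Num.min (e / 2) 1.
have t0 : 0 < t by rewrite lt_min ltr01 andbT; lra.
have [te t1] : t <= e / 2 /\ t <= 1 by split; rewrite /t ge_min lexx ?orbT.
have bt u : 0 <= u <= t -> box x (r / 2) (b u).
  by move=> ?; apply: He; rewrite subr0 ger0_norm; lra.
have At : arc_set b 0 t (b t) by exists t; rewrite ?lexx ?(ltW t0).
have common z : arc_set b 0 t z -> arc_set b t 1 z -> z = b t.
  by apply: arc_cut; rewrite ?(ltW t0).
have oW : open (box x r : set (R * R)) by exact: box_open.
have cW : cvx (box x r : set (R * R)) by exact: cvx_box.
have [|s1 [s2 [e' [H1 H2 H]]]] := @plane_split _ _ _ _ (b t) s oW cW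
  (@plane_arc_closed b 0 t bc) (@plane_arc_closed b t 1 bc) At common.
  move=> z bz A1z A2z; apply: sl => // -[u /andP[u1 u2] buz].
  by have [ut|tu] := leP u t; [apply: A1z|apply: A2z]; exists u; rewrite ?u1 ?u2 ?(ltW tu).
have e'0 : e' = false.
  apply: no_twist r2r _ _ H1; first by apply: bt; rewrite lexx (ltW t0).
  by move=> _ [u ut <-]; exact: bt.
have [|c Hc] := @initial_nonseparating x t (r / 2) r b s1 t0 t1 r2r xb bt.
  by move=> z Wz Az; apply: eq_locstW (H1 z _) => [w'|]; rewrite ?e'0 ?addbF.
have A2x : ~ arc_set b t 1 x.
  move=> [u /andP[u1 u2] bux].
  have u0 : u = 0 by apply: binj; rewrite ?in_itv /=; [lra|lra|rewrite b0].
  by rewrite u0 in u1; lra.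
have s2x : locst s2 x.
  apply: eq_locstW (H2 x _) => [w'|]; rewrite ?e'0 ?addbF//.
  split=> //; split; first exact: box_self.
  by move=> xb'; apply: A2x; exists t; rewrite ?lexx.
exists (c (+) s2 x); apply: filterS2 s2x (near_in_box x r0) => z s2z bz Az.
have A1z : ~ arc_set b 0 t z by move=> [u ut buz]; apply: Az; exists u => //; lra.
have A2z : ~ arc_set b t 1 z by move=> [u ut buz]; apply: Az; exists u => //; lra.
by rewrite H// Hc// s2z.
Qed.

Lemma arc_bounded b : (forall t, cnt b t) ->
  exists M, forall t, 0 <= t <= 1 -> box (b 0) M (b t).
Proof.
move=> bc; pose P u v := exists M, forall t, u <= t <= v -> box (b 0) M (b t).
apply: (@interval_ind _ P) => [t t01|u w v u0 uw wv v1 [M HM] [N HN]].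
  have [e e0 He] := near_ball (bc t) (near_in_box (b t) ltr01).
  exists e => // u v u0 v1 ue uv ve.
  exists (1 + `|(b t).1 - (b 0).1| + `|(b t).2 - (b 0).2|) => t' ut'.
  have : box (b t) 1 (b t') by apply: He; rewrite ltr_norml; lra.
  rewrite /box => /andP[h1 h2].
  have := ler_distD (b t).1 (b t').1 (b 0).1; have := ler_distD (b t).2 (b t').2 (b 0).2.
  have := normr_ge0 ((b t).1 - (b 0).1); have := normr_ge0 ((b t).2 - (b 0).2).
  by move=> ? ? ? ?; apply/andP; split; lra.
exists (Num.max M N) => t /andP[ut tv].
have [tw|wt] := leP t w.
  have := HM t; rewrite ut tw => /(_ isT); rewrite /box !lt_max => /andP[-> ->].
  by [].
have := HN t; rewrite (ltW wt) tv => /(_ isT); rewrite /box !lt_max => /andP[-> ->].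
by rewrite !orbT.
Qed.

End Arms.

(** * The function of an arm *)

Section Star.
Variable R : realType.
Implicit Types (x y z p q w : R * R) (W A : set (R * R)) (s f : R * R -> bool)
  (b : R -> R * R).

(** Move the branch point from [x] along the arm out of a box: this trivializes
    in the box, off the arm, the cover branched at [x]. The trivialization jumps
    at every point [y] of the arm: otherwise those that are obtained by moving
    the branch point from [x] to [y] and from [y] to the other end would glue to
    a trivialization of the cover branched at [y] around [y], against
    [kappa_loop]. *)
Lemma arm_function x b : arm x b -> exists F (r : R),
  [/\ 0 < r,
      forall y, box x r y -> ~ arc_set b 0 1 y -> locst (fun z => F z (+) kappa x y z) y &
      forall t c, 0 < t < 1 -> box x r (b t) ->
        ~ \forall z \near b t, ~ arc_set b 0 1 z -> F z (+) kappa x (b t) z = c].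
Proof.
move=> xb; have [bc b0 binj] := xb.
have b_neq u v : 0 <= u <= 1 -> 0 <= v <= 1 -> u != v -> b u <> b v.
  by move=> u01 v01 /eqP uv /binj h; apply: uv; apply: h; rewrite in_itv.
have xq : x <> b 1 by rewrite -b0; apply: b_neq; rewrite ?lexx ?ler01// eq_sym oner_eq0.
have [r r0 qr] := box_excl xq.
have [F0 HF0] := kappa_path ler01 bc; rewrite b0 in HF0.
have [g Hg] : exists g, trivializes (box x r) (kappa (b 1)) g.
  apply: cvx_trivial; [exact: box_open|exact: cvx_box|].
  apply: cocycle_sub (@kappa_cocycle R (b 1)) => z bz /= zq.
  by move: qr; rewrite -zq => /negP; apply; exact: bz.
exists (fun z => F0 z (+) g z), r; split=> // [y by_ Ay|t c /andP[t0 t1] bt Hc].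
  by apply: eq_locstW (locstD (HF0 y Ay) (Hg y by_)) => z; xor_ring.
pose y := b t; rewrite -/y in bt Hc *.
have yx : y <> x by rewrite -b0; apply: b_neq; rewrite ?lexx ?ler01 ?(ltW t0) ?(ltW t1)// gt_eqF.
have [f1 Hf1] := kappa_path (ltW t0) bc; rewrite b0 -/y in Hf1.
have [f2 Hf2] := kappa_path (ltW t1) bc; rewrite -/y in Hf2.
have sub1 z : ~ arc_set b 0 1 z -> ~ arc_set b 0 t z.
  by move=> h [u ? ?]; apply: h; exists u => //; lra.
have sub2 z : ~ arc_set b 0 1 z -> ~ arc_set b t 1 z.
  by move=> h [u ? ?]; apply: h; exists u => //; lra.
have sub12 z : ~ arc_set b 0 t z -> ~ arc_set b t 1 z -> ~ arc_set b 0 1 z.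
  move=> h1 h2 [u /andP[u0 u1] bu].
  by have [ut|tu] := leP u t; [apply: h1|apply: h2]; exists u; rewrite ?u0 ?u1 ?(ltW tu).
have common z : arc_set b 0 t z -> arc_set b t 1 z -> z = y.
  by apply: arc_cut; rewrite ?(ltW t0) ?(ltW t1).
have c1 := @plane_arc_closed R b 0 t bc; have c2 := @plane_arc_closed R b t 1 bc.
have [M HM] := arc_bounded bc; rewrite b0 in HM.
have MM : M < M + 1 by lra.
have [|d Hd] := @initial_nonseparating R x 1 M (M + 1) b
    (fun z => F0 z (+) (f1 z (+) f2 z)) ltr01 (lexx _) MM xb HM.
  move=> z _ Az; have A1z := sub1 z Az; have A2z := sub2 z Az.
  apply: eq_locstW (locstD (HF0 z Az) (locstD (Hf1 z A1z) (Hf2 z A2z))) => w.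
  by xor_ring.
have yM : box x (M + 1) y by have := HM t; rewrite (ltW t0) (ltW t1) !boxE => /(_ isT) /and4P[? ? ? ?]; lra.
have nb : \forall z \near y, box x r z.
  by apply: open_nbhs_nbhs; split=> //; exact: box_open.
have nM : \forall z \near y, box x (M + 1) z.
  by apply: open_nbhs_nbhs; split=> //; exact: box_open.
have key : \forall z \near y, ~ arc_set b 0 1 z ->
    f1 z (+) kappa x y z = (f2 z (+) g z) (+) (c (+) d).
  apply: filterS2 nM Hc => z bz Hz Az; rewrite -(Hz Az) -(Hd z bz Az).
  by xor_ring.
have kk : \forall z \near y, locst (fun w => kappa x y w (+) kappa x z w) z.
  exact: (kappa_cocycle yx).
pose h z := if `[< arc_set b 0 t z >] then (f2 z (+) g z) (+) (c (+) d) else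
  f1 z (+) kappa x y z.
have : \forall z \near y, z <> y -> locst (fun w => h w (+) kappa y z w) z.
  have key' := near_join key.
  apply: filterS3 (filterI nb key') nM kk => z [bz kz] _ kkz zy.
  have [A1z|A1z] := pselect (arc_set b 0 t z); last first.
    apply: eq_locst (locstD (Hf1 z A1z) kkz).
    by apply: filterS (near_off c1 A1z) => w A1w; rewrite /h asboolF//; xor_ring.
  have A2z : ~ arc_set b t 1 z by move=> /(common _ A1z).
  apply: eq_locst (locstD (locstD (Hf2 z A2z) (Hg z bz)) (locst_cst (c (+) d) z)).
  apply: filterS2 kz (near_off c2 A2z) => w kw A2w; rewrite /h.
  by case: asboolP => A1w; [|rewrite kw; last exact: sub12]; xor_ring.
move=> /near_box[e e0 He]; have e20 : 0 < e / 2 by lra.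
apply: (@kappa_loop R y y (e / 2) h); first exact: box_self.
move=> z sz; apply: He.
  by apply: (sq_box sz); lra.
by move=> zy; have /negP := sq_notbox sz; apply; rewrite zy; exact: box_self.
Qed.

End Star.

(** * Stars in the plane *)

Section Star.
Variable R : realType.
Implicit Types (y z p q w : R * R) (W A : set (R * R)) (s f : R * R -> bool).

Variables (x : R * R) (I : finType) (b : I -> R -> R * R).
Hypothesis armb : forall i, arm x (b i).
Hypothesis disj : forall i j z, i != j -> arc_set (b i) 0 1 z -> arc_set (b j) 0 1 z -> z = x.

Let K i := arc_set (b i) 0 1.

Let Kclosed i : closed (K i).
Proof. by apply: plane_arc_closed; have [] := armb i. Qed.

Let Kx i : K i x.
Proof. by exists 0; [rewrite lexx ler01|have [] := armb i]. Qed.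

Lemma near_off_arms (J : seq I) y : (forall i, i \in J -> ~ K i y) ->
  \forall z \near y, forall i, i \in J -> ~ K i z.
Proof.
by move=> Jy; apply: near_seq => i iJ; exact: near_off (@Kclosed i) (Jy i iJ).
Qed.

Lemma finite_radius (P : I -> R -> Prop) : (forall i, exists2 r, 0 < r & P i r) ->
  (forall i r r', r' <= r -> 0 < r' -> P i r -> P i r') ->
  exists2 r, 0 < r & forall i, P i r.
Proof.
move=> Pr Pmon; have [r rP] := choice (fun i => let: ex_intro2 r r0 Pr := Pr i in ex_intro (fun r => 0 < r /\ P i r) r (conj r0 Pr)).
suff [e e0 He] : exists2 e, 0 < e & forall i, i \in enum I -> e <= r i.
  exists e => // i; have [_ Pi] := rP i; apply: Pmon Pi => //.
  by apply: He; rewrite mem_enum.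
elim: (enum I) => [|i J [e e0 He]]; first by exists 1.
exists (Num.min e (r i)); first by rewrite lt_min e0; have [] := rP i.
by move=> j; rewrite inE ge_min => /orP[/eqP->|/He->]; rewrite ?lexx ?orbT.
Qed.

Lemma box_mono p (r r' : R) z : r' <= r -> box p r' z -> box p r z.
Proof. by rewrite /box => rr /andP[h1 h2]; rewrite !(lt_le_trans _ rr). Qed.

Lemma punctured_const (r : R) s : (forall z, box x r z -> z <> x -> locst s z) ->
  forall z z', box x r z -> box x r z' -> z <> x -> z' <> x -> s z = s z'.
Proof.
move=> sl z z' bz bz' zx z'x.
have r0 : 0 < r by move: bz; rewrite boxE => /and4P[*]; lra.
have [d1 d10 h1] := far_neq zx; have [d2 d20 h2] := far_neq z'x.
pose d := Num.min (Num.min d1 d2) (r / 4).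
have d0 : 0 < d by rewrite !lt_min d10 d20 /=; lra.
have [dd1 dd2 dr] : [/\ d <= d1, d <= d2 & d <= r / 4].
  by split; rewrite /d !ge_min lexx ?orbT.
have bx : box x (r - r / 2) x by apply: box_self; lra.
have dr' : d < r / 2 by lra.
have out := @outside_const R x x r d (r / 2) s bx dr' (ltW d0).
have sl' w : box x r w -> ~~ ((`|w.1 - x.1| <= d) && (`|w.2 - x.2| <= d)) -> locst s w.
  move=> bw hw; apply: sl => // wx; move: hw.
  by rewrite wx !subrr normr0 (ltW d0).
rewrite (out sl' z)//; last by apply/negP => /andP[? ?]; move/negP: h1; apply; lra.
rewrite (out sl' z')//; by apply/negP => /andP[? ?]; move/negP: h2; apply; lra.
Qed.

Let F i : R * R -> bool := sval (cid (arm_function (armb i))).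

Let F_spec i (r : R) := (forall y, box x r y -> ~ K i y -> locst (fun z => F i z (+) kappa x y z) y) /\
  (forall t c, 0 < t < 1 -> box x r (b i t) ->
        ~ \forall z \near b i t, ~ K i z -> F i z (+) kappa x (b i t) z = c).

Let F_radius : exists2 r, 0 < r & forall i, F_spec i r.
Proof.
apply: finite_radius => [i|i r r' rr r'0 [h1 h2]].
  by rewrite /F_spec /F; case: cid => /= f [r [r0 h1 h2]]; exists r.
split=> [y /(box_mono rr)|t c t01 /(box_mono rr)]; [exact: h1|exact: h2].
Qed.

Definition arm_sum (J : {set I}) z := \big[addb/false]_(i in J) F i z.

Lemma locst_arm_sum_twisted r (J : {set I}) y : (forall i, F_spec i r) -> box x r y ->
  (forall i, i \in J -> ~ K i y) ->
  locst (fun z => arm_sum J z (+) (odd #|J| && kappa x y z)) y.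
Proof.
move=> rP by_ JK.
suff H (L : seq I) : (forall i, i \in L -> ~ K i y) ->
    locst (fun z => \big[addb/false]_(i <- L) F i z (+) (odd (size L) && kappa x y z)) y.
  have : locst (fun z => \big[addb/false]_(i <- enum J) F i z (+)
      (odd (size (enum J)) && kappa x y z)) y.
    by apply: H => i; rewrite mem_enum; exact: JK.
  by rewrite -cardE; apply: eq_locstW => z; rewrite /arm_sum big_enum.
elim: L => [|i L IH] LK.
  by apply: eq_locstW (locst_cst false y) => z; rewrite big_nil.
have [Fi _] := rP i.
have /Fi hi : ~ K i y by apply: LK; rewrite mem_head.
have {}IH := IH (fun j jL => LK j (mem_behead (s := i :: L) jL)).
apply: eq_locstW (locstD (hi by_) IH) => z; rewrite big_cons /=.
by case: (odd _); xor_ring.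
Qed.

Lemma box_nbhs (p z : R * R) (r : R) : box p r z -> \forall w \near z, box p r w.
Proof. by move=> bz; apply: open_nbhs_nbhs; split=> //; exact: box_open. Qed.

Lemma jump_arm_sum r (J : {set I}) j t c : (forall i, F_spec i r) -> ~~ odd #|J| ->
  0 < t < 1 -> box x r (b j t) -> j \in J ->
  ~ \forall z \near b j t, (forall i, ~ K i z) -> arm_sum J z = c.
Proof.
move=> rP Jeven t01 bt jJ Hc; have /andP[t0 t1] := t01.
have [_ nojump] := rP j.
have [bc b0 binj] := armb j.
have y_neq : b j t <> x.
  rewrite -b0 => /binj h; have : t = 0 by apply: h; rewrite in_itv /=; lra.
  by move=> t00; rewrite t00 ltxx in t0.
have Kjt : K j (b j t) by exists t => //; lra.
have offK i : i != j -> ~ K i (b j t) by move=> ij Ki; apply: y_neq; apply: disj ij Ki Kjt.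
have JK i : i \in J :\ j -> ~ K i (b j t) by rewrite !inE => /andP[/offK].
have := locst_arm_sum_twisted rP bt JK.
have -> : odd #|J :\ j| = true.
  by move: Jeven; rewrite (cardsD1 j J) jJ add1n /= negbK => ->.
rewrite /locst /=; set d := arm_sum _ (b j t) (+) _ => Hd.
apply: (nojump t (c (+) d) t01 bt).
have nL : \forall z \near b j t, forall i, i \in enum (predC1 j) -> ~ K i z.
  by apply: near_off_arms => i; rewrite mem_enum !inE; exact: offK.
apply: filterS3 Hc Hd nL => z Hc Hd Kz Kjz.
have Kz' i : ~ K i z.
  by have [->|ij] := eqVneq i j => //; apply: Kz; rewrite mem_enum !inE.
rewrite -(Hc Kz') -Hd /arm_sum (big_setD1 j) //=.
by xor_ring.
Qed.

(** Arms are split off one at a time. The rest may be twisted ([e]) around [x],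
    which is a trivialization of the branched cover, even if [s] is not: then
    the arm function of the arm that is split off absorbs the twist. *)
Lemma star_decompose r (L : seq I) e s : (forall i, F_spec i r) -> uniq L ->
  forall r', 0 < r' -> r' <= r ->
  (forall y, box x r' y -> y <> x -> (forall i, i \in L -> ~ K i y) ->
     locst (fun z => s z (+) (e && kappa x y z)) y) ->
  exists (J : {set I}) c, [/\ {subset J <= L}, odd #|J| = e &
    \forall z \near x, z <> x -> (forall i, i \in L -> ~ K i z) -> s z = arm_sum J z (+) c].
Proof.
move=> rP; elim: L e s => [|j L IH] e s uL r' r'0 r'r sl.
  have r'2 : r' / 2 < r' by lra.
  case: e sl => sl.
    exfalso; have bx : box x (r' / 2) x by apply: box_self; lra.
    apply: (kappa_loop bx (f := s)) => z sz.
    have zx : z <> x by move=> zx; have /negP := sq_notbox sz; apply; rewrite zx.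
    by apply: eq_locstW (sl z (sq_box sz r'2) zx _) => // i.
  have sl' z : box x r' z -> z <> x -> locst s z.
    by move=> bz zx; apply: eq_locstW (sl z bz zx _) => [w|//]; rewrite /= addbF.
  pose z0 : R * R := (x.1 + r' / 2, x.2).
  have bz0 : box x r' z0 by rewrite boxE /z0 /=; lra.
  have z0x : z0 <> x by move=> /(congr1 fst) /=; lra.
  exists finset.set0, (s z0); split=> [i|//|]; rewrite ?inE ?cards0//.
  apply: filterS (near_in_box x r'0) => z bz zx _.
  rewrite /arm_sum big_pred0 => [|i]; last by rewrite inE.
  by rewrite /=; exact: (punctured_const sl').
move: uL => /= /andP[jL uL].
(* [s'] has no twist: a twist is absorbed by the function of the arm [j] *)
pose s' z := s z (+) (e && F j z).
have [Fj _] := rP j.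
have s'l y : box x r' y -> y <> x -> ~ K j y -> (forall i, i \in L -> ~ K i y) -> locst s' y.
  move=> by_ yx Kj KL.
  have sly : locst (fun z => s z (+) (e && kappa x y z)) y.
    by apply: sl => // i; rewrite inE => /orP[/eqP->|/KL].
  rewrite /s'; case: e sl sly {s'} => sl sly; last by apply: eq_locstW sly => z; xor_ring.
  by apply: eq_locstW (locstD sly (Fj y (box_mono r'r by_) Kj)) => z; xor_ring.
pose A2 : set (R * R) := [set z | exists2 i, i \in L & K i z].
have cA2 : closed A2.
  rewrite -[A2]setCK; apply: open_closedC; rewrite openE => z Az.
  have : \forall w \near z, forall i, i \in L -> ~ K i w.
    by apply: near_off_arms => i iL Ki; apply: Az; exists i.
  by apply: filterS => w Kw [i iL Ki]; exact: Kw Ki.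
have common z : K j z -> A2 z -> z = x.
  move=> Kj [i iL Ki]; apply: disj Kj Ki.
  by apply: contra jL => /eqP->.
have oW : open (box x r' : set (R * R)) by exact: box_open.
have cW : cvx (box x r' : set (R * R)) by exact: cvx_box.
have [|s1 [s2 [d [H1 H2 H]]]] := @plane_split R (box x r') (K j) A2 x s' oW cW (@Kclosed j) cA2 (@Kx j) common.
  move=> z bz Kz A2z; apply: s'l => //; first by move=> zx; apply: Kz; rewrite zx.
  by move=> i iL Ki; apply: A2z; exists i.
have [c1 Hc1] : exists c1, \forall z \near x, ~ K j z -> s1 z (+) (d && F j z) = c1.
  apply: (@arc_end R x r' (b j) _ r'0 (armb j)) => z bz Kz.
  have := H1 z (conj bz Kz); case: (d) => h; last by apply: eq_locstW h => w; xor_ring.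
  by apply: eq_locstW (locstD h (Fj z (box_mono r'r bz) Kz)) => w; xor_ring.
have [|J [c2 [JL Jd HJ]]] := IH d s2 uL r' r'0 r'r.
  by move=> y by_ yx KL; apply: H2; split=> // -[i iL Ki]; exact: KL Ki.
have jJ : j \notin J by apply: contra jL => /JL.
pose J' := if d (+) e then j |: J else J.
exists J', (c1 (+) c2); split.
- move=> i; rewrite /J'; case: ifP => _; last by move=> /JL; rewrite inE orbC => ->.
  by rewrite !inE => /orP[->//|/JL->]; rewrite orbT.
- rewrite /J'; case: ifP => de; rewrite ?cardsU1 ?jJ /= Jd.
    by move: de; case: (d); case: (e).
  by move: de; case: (d); case: (e).
apply: filterS2 Hc1 HJ => z Hz1 Hz2 zx KL.
have Kj : ~ K j z by apply: KL; rewrite mem_head.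
have KL' i : i \in L -> ~ K i z by move=> iL; apply: KL; rewrite inE iL orbT.
have A2z : ~ A2 z by move=> [i iL Ki]; exact: KL' iL Ki.
have := H z A2z; rewrite /s' (Hz2 zx KL') => sE.
have s1E : s1 z = c1 (+) (d && F j z) by rewrite -(Hz1 Kj); xor_ring.
have -> : arm_sum J' z = ((d (+) e) && F j z) (+) arm_sum J z.
  by rewrite /J'; case: (d (+) e) => //; rewrite /arm_sum big_setU1.
move: sE; rewrite s1E; move: (s z) (F j z) (arm_sum J z).
by case: (d); case: (e); case: (c1); case: (c2) => -[] [] [].
Qed.

(** The twists of the arm functions around [x] cancel in sums of an even number
    of them: near [x] these sums are, up to constants, all the functions locally
    constant off the arms, and they jump exactly at their arms. *)
Theorem star : exists F (r : R), [/\ 0 < r,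
    forall (J : {set I}) y, ~~ odd #|J| -> box x r y -> (forall i, i \in J -> ~ K i y) ->
      locst (fun z => \big[addb/false]_(i in J) F i z) y,
    forall (J : {set I}) j t c, ~~ odd #|J| -> 0 < t < 1 -> box x r (b j t) -> j \in J ->
      ~ \forall z \near b j t, (forall i, ~ K i z) -> \big[addb/false]_(i in J) F i z = c &
    forall s r', 0 < r' ->
      (forall y, box x r' y -> y <> x -> (forall i, ~ K i y) -> locst s y) ->
      exists (J : {set I}) c, ~~ odd #|J| /\ \forall z \near x, z <> x ->
        (forall i, ~ K i z) -> s z = \big[addb/false]_(i in J) F i z (+) c].
Proof.
have [r r0 rP] := F_radius; exists F, r; split=> //.
- move=> J y Jeven by_ Ky; apply: eq_locstW (locst_arm_sum_twisted rP by_ Ky) => z.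
  by rewrite (negbTE Jeven) addbF.
- by move=> J j t c; exact: jump_arm_sum.
move=> s r' r'0 sl; pose r1 := Num.min r r'.
have r10 : 0 < r1 by rewrite lt_min r0.
have r1r : r1 <= r by rewrite ge_min lexx.
have r1r' : r1 <= r' by rewrite ge_min lexx orbT.
have [|J [c [_ Jeven HJ]]] := @star_decompose r (enum I) false s rP (enum_uniq _) r1 r10 r1r.
  move=> y by_ yx Ky; apply: eq_locstW (sl y (box_mono r1r' by_) yx _) => [z|i].
    by rewrite /= addbF.
  by apply: Ky; rewrite mem_enum.
exists J, c; rewrite Jeven; split=> //; apply: filterS HJ => z Hz zx Kz.
by apply: Hz => // i _; exact: Kz.
Qed.

End Star.

(** * Stars on a surface: transport by charts *)

Section Clamp.
Variables (R : realType) (T : topologicalType).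

(** Extends curves from the unit interval to the line, where continuity at a
    point is available without restriction to a subspace. *)
Definition clamp (t : R) : R := Num.max 0 (Num.min t 1).

Lemma clamp01 t : 0 <= clamp t <= 1.
Proof. by rewrite /clamp le_max lexx /= ge_max ler01 ge_min lexx orbT. Qed.

Lemma clamp_id t : 0 <= t <= 1 -> clamp t = t.
Proof. by move=> /andP[t0 t1]; rewrite /clamp min_l// max_r. Qed.

Lemma cnt_clamp t : cnt clamp t.
Proof.
move=> A /nbhs_ballP[e /= e0 He]; apply/nbhs_ballP; exists e => //= u.
rewrite /ball /= => tu; apply: He; rewrite /ball /=; apply: le_lt_trans tu.
have max0 (a b : R) : `|Num.max 0 a - Num.max 0 b| <= `|a - b|.
  have h1 := ler_norm (a - b); have h2 := ler_norm (b - a); rewrite distrC in h2.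
  by case: (leP 0 a) => ?; case: (leP 0 b) => ?; rewrite ler_norml; apply/andP; split; lra.
apply: le_trans (max0 _ _) _.
have h1 := ler_norm (t - u); have h2 := ler_norm (u - t); rewrite distrC in h2.
by case: (leP t 1) => ?; case: (leP u 1) => ?; rewrite ler_norml; apply/andP; split; lra.
Qed.

Lemma cnt_clamped (f : R -> T) t : {within `[0, 1], continuous f} -> cnt (f \o clamp) t.
Proof.
move=> /subspace_continuousP fc A; have /= ct := clamp01 t.
have c01 : `[(0 : R), 1]%classic (clamp t) by rewrite /= in_itv.
move=> /(fc _ c01) /cnt_clamp; apply: filterS => u /=; apply.
by rewrite in_itv /=; exact: clamp01.
Qed.

End Clamp.

Section Chart.
Variables (R : realType) (S : topologicalType) (U : set S) (phi : S -> R * R) (psi : R * R -> S).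
Hypotheses (oU : open U) (phic : {within U, continuous phi}) (psic : continuous psi).
Hypotheses (psiU : forall z, U (psi z)) (phiK : forall y, U y -> psi (phi y) = y)
  (psiK : forall z, phi (psi z) = z).

Lemma chart_cnt y : U y -> cnt phi y.
Proof.
move: phic => /subspace_continuousP fc Uy A /(fc _ Uy) => h.
have nU : \forall z \near y, U z by exact: open_nbhs_nbhs.
by apply: filterS2 nU h => z Uz; apply.
Qed.

Lemma chart_near y (P : S -> Prop) : U y ->
  (\forall z \near y, P z) <-> (\forall w \near phi y, P (psi w)).
Proof.
move=> Uy; split=> h.
  have /cntP := @psic (phi y); apply; by rewrite phiK.
have nU : \forall z \near y, U z by exact: open_nbhs_nbhs.
by apply: filterS2 nU (chart_cnt Uy h) => z Uz; rewrite /= phiK.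
Qed.

Lemma chart_locst y (s : S -> bool) : U y -> locst s y <-> locst (s \o psi) (phi y).
Proof. by move=> Uy; rewrite /locst (chart_near _ Uy) /= phiK. Qed.

Lemma chart_inj y z : U y -> U z -> phi y = phi z -> y = z.
Proof. by move=> Uy Uz yz; rewrite -(phiK Uy) yz phiK. Qed.

End Chart.

Section Drawing.
Variables (R : realType) (S : topologicalType) (hS : closed_surface R S).
Variables (G : sgraph) (p : G -> S) (g : {set G} -> R -> S) (emb : embedding p g).

Definition curve e : R -> S := g e \o @clamp R.

Lemma curve_cnt e t : e \in edges G -> cnt (curve e) t.
Proof. by move=> eE; have [_ /(_ e eE)[[ge _] _] _ _] := emb; exact: cnt_clamped. Qed.

Lemma curveE e t : 0 <= t <= 1 -> curve e t = g e t.
Proof. by move=> t01; rewrite /curve /= clamp_id. Qed.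

Lemma curve_inj e u v : e \in edges G -> 0 <= u <= 1 -> 0 <= v <= 1 ->
  curve e u = curve e v -> u = v.
Proof.
move=> eE u01 v01; rewrite !curveE//; have [_ /(_ e eE)[[_ ginj] _] _ _] := emb.
by apply: ginj; rewrite in_itv.
Qed.

Lemma surface_hausdorff : hausdorff_space S.
Proof. by have [] := hS. Qed.

Lemma curve_end e t : e \in edges G -> 0 <= t <= 1 -> ~~ (0 < t < 1) ->
  exists2 v, v \in e & curve e t = p v.
Proof.
move=> eE /[dup] t01 /andP[t0 t1] nt; have [_ /(_ e eE)[_ ends] _ _] := emb.
have : [set g e 0; g e 1] (curve e t).
  rewrite curveE//; move: nt; rewrite negb_and -!leNgt => /orP[t00|t11].
    by left => /=; congr (g e); apply/eqP; rewrite eq_le t00.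
  by right => /=; congr (g e); apply/eqP; rewrite eq_le t1.
by rewrite ends => -[v /= ve <-]; exists v.
Qed.

Lemma curve_vertex e t v : e \in edges G -> 0 < t < 1 -> curve e t <> p v.
Proof.
move=> eE /[dup] t01 /andP[t0 t1]; rewrite curveE ?(ltW t0) ?(ltW t1)//.
by have [_ _ h _] := emb; apply: h; rewrite ?in_itv.
Qed.

Lemma curve_disjoint e f u v : e \in edges G -> f \in edges G -> 0 < u < 1 -> 0 <= v <= 1 ->
  curve e u = curve f v -> e = f.
Proof.
move=> eE fE u01 v01 euv; apply: contrapT => ef.
have [v01'|v01'] := boolP (0 < v < 1); last first.
  have [w _ fw] := curve_end fE v01 v01'.
  by apply: (curve_vertex (v := w) eE u01); rewrite euv.
have [_ _ _ h] := emb; apply: (h e f eE fE ef u v); rewrite ?in_itv//.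
move/andP: u01 => [? ?]; move/andP: v01' => [? ?].
by rewrite -!curveE// ltW// ltW.
Qed.

Definition drawing : set S := [set y | exists e t, [/\ e \in edges G, 0 <= t <= 1 & curve e t = y]].

Definition interior_of e : set S := [set y | exists2 t, 0 < t < 1 & curve e t = y].

(** An arm at [x] is an edge through [x] with a direction in which it leaves; so
    an inner point of an edge has two arms, and a vertex one for each edge. *)
Definition leaves x (a : {set G} * bool) := a.1 \in edges G /\
  exists t, [/\ 0 <= t <= 1, curve a.1 t = x & if a.2 then t < 1 else 0 < t].

Definition arms_at x := {a : {set G} * bool | `[< leaves x a >]}.

(** The values on the drawing itself do not count. *)
Definition jumpless (s : S -> bool) (y : S) := exists c, \forall z \near y, ~ drawing z -> s z = c.

Lemma drawing_near x : ~ drawing x -> \forall y \near x, ~ drawing y.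
Proof.
move=> xX; suff H (L : seq {set G}) : {subset L <= edges G} ->
    \forall y \near x, forall e, e \in L -> ~ arc_set (curve e) 0 1 y.
  have /H : {subset enum (edges G) <= edges G} by move=> e; rewrite mem_enum.
  apply: filterS => y hy [e [t [eE t01 ety]]]; apply: (hy e); first by rewrite mem_enum.
  by exists t.
move=> LE; apply: near_seq => e /LE eE; apply: near_off.
  by apply: arc_closed; [exact: surface_hausdorff|move=> t; exact: curve_cnt].
by move=> [t t01 etx]; apply: xX; exists e, t.
Qed.

Lemma arms_edge x (i : arms_at x) : (val i).1 \in edges G.
Proof. by have /asboolP[] := valP i. Qed.

Lemma drawing_curve e t : e \in edges G -> 0 <= t <= 1 -> drawing (curve e t).
Proof. by move=> eE t01; exists e, t. Qed.

(** In a chart the drawing is, near [x], the star formed by short initial pieces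
    of the arms at [x], so [star] applies. The set [P i] is the piece of the
    arm [i] without its origin. *)
Theorem surface_star x : exists (F : arms_at x -> S -> bool) (N : set S) (P : arms_at x -> set S),
  [/\ open N /\ N x,
      forall y, N y -> drawing y -> y <> x -> exists i, P i y,
      forall i y, N y -> P i y -> [/\ interior_of (val i).1 y, y <> x &
        forall J : {set arms_at x}, ~~ odd #|J| ->
          jumpless (fun z => \big[addb/false]_(j in J) F j z) y <-> i \notin J],
      forall i M, nbhs x M -> exists y, [/\ M y, N y & P i y] &
      (forall (J : {set arms_at x}) y, ~~ odd #|J| -> N y -> ~ drawing y ->
        locst (fun z => \big[addb/false]_(j in J) F j z) y) /\
      forall s, (\forall y \near x, ~ drawing y -> locst s y) ->
        exists (J : {set arms_at x}) c, ~~ odd #|J| /\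
          \forall z \near x, ~ drawing z -> s z = \big[addb/false]_(j in J) F j z (+) c].
Proof.
have [_ _ _ _ /(_ x) [U [oU Ux [phi [psi [phic psic psiU phiK psiK]]]]]] := hS.
have phi_cnt := chart_cnt oU phic.
have chart_near := chart_near oU phic psic phiK.
have chart_locst := chart_locst oU phic psic phiK.
have chart_inj := chart_inj phiK.
have tE (i : arms_at x) : exists t : R, [/\ 0 <= t <= 1, curve (val i).1 t = x &
    if (val i).2 then t < 1 else 0 < t].
  by have /asboolP[_ [u ?]] := valP i; exists u.
have [t tP] := choice tE.
pose sg (i : arms_at x) u := if (val i).2 then t i + u else t i - u.
have sgU i : exists2 d, 0 < d & forall u, 0 <= u <= d ->
    U (curve (val i).1 (sg i u)) /\ (0 < u -> 0 < sg i u < 1).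
  have [/andP[t0 t1] tx ti] := tP i.
  have cc : cnt (curve (val i).1) (t i) by apply: curve_cnt; exact: arms_edge.
  have nU : nbhs (curve (val i).1 (t i)) U by rewrite tx; exact: open_nbhs_nbhs.
  have [e e0 He] := near_ball cc nU.
  pose d := Num.min (e / 2) ((if (val i).2 then 1 - t i else t i) / 2).
  have d0 : 0 < d by rewrite lt_min; case: ifP ti => _ ?; lra.
  have de : d <= e / 2 by rewrite ge_min lexx.
  have dt : d <= (if (val i).2 then 1 - t i else t i) / 2 by rewrite ge_min lexx orbT.
  exists d => // u /andP[u0 ud]; split.
    apply: He; rewrite /sg; case: ifP => _.
      by rewrite addrAC subrr add0r ger0_norm//; lra.
    by rewrite addrAC subrr add0r normrN ger0_norm//; lra.
  by move=> u0'; rewrite /sg; case: ifP ti dt => _ ? ?; lra.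
have [d d0 dP] : exists2 d, 0 < d & forall i, forall u, 0 <= u <= d ->
    U (curve (val i).1 (sg i u)) /\ (0 < u -> 0 < sg i u < 1).
  apply: (finite_radius (P := fun i d => forall u, 0 <= u <= d ->
    U (curve (val i).1 (sg i u)) /\ (0 < u -> 0 < sg i u < 1))) => //.
  by move=> i r r' rr' r'0 h u /andP[u0 ur]; apply: h; rewrite u0 (le_trans ur).
pose Q (i : arms_at x) u := curve (val i).1 (sg i (d * u)).
have du u : 0 <= u <= 1 -> 0 <= d * u <= d.
  by move=> /andP[u0 u1]; rewrite mulr_ge0 ?(ltW d0)//= ler_piMr ?(ltW d0).
have QU i u : 0 <= u <= 1 -> U (Q i u).
  by move=> u01; have [] := dP i _ (du u u01).
have sgQ i u : 0 < u <= 1 -> 0 < sg i (d * u) < 1.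
  move=> /andP[u0 u1]; have [|_] := dP i (d * u); first by apply: du; rewrite (ltW u0).
  by apply; rewrite mulr_gt0.
have sg0 i : sg i 0 = t i by rewrite /sg addr0 subr0; case: ifP.
have Q0 i : Q i 0 = x by rewrite /Q mulr0 sg0; have [] := tP i.
have sg01 i u : 0 <= u <= 1 -> 0 <= sg i (d * u) <= 1.
  move=> /andP[]; rewrite le_eqVlt => /orP[/eqP<- _|u0 u1]; first by rewrite mulr0 sg0; have [] := tP i.
  by have := sgQ i u; rewrite u0 u1 => /(_ isT) /andP[*]; rewrite !ltW.
have sg_inj i u v : sg i (d * u) = sg i (d * v) -> u = v.
  by rewrite /sg; case: ifP => _ h; apply: (mulfI (lt0r_neq0 d0)); lra.
have Qinj i u v : 0 <= u <= 1 -> 0 <= v <= 1 -> Q i u = Q i v -> u = v.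
  by move=> u01 v01 /(curve_inj (arms_edge i) (sg01 i u u01) (sg01 i v v01)); exact: sg_inj.
have QX i u : 0 <= u <= 1 -> drawing (Q i u).
  by move=> u01; apply: drawing_curve; [exact: arms_edge|exact: sg01].
have Qc i u : cnt (Q i \o @clamp R) u.
  apply: cnt_comp; first exact: cnt_clamp.
  apply: (@cnt_comp _ _ _ (fun u => sg i (d * u)) (curve (val i).1)); last first.
    by apply: curve_cnt; exact: arms_edge.
  rewrite /sg; case: (val i).2; [apply: cntD|apply: cntB]; try exact: cnt_cst.
    by apply: cntM; [exact: cnt_cst|exact: cnt_id].
  by apply: cntM; [exact: cnt_cst|exact: cnt_id].
pose b (i : arms_at x) u := phi (Q i (clamp u)).
have bE i u : 0 <= u <= 1 -> b i u = phi (Q i u) by move=> ?; rewrite /b clamp_id.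
have armb i : arm (phi x) (b i).
  split=> [u||u v].
  - apply: (@cnt_comp _ _ _ (Q i \o @clamp R) phi); first exact: Qc.
    by apply: phi_cnt; apply: QU; exact: clamp01.
  - by rewrite bE ?lexx ?ler01// Q0.
  - rewrite !in_itv /= => u01 v01; rewrite !bE// => /chart_inj h; apply: (Qinj i) => //.
    by apply: h; exact: QU.
have KP i z : arc_set (b i) 0 1 z <-> exists2 u, 0 <= u <= 1 & phi (Q i u) = z.
  by split=> -[u u01]; rewrite ?bE// => <-; exists u; rewrite ?bE.
have disj i j z : i != j -> arc_set (b i) 0 1 z -> arc_set (b j) 0 1 z -> z = phi x.
  move=> ij /KP[u u01 <-] /KP[v v01] /chart_inj => h.
  have {h} uv : Q i u = Q j v by apply/esym/h; exact: QU.
  have [u0|u0] := eqVneq u 0; first by rewrite u0 Q0.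
  exfalso; have u0' : 0 < u <= 1 by rewrite lt_neqAle eq_sym u0.
  have ee : (val i).1 = (val j).1.
    exact: (curve_disjoint (arms_edge i) (arms_edge j) (sgQ i u u0') (sg01 j v v01) uv).
  have [ti xi _] := tP i; have [tj xj _] := tP j.
  have tt : t i = t j by apply: (curve_inj (arms_edge i)) => //; rewrite xi ee xj.
  have : sg i (d * u) = sg j (d * v).
    apply: (curve_inj (arms_edge i)); [exact: sg01|exact: sg01|].
    by move: uv; rewrite /Q -ee.
  have neq2 : (val i).2 != (val j).2.
    apply: contra ij => /eqP e2; apply/eqP/val_inj.
    by move: ee e2; case: (val i) (val j) => [e1 d1] [e2 d2] /= -> ->.
  have du0 : 0 < d * u by rewrite mulr_gt0//; case/andP: u0'.
  have dv0 : 0 <= d * v by rewrite mulr_ge0 ?(ltW d0)//; case/andP: v01.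
  by rewrite /sg tt; move: neq2; case: (val i).2; case: (val j).2 => //= _ ?; lra.
have [F [r [r0 starA starB starC]]] := star armb disj.
have near_arm : \forall y \near x, drawing y -> exists i, exists2 u, 0 <= u < 1 & Q i u = y.
  suff H (L : seq {set G}) : {subset L <= edges G} -> \forall y \near x, forall e, e \in L ->
      arc_set (curve e) 0 1 y -> exists i, exists2 u, 0 <= u < 1 & Q i u = y.
    have /H : {subset enum (edges G) <= edges G} by move=> e; rewrite mem_enum.
    apply: filterS => y hy [e [u [eE u01 euy]]]; apply: (hy e); first by rewrite mem_enum.
    by exists u.
  move=> LE; apply: near_seq => e /LE eE.
  have ce u v : closed (arc_set (curve e) u v).
    by apply: arc_closed; [exact: surface_hausdorff|move=> w; exact: curve_cnt].
  have [[w w01 ewx]|xe] := pselect (arc_set (curve e) 0 1 x); last first.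
    by apply: filterS (near_off (ce 0 1) xe) => y ye /ye.
  have lo : ~ arc_set (curve e) 0 (w - d) x.
    move=> [u /andP[u0 u1] eux]; have : u = w.
      by apply: (curve_inj eE) => //; [lra|rewrite eux].
    by lra.
  have hi : ~ arc_set (curve e) (w + d) 1 x.
    move=> [u /andP[u0 u1] eux]; have : u = w.
      by apply: (curve_inj eE) => //; [lra|rewrite eux].
    by lra.
  apply: filterS2 (near_off (ce _ _) lo) (near_off (ce _ _) hi) => y ylo yhi.
  move=> [u /andP[u0 u1] euy].
  have wu : w - d < u by rewrite ltNge; apply/negP => h; apply: ylo; exists u; rewrite ?u0.
  have uw : u < w + d by rewrite ltNge; apply/negP => h; apply: yhi; exists u; rewrite ?h.
  (* the direction in which [u] lies from [w]; at [u = w] any arm of [e] will do *)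
  have [dir [hdir hu]] : exists dir : bool, (if dir then w < 1 else 0 < w) /\
      (if dir then w <= u else u <= w).
    have [wltu|ultw|wequ] := ltgtP w u; [exists true|exists false|].
    - by split; lra.
    - by split; lra.
    - have [w1|w1] := ltP w 1; first by exists true; split; lra.
      by exists false; split; lra.
  have la : leaves x (e, dir) by split=> //; exists w.
  pose i : arms_at x := exist _ (e, dir) (asboolT la).
  have tw : t i = w.
    have [t01 tx _] := tP i; apply: (curve_inj eE) => //; by rewrite ewx.
  exists i; exists ((if dir then u - w else w - u) / d).
    rewrite divr_ge0 ?(ltW d0)//=; last by case: dir hu {hdir la i tw}; lra.
    by rewrite ltr_pdivrMr// mul1r; case: dir hu {hdir la i tw}; lra.
  rewrite /Q mulrCA divff ?gt_eqF// mulr1 /sg tw /= -euy.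
  by congr curve; case: dir {hdir hu la i tw}; lra.
pose C y := [/\ U y, box (phi x) r (phi y) &
  drawing y -> exists i, exists2 u, 0 <= u < 1 & Q i u = y].
have nC : \forall y \near x, C y.
  have nU : \forall z \near x, U z by exact: open_nbhs_nbhs.
  have nb := phi_cnt x Ux _ (near_in_box (phi x) r0).
  by apply: filterS3 nU nb near_arm => y; split.
have KX i y : U y -> arc_set (b i) 0 1 (phi y) -> drawing y.
  by move=> Uy /KP[u u01 /chart_inj <-//]; [exact: QX|exact: QU].
pose P (i : arms_at x) : set S := [set y | exists2 u, 0 < u < 1 & Q i u = y].
exists (fun i y => F i (phi y)), C°, P; split.
- by split; [exact: open_interior|].
- move=> y /nbhs_singleton[Uy _ yX] /yX[i [u /andP[u0 u1] <-]] yx; exists i, u => //.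
  rewrite u1 andbT lt_neqAle u0 andbT; apply/eqP => u00.
  by apply: yx; rewrite -u00 Q0.
- move=> i y Cy [u /andP[u0 u1] Qu]; have [Uy by_ _] := nbhs_singleton Cy.
  have u01 : 0 <= u <= 1 by rewrite !ltW.
  have yx : y <> x.
    move=> yx; have : u = 0.
      by apply: (Qinj i) => //; rewrite ?lexx ?ler01// Q0 -yx.
    by move=> u00; rewrite u00 ltxx in u0.
  have Ky : arc_set (b i) 0 1 (phi y) by apply/KP; exists u; rewrite ?Qu.
  split=> //; first by exists (sg i (d * u)) => //; apply: sgQ; rewrite u0 ltW.
  move=> J Jeven; split=> [[c Hc]|iJ].
    apply/negP => iJ.
    have bu : b i u = phi y by rewrite bE// Qu.
    apply: (starB J i u c Jeven) => //; rewrite ?u0 ?bu//.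
    have /chart_near : \forall z \near y, C z by exact: Cy.
    move=> /(_ Uy); move/chart_near: Hc => /(_ Uy); apply: filterS2 => w Hw [_ _ Cw] Kw.
    rewrite -Hw ?psiK// => /Cw[j [v /andP[v0 v1] Qv]]; apply: (Kw j); apply/KP; exists v.
      by rewrite v0 ltW.
    by rewrite Qv psiK.
  have : locst (fun z => \big[addb/false]_(j in J) F j (phi z)) y.
    apply: (@locst_comp _ _ phi (fun w => \big[addb/false]_(j in J) F j w)); first exact: phi_cnt.
    apply: starA => // j jJ Kj; apply: yx; apply: chart_inj => //.
    by apply: disj Kj Ky; apply: contraNneq iJ => <-.
  by move=> l; exists (\big[addb/false]_(j in J) F j (phi y)); apply: filterS l.
- move=> i M nM.
  have c0 : clamp (0 : R) = 0 by rewrite clamp_id// lexx ler01.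
  have nMC : nbhs ((Q i \o @clamp R) 0) (M `&` C°).
    by rewrite /= c0 Q0; apply: filterI => //; exact: nbhs_interior.
  have [e e0 He] := near_ball (Qc i 0) nMC.
  pose u := Num.min (e / 2) (1 / 2).
  have u0 : 0 < u by rewrite lt_min; lra.
  have ue : u <= e / 2 by rewrite ge_min lexx.
  have u1 : u <= 1 / 2 by rewrite ge_min lexx orbT.
  have [|MQ CQ] := He u; first by rewrite subr0 gtr0_norm//; lra.
  have cu : clamp u = u by rewrite clamp_id//; lra.
  rewrite /= cu in MQ CQ; exists (Q i u); split=> //; exists u => //; lra.
- split=> [J y Jeven Cy yX|s sl].
    have [Uy by_ _] := nbhs_singleton Cy.
    apply: (@locst_comp _ _ phi (fun w => \big[addb/false]_(j in J) F j w)); first exact: phi_cnt.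
    by apply: starA => // j jJ /(KX _ _ Uy).
  have [xX|xX] := pselect (drawing x); last first.
    have noarm (i : arms_at x) : False by apply: xX; rewrite -(Q0 i); apply: QX; rewrite lexx ler01.
    exists finset.set0, (s x); rewrite cards0; split=> //.
    have := nbhs_singleton sl xX; apply: filterS => z -> _.
    by rewrite big_pred0 => [|i]; [|rewrite inE].
  have : \forall y \near x, C y /\ (~ drawing y -> locst s y) by apply: filterS2 nC sl.
  move=> /(chart_near _ _ Ux)/near_box[r' r'0 Hr'].
  have [|J [c [Jeven HJ]]] := starC (s \o psi) r' r'0.
    move=> w bw wx Kw; have [[_ _ Cw] sw] := Hr' w bw.
    have : locst s (psi w).
      apply: sw => /Cw[j [v /andP[v0 v1] Qv]]; apply: (Kw j); apply/KP; exists v.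
        by rewrite v0 ltW.
      by rewrite Qv psiK.
    by move=> /chart_locst; rewrite psiK; apply.
  exists J, c; split=> //; have nU : \forall z \near x, U z by exact: open_nbhs_nbhs.
  apply: filterS2 nU (phi_cnt x Ux _ HJ) => z Uz /= Hz zX; rewrite -[in LHS](phiK z Uz).
  apply: Hz => [zx|i /(KX _ _ Uz)//].
  by apply: zX; rewrite (chart_inj _ _ Uz Ux zx).
Qed.

End Drawing.

(** * Jumps at the edges of a drawing *)

Section Jumps.
Variables (R : realType) (S : topologicalType) (hS : closed_surface R S).
Variables (G : sgraph) (p : G -> S) (g : {set G} -> R -> S) (emb : embedding p g).

Let X := drawing g.
Let lc := jumpless g.

Lemma lc_near s y : lc s y -> \forall y' \near y, lc s y'.
Proof. by move=> [c /near_join Hc]; apply: filterS Hc => y' ?; exists c. Qed.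

Lemma lc_cst b y : lc (fun=> b) y.
Proof. by exists b; exact: nearW. Qed.

Lemma lcD s t y : lc s y -> lc t y -> lc (fun z => s z (+) t z) y.
Proof.
move=> [c Hc] [d Hd]; exists (c (+) d).
by apply: filterS2 Hc Hd => z hc hd Xz; rewrite hc// hd.
Qed.

Lemma eq_lc s t y : (\forall z \near y, ~ X z -> s z = t z) -> lc s y -> lc t y.
Proof.
move=> st [c Hc]; exists c.
by apply: filterS2 st Hc => z st' sc Xz; rewrite -st'// sc.
Qed.

Lemma locst_lc s y : locst s y -> lc s y.
Proof. by move=> sy; exists (s y); apply: filterS sy. Qed.

Lemma lc_locst s y : ~ X y -> lc s y -> locst s y.
Proof.
move=> Xy [c Hc]; apply: (@locstP _ _ _ c).
by apply: filterS2 (drawing_near hS emb Xy) Hc => z Xz; exact.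
Qed.

Definition off_locst_near (s : S -> bool) (y : S) := \forall z \near y, ~ X z -> locst s z.

Lemma off_locst_nearD s t y : off_locst_near s y -> off_locst_near t y -> off_locst_near (fun z => s z (+) t z) y.
Proof. by move=> hs ht; apply: filterS2 hs ht => z hs ht Xz; apply: locstD; [exact: hs|exact: ht]. Qed.

Lemma off_locst_near_join s y : off_locst_near s y -> \forall z \near y, off_locst_near s z.
Proof. exact: near_join. Qed.

Lemma interior_drawing e y : e \in edges G -> interior_of g e y -> X y.
Proof. by move=> eE [t /andP[t0 t1] <-]; apply: drawing_curve; rewrite ?(ltW t0) ?(ltW t1). Qed.

Lemma arms_interior e y (i : arms_at g y) : e \in edges G -> interior_of g e y -> (val i).1 = e.
Proof.
move=> eE [t t01 ety]; have /asboolP[fE [u [u01 fuy _]]] := valP i.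
by apply/esym/(curve_disjoint emb eE fE t01 u01); rewrite ety.
Qed.

Lemma interior_unique e f y : e \in edges G -> f \in edges G -> interior_of g e y ->
  interior_of g f y -> e = f.
Proof.
move=> eE fE [t t01 ety] [u /andP[u0 u1] fuy].
by apply: (curve_disjoint emb eE fE t01 (v := u)); rewrite ?(ltW u0) ?(ltW u1)// ety fuy.
Qed.

Lemma card_arms_interior e y : e \in edges G -> interior_of g e y -> #|{: arms_at g y}| = 2.
Proof.
move=> eE ye; have [t /andP[t0 t1] ety] := ye.
have lv d : leaves g y (e, d).
  by split=> //; exists t; split=> //; [rewrite ltW//= ltW|case: d].
pose a d : arms_at g y := exist _ (e, d) (asboolT (lv d)).
have <- : #|[set a d | d in [set: bool]]%SET| = 2.
  rewrite card_imset; first by rewrite cardsT card_bool.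
  by move=> d d' /(congr1 val) [].
rewrite -cardsT; congr #|pred_of_set _|; apply/setP => i; rewrite inE; apply/esym/imsetP.
exists (val i).2; rewrite ?inE//; apply/val_inj => /=.
by rewrite -(arms_interior i eE ye) -surjective_pairing.
Qed.

Lemma arm_exists x : X x -> exists i : arms_at g x, True.
Proof.
move=> [e [t [eE /andP[t0 t1] ety]]].
have [t1'|t1'] := ltP t 1.
  have lv : leaves g x (e, true) by split=> //; exists t; rewrite t0 t1.
  by exists (exist _ (e, true) (asboolT lv)).
have lv : leaves g x (e, false) by split=> //; exists t; rewrite t0 t1; split=> //=; lra.
by exists (exist _ (e, false) (asboolT lv)).
Qed.

Lemma near_interior x : \forall y \near x, X y -> y <> x ->
  exists2 i : arms_at g x, (val i).1 \in edges G & interior_of g (val i).1 y.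
Proof.
have [F [N [P [[oN Nx] HX HP _ _]]]] := surface_star hS emb x.
have nN : \forall y \near x, N y by exact: open_nbhs_nbhs.
apply: filterS nN => y Ny Xy yx; have [i Piy] := HX y Ny Xy yx.
by exists i; [exact: arms_edge|have [] := HP i y Ny Piy].
Qed.

(** A function jumps at every arm of its decomposition near [x], and every arm
    has points arbitrarily close to [x]; so the decomposition is empty. *)
Lemma no_jump s x : off_locst_near s x ->
  (\forall y \near x, y <> x -> X y -> lc s y) -> lc s x.
Proof.
move=> sx sj; have [F [N [P [[oN Nx] HX HP Hd [_ HC]]]]] := surface_star hS emb x.
have [J [c [Jeven HJ]]] := HC s sx.
have J0 : J = finset.set0.
  apply/setP => i; rewrite inE; apply/negP => iJ.
  have [y [[/= sy HJy] Ny Piy]] := Hd i _ (filterI sj (near_join HJ)).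
  have [ye yx /(_ J Jeven) [h _]] := HP i y Ny Piy.
  have : lc (fun z => \big[addb/false]_(j in J) F j z) y.
    apply: eq_lc (lcD (sy yx (interior_drawing (arms_edge i) ye)) (lc_cst c y)).
    by apply: filterS HJy => z Hz Xz; rewrite Hz//; xor_ring.
  by move=> /h; rewrite iJ.
exists c; apply: filterS HJ => z Hz Xz; rewrite Hz// J0 big_pred0// => i.
by rewrite inE.
Qed.

(** An inner point of an edge has two arms, so the only nonempty even set of
    arms is the full one, and a single function [s0] and the constants span. *)
Lemma interior_decompose e y : e \in edges G -> interior_of g e y -> exists s0 : S -> bool,
  [/\ ~ lc s0 y, off_locst_near s0 y,
     (\forall z \near y, X z -> z <> y -> ~ lc s0 z) &
     forall s, off_locst_near s y -> exists d c, \forall z \near y, ~ X z -> s z = (d && s0 z) (+) c].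
Proof.
move=> eE ye; have [F [N [P [[oN Nx] HX HP Hd [HA HC]]]]] := surface_star hS emb y.
have c2 := card_arms_interior eE ye.
have Teven : ~~ odd #|[set: arms_at g y]%SET| by rewrite cardsT c2.
have nN : \forall z \near y, N z by exact: open_nbhs_nbhs.
pose s0 z := \big[addb/false]_(j in [set: arms_at g y]%SET) F j z.
have nj : \forall z \near y, X z -> z <> y -> ~ lc s0 z.
  apply: filterS nN => z Nz Xz zy; have [i Pz] := HX z Nz Xz zy.
  by have [_ _ /(_ _ Teven) [h _]] := HP i z Nz Pz; move=> /h; rewrite inE.
exists s0; split=> //.
- move=> /lc_near l0; have [i _] := arm_exists (interior_drawing eE ye).
  have [z [[/= lz nz] Nz Pz]] := Hd i _ (filterI l0 nj).
  have [ze zy _] := HP i z Nz Pz.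
  exact: nz (interior_drawing (arms_edge i) ze) zy lz.
- by apply: filterS nN => z Nz; exact: HA.
move=> s /HC [J [c [Jeven HJ]]].
have [J0|J0] := eqVneq J finset.set0.
  exists false, c; apply: filterS HJ => z Hz Xz.
  by rewrite Hz// J0 big_pred0// => i; rewrite inE.
have JT : J = [set: arms_at g y]%SET.
  apply/eqP; rewrite eqEcard finset.subsetT cardsT c2.
  move: Jeven J0; rewrite -card_gt0; case: #|J| => [|[|]]//.
by exists true, c; apply: filterS HJ => z Hz Xz; rewrite Hz// JT.
Qed.

Lemma jump_add e y s t : e \in edges G -> interior_of g e y -> off_locst_near s y -> off_locst_near t y ->
  ~ lc s y -> ~ lc t y -> lc (fun z => s z (+) t z) y.
Proof.
move=> eE ye hs ht ns nt; have [s0 [_ _ _ H]] := interior_decompose eE ye.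
have [d [c Hs]] := H s hs; have [d' [c' Ht]] := H t ht.
case: d Hs => Hs; last by exfalso; apply: ns; exists c; apply: filterS Hs => z h /h ->.
case: d' Ht => Ht; last by exfalso; apply: nt; exists c'; apply: filterS Ht => z h /h ->.
exists (c (+) c'); apply: filterS2 Hs Ht => z hs' ht' Xz.
by rewrite hs'// ht'//; xor_ring.
Qed.

Lemma lc_interior_near e y s : e \in edges G -> interior_of g e y -> off_locst_near s y ->
  \forall z \near y, X z -> (lc s z <-> lc s y).
Proof.
move=> eE ye hs; have [s0 [n0 o0 nj H]] := interior_decompose eE ye.
have [d [c Hs]] := H s hs; case: d Hs => Hs; last first.
  have ly : lc s y by exists c; apply: filterS Hs => z h /h ->.
  by apply: filterS (lc_near ly) => z lz _; split.
have eqs z : (\forall w \near z, ~ X w -> s w = s0 w (+) c) -> lc s z -> lc s0 z.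
  move=> h lz; apply: eq_lc (lcD lz (lc_cst c z)).
  by apply: filterS h => w hw Xw; rewrite hw//; xor_ring.
have ny : ~ lc s y by move=> /(eqs y Hs).
apply: filterS2 nj (near_join Hs) => z njz Hz Xz; split=> // lz; exfalso.
have [zy|zy] := pselect (z = y); first by apply: ny; rewrite -zy.
by apply: (njz Xz zy); exact: eqs lz.
Qed.

(** By [lc_interior_near] jumping is a locally constant property along the edge. *)
Lemma lc_edge e s y z : e \in edges G -> (forall w, ~ X w -> locst s w) ->
  interior_of g e y -> interior_of g e z -> lc s y <-> lc s z.
Proof.
move=> eE hs [t t01 <-] [u u01 <-].
have soff w : off_locst_near s w by apply: nearW => ?; exact: hs.
pose q t : bool := `[< lc s (curve g e t) >].
have ql w : 0 < w < 1 -> locst q w.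
  move=> w01; have ye : interior_of g e (curve g e w) by exists w.
  have n01 : \forall v \near w, 0 < v < 1.
    case/andP: w01 => w0 w1.
    by apply: filterS2 (lt_nbhsr w0) (lt_nbhsl w1) => v -> ->.
  have := curve_cnt emb (t := w) eE (lc_interior_near eE ye (soff _)).
  move=> h; apply: filterS2 n01 h => v v01 /= hv.
  have Xv : X (curve g e v) by apply: (interior_drawing eE); exists v.
  by apply/asboolP/asboolP; rewrite (hv Xv).
suff qtu : q t = q u by split=> l; apply/asboolP; [rewrite -/(q u) -qtu|rewrite -/(q t) qtu]; apply/asboolP.
wlog tu : t u t01 u01 / t <= u.
  by move=> W; have [tu|/ltW ut] := leP t u; [exact: W|apply/esym; exact: W].
apply: (@locst_path _ _ q id) => // v /andP[tv vu]; first exact: cnt_id.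
apply: ql.
by move/andP: t01 => [? _]; move/andP: u01 => [_ ?]; lra.
Qed.

(** Inside an open part of the drawing every function would be jumpless, in
    particular the function [s0] of [interior_decompose]. *)
Lemma off_drawing_dense (x : S) (M : set S) : nbhs x M -> exists2 y, M y & ~ X y.
Proof.
have int e y A : e \in edges G -> interior_of g e y -> nbhs y A -> exists2 z, A z & ~ X z.
  move=> eE ye nA; apply: contrapT => no.
  have [s0 [n0 _ _ _]] := interior_decompose eE ye; apply: n0; exists true.
  by apply: filterS nA => z Az Xz; exfalso; apply: no; exists z.
move=> nM; have [Xx|Xx] := pselect (X x); last by exists x => //; exact: nbhs_singleton.
have [F [N [P [[oN Nx] HX HP Hd _]]]] := surface_star hS emb x.
have [i _] := arm_exists Xx.
have [y [My Ny Py]] := Hd i _ (near_join nM).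
by have [ye _ _] := HP i y Ny Py; exact: int (arms_edge i) ye My.
Qed.

(** The common value near [y] off the drawing, even if [y] is on the drawing. *)
Definition jumpless_value (s : S -> bool) (y : S) : bool := `[< \forall z \near y, ~ X z -> s z = true >].

Lemma jumpless_value_eq s y c : (\forall z \near y, ~ X z -> s z = c) -> jumpless_value s y = c.
Proof.
move=> Hc; case: c Hc => Hc; first by rewrite /jumpless_value asboolT.
rewrite /jumpless_value asboolF// => Ht; have [z [/= h1 h2] Xz] := off_drawing_dense (filterI Hc Ht).
by move: (h1 Xz) (h2 Xz) => ->.
Qed.

Lemma jumpless_valueP s y : lc s y -> \forall z \near y, ~ X z -> s z = jumpless_value s y.
Proof. by move=> [c Hc]; rewrite (jumpless_value_eq Hc). Qed.

Lemma locst_jumpless_value s y : lc s y -> locst (jumpless_value s) y.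
Proof.
move=> [c Hc]; apply: (@locstP _ _ _ c).
by apply: filterS (near_join Hc) => z; exact: jumpless_value_eq.
Qed.

Lemma locst_surface (s : S -> bool) : (forall x, locst s x) -> forall x y, s x = s y.
Proof.
move=> sl x y; have [_ _ _ conn _] := hS.
pose B := [set z | s z = s x].
have oB : open B.
  by rewrite openE => z /= zx; have := sl z; apply: filterS => w wz; rewrite /B /= wz.
have cB : closed B.
  rewrite -[B]setCK; apply: open_closedC; rewrite openE => z /= zx.
  by have := sl z; apply: filterS => w wz; rewrite /B /= wz.
have : B = [set: S].
  apply: conn; first by exists x.
    by exists B => //; rewrite setTI.
  by exists B => //; rewrite setTI.
by move=> BT; apply/esym; have : [set: S] y by []; rewrite -BT.
Qed.

(** Such a function has no jumps at vertices either by [no_jump], so it extends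
    to a locally constant function on the connected surface. *)
Lemma const_off_drawing s : (forall y, ~ X y -> locst s y) ->
  (forall e y, e \in edges G -> interior_of g e y -> lc s y) ->
  exists b, forall y, ~ X y -> s y = b.
Proof.
move=> hs hj; have soff w : off_locst_near s w.
  by apply: nearW => ?; exact: hs.
have slc x : lc s x.
  apply: no_jump => //; apply: filterS (near_interior x) => y hy yx Xy.
  by have [i eE ye] := hy Xy yx; exact: hj eE ye.
have [[x0 _] _ _ _ _] := hS.
exists (jumpless_value s x0) => y Xy; rewrite -(locst_surface (fun x => locst_jumpless_value (slc x)) y x0).
exact: (nbhs_singleton (jumpless_valueP (slc y))).
Qed.

End Jumps.

(** * Cyclic edge sets and their cocycles *)

Definition cyclic_set (G : sgraph) (z : {set {set G}}) :=
  z \subset edges G /\ forall v : G, ~~ odd #|[set e in z | v \in e]%SET|.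

Lemma eq_pair (A B : Type) (a b : A * B) : a.1 = b.1 -> a.2 = b.2 -> a = b.
Proof. by case: a b => [a1 a2] [b1 b2] /= -> ->. Qed.

Section Cycles.
Variables (R : realType) (S : topologicalType) (hS : closed_surface R S).
Variables (G : sgraph) (p : G -> S) (g : {set G} -> R -> S) (emb : embedding p g).

Let X := drawing g.
Let lc := jumpless g.

Lemma vertex_arm_inj v : injective (fun i : arms_at g (p v) => (val i).1).
Proof.
move=> i j /= eij.
have [/asboolP[iE [t [t01 it dt]]] /asboolP[_ [u [u01 ju du]]]] := (valP i, valP j).
have tu : t = u by apply: (curve_inj emb iE) => //; rewrite it eij ju.
have nt : ~~ (0 < t < 1) by apply/negP => /(curve_vertex emb (v := v) iE); apply.
apply/val_inj/eq_pair => //; move: dt du; rewrite -tu.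
by case: (val i).2; case: (val j).2 => // ? ?; exfalso; move/negP: nt; apply; lra.
Qed.

Lemma vertex_arm_ex v e : e \in edges G -> v \in e -> exists i : arms_at g (p v), (val i).1 = e.
Proof.
move=> eE ve; have [_ /(_ e eE)[_ ends] _ _] := emb.
have : (p @` [set` e]) (p v) by exists v.
rewrite -ends => -[/= ev|/= ev].
  have lv : leaves g (p v) (e, true).
    by split=> //; exists 0; split; [exact: zero01|rewrite curveE// zero01|exact: ltr01].
  by exists (exist _ (e, true) (asboolT lv)).
have lv : leaves g (p v) (e, false).
  by split=> //; exists 1; split; [exact: one01|rewrite curveE// one01|exact: ltr01].
by exists (exist _ (e, false) (asboolT lv)).
Qed.

Lemma arm_vertex_mem v (i : arms_at g (p v)) : v \in (val i).1.
Proof.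
have /asboolP[iE [t [t01 it _]]] := valP i.
have nt : ~~ (0 < t < 1) by apply/negP => /(curve_vertex emb (v := v) iE); apply.
have [w we] := curve_end emb iE t01 nt; rewrite it => pvw.
have wv : w = v by have [pinj _ _ _] := emb; exact/esym/pinj.
by move: we; rewrite wv.
Qed.

Lemma card_vertex_arms v (J : {set arms_at g (p v)}) (z : {set {set G}}) :
  z \subset edges G -> (forall i, i \in J <-> (val i).1 \in z) ->
  #|J| = #|[set e in z | v \in e]%SET|.
Proof.
move=> /fintype.subsetP zE Jz; rewrite -(card_imset _ (@vertex_arm_inj v)).
congr #|pred_of_set _|; apply/setP => e; rewrite inE; apply/imsetP/andP => [[i /Jz iz ->]|[ez ve]].
  by rewrite iz arm_vertex_mem.
have [i ie] := vertex_arm_ex (zE e ez) ve.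
by exists i => //; apply/Jz; rewrite ie.
Qed.

(** At a vertex this is the condition on [z]; at an inner point of an edge both
    arms or none belong to edges of [z]. *)
Lemma even_arms z x : cyclic_set z ->
  ~~ odd #|[set i : arms_at g x | (val i).1 \in z]%SET|.
Proof.
move=> [zE zev]; have [[v pvx]|nov] := pselect (exists v, p v = x).
  by subst x; rewrite (@card_vertex_arms v _ z)// => i; rewrite inE.
have [[e [eE ye]]|noi] := pselect (exists e, e \in edges G /\ interior_of g e x).
  have [ez|ez] := boolP (e \in z).
    have -> : [set i : arms_at g x | (val i).1 \in z]%SET = [set: arms_at g x]%SET.
      by apply/setP => i; rewrite !inE (arms_interior emb i eE ye).
    by rewrite cardsT (card_arms_interior emb eE ye).
  have -> : [set i : arms_at g x | (val i).1 \in z]%SET = finset.set0.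
    by apply/setP => i; rewrite !inE (arms_interior emb i eE ye) (negbTE ez).
  by rewrite cards0.
have -> : [set i : arms_at g x | (val i).1 \in z]%SET = finset.set0; last by rewrite cards0.
apply/setP => i; exfalso; have /asboolP[iE [t [t01 it _]]] := valP i.
have [t01'|nt] := boolP (0 < t < 1).
  by apply: noi; exists (val i).1; split=> //; exists t.
by have [w we] := curve_end emb iE t01 nt; rewrite it => pvw; apply: nov; exists w.
Qed.

(** The sum of the functions of those arms at [x] that belong to edges of [z];
    it exists because their number is even. *)
Lemma local_function z x : cyclic_set z -> exists c : S -> bool, off_locst_near g c x /\
  \forall y \near x, forall e, e \in edges G -> interior_of g e y -> (lc c y <-> e \notin z).
Proof.
move=> zc; have [F [N [P [[oN Nx] HX HP Hd [HA HC]]]]] := surface_star hS emb x.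
have nN : \forall y \near x, N y by exact: open_nbhs_nbhs.
pose J : {set arms_at g x} := [set i : arms_at g x | (val i).1 \in z]%SET.
have Jeven : ~~ odd #|J| by exact: even_arms.
pose c y := \big[addb/false]_(j in J) F j y.
have coff : off_locst_near g c x by apply: filterS nN => y Ny; exact: HA.
have away : \forall y \near x, y <> x -> forall e, e \in edges G -> interior_of g e y ->
    (lc c y <-> e \notin z).
  apply: filterS nN => y Ny yx e eE ye.
  have [i Piy] := HX y Ny (interior_drawing eE ye) yx.
  have [ye' _ /(_ J Jeven) h] := HP i y Ny Piy.
  by rewrite (interior_unique emb eE (arms_edge i) ye ye'); split=> [/h|hz]; [|apply/h]; rewrite inE.
exists c; split=> //; apply: filterS (away) => y hy e eE ye.
have [yx|] := pselect (y = x); last by move=> /hy; exact.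
subst y.
split=> [l|ez].
  apply/negP => ez; have [i _] := arm_exists (interior_drawing eE ye).
  have [y [[/= ly hay] Ny Piy]] := Hd i _ (filterI (lc_near l) away).
  have [ye' yx _] := HP i y Ny Piy.
  have := hay yx _ (arms_edge i) ye'; rewrite (arms_interior emb i eE ye) => -[/(_ ly)].
  by rewrite ez.
apply: (no_jump hS emb) => //.
apply: filterS2 away (near_interior hS emb x) => y hay hi yx Xy.
have [i iE ye'] := hi Xy yx; apply/(hay yx _ iE ye').
by rewrite (arms_interior emb i eE ye).
Qed.

Section CycleCocycle.
Variables (z : {set {set G}}) (zc : cyclic_set z).

Definition cycle_local x : S -> bool := sval (cid (local_function x zc)).

Lemma cycle_local_off x : off_locst_near g (cycle_local x) x.
Proof. by rewrite /cycle_local; case: cid => c []. Qed.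

Lemma cycle_local_jump x : \forall y \near x, forall e, e \in edges G -> interior_of g e y ->
  (lc (cycle_local x) y <-> e \notin z).
Proof. by rewrite /cycle_local; case: cid => c []. Qed.

Lemma cycle_local_diff x : \forall y \near x, lc (fun w => cycle_local x w (+) cycle_local y w) y.
Proof.
have o1 := off_locst_near_join (cycle_local_off x); have j1 := near_join (cycle_local_jump x).
apply: filterS2 o1 j1 => y oxy jxy.
apply: (no_jump hS emb); first exact: off_locst_nearD oxy (cycle_local_off y).
have oxy' := off_locst_near_join oxy; have oyy := off_locst_near_join (cycle_local_off y).
apply: filterS3 (filterI oxy' oyy) (filterI jxy (cycle_local_jump y)) (near_interior hS emb y).
move=> w [oxw oyw] [jxw jyw] hi wy Xw.
have [i iE we] := hi Xw wy; have := jxw _ iE we; have := jyw _ iE we.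
case: (boolP (_ \in z)) => iz hy hx.
  apply: (jump_add hS emb iE we) => //.
    by move=> /hx.
  by move=> /hy.
by apply: lcD; [apply/hx|apply/hy].
Qed.

(** The differences of the local functions have no jumps, but their values on
    the drawing are arbitrary; the values nearby make them a cocycle on the
    whole surface. *)
Definition cycle_cocycle x y := jumpless_value g (fun w => cycle_local x w (+) cycle_local y w) y.

Lemma cycle_cocycleP : cocycle [set: S] cycle_cocycle.
Proof.
move=> x _; apply: filterS2 (cycle_local_diff x) (near_join (cycle_local_diff x)) => y lxy nxy.
apply: eq_locst (locst_jumpless_value hS emb lxy).
apply: filterS3 nxy (cycle_local_diff y) (near_join (jumpless_valueP hS emb lxy)) => w lxw lyw _.
apply: (jumpless_value_eq hS emb).
apply: filterS2 (jumpless_valueP hS emb lxw) (jumpless_valueP hS emb lyw) => v hx hy Xv.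
by rewrite /cycle_cocycle -(hx Xv) -(hy Xv); xor_ring.
Qed.

Lemma cycle_cocycle_near x : \forall w \near x, ~ X w ->
  cycle_cocycle x w = cycle_local x w (+) cycle_local w w.
Proof.
apply: filterS (cycle_local_diff x) => w lw Xw.
exact/esym/(nbhs_singleton (jumpless_valueP hS emb lw)).
Qed.

End CycleCocycle.

(** Off the drawing each cocycle is trivialized by the values [cycle_local w w],
    so correcting [f] by these gives a function [s] that is locally constant
    there; near an edge it is the sum of two local functions, up to a jumpless
    one, and so jumps where exactly one of them does. *)
Lemma cycles_difference z z' (zc : cyclic_set z) (zc' : cyclic_set z') f :
  trivializes [set: S] (fun x y => cycle_cocycle zc x y (+) cycle_cocycle zc' x y) f ->
  exists s : S -> bool, (forall y, ~ X y -> locst s y) /\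
    forall e y, e \in edges G -> interior_of g e y -> (lc s y <-> (e \in z) = (e \in z')).
Proof.
move=> fP; pose a := cycle_local zc; pose a' := cycle_local zc'.
pose s w := f w (+) (a w w (+) a' w w).
have key x : lc (fun w => s w (+) (a x w (+) a' x w)) x.
  have l : lc (fun w => f w (+) (cycle_cocycle zc x w (+) cycle_cocycle zc' x w)) x.
    by apply: locst_lc; exact: fP.
  apply: eq_lc l.
  apply: filterS2 (cycle_cocycle_near zc x) (cycle_cocycle_near zc' x) => w h h' Xw.
  by rewrite h// h'// /s -/a -/a'; xor_ring.
have soff y : ~ X y -> locst s y.
  move=> Xy; apply: (lc_locst hS emb Xy).
  have l1 := nbhs_singleton (cycle_local_off zc y) Xy.
  have l2 := nbhs_singleton (cycle_local_off zc' y) Xy.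
  have l : lc (fun w => a y w (+) a' y w) y by apply: locst_lc; exact: locstD.
  apply: eq_lc (lcD (key y) l).
  by apply: nearW => w _; xor_ring.
exists s; split=> // e y eE ye.
have offs w : off_locst_near g s w.
  by apply: nearW => ?; exact: soff.
have j1 := nbhs_singleton (cycle_local_jump zc y) e eE ye.
have j2 := nbhs_singleton (cycle_local_jump zc' y) e eE ye.
have o1 := cycle_local_off zc y; have o2 := cycle_local_off zc' y.
have sum_to t t' : (forall w, t w = t' w) -> lc t y -> lc t' y.
  by move=> tt lt; apply: eq_lc lt; apply: nearW => w _.
have xs : lc s y <-> lc (fun w => a y w (+) a' y w) y.
  by split=> l; apply: sum_to (lcD (key y) l) => w; xor_ring.
rewrite {}xs; case: (boolP (e \in z)) j1 => ez j1; case: (boolP (e \in z')) j2 => ez' j2.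
- by split=> // _; apply: (jump_add hS emb eE ye) => //; [by move/j1|by move/j2].
- split=> // l; have : lc (a y) y by apply: sum_to (lcD l (j2.2 isT)) => w; rewrite /a /a'; xor_ring.
  by move/j1.
- split=> // l; have : lc (a' y) y by apply: sum_to (lcD l (j1.2 isT)) => w; rewrite /a /a'; xor_ring.
  by move/j2.
- by split=> // _; apply: lcD; [apply/j1|apply/j2].
Qed.

End Cycles.

(** * Jump sets are cyclic; the two sides of an edge *)

Section Sides.
Variables (R : realType) (S : topologicalType) (hS : closed_surface R S).
Variables (G : sgraph) (p : G -> S) (g : {set G} -> R -> S) (emb : embedding p g).

Let X := drawing g.
Let lc := jumpless g.

Definition off_locst (s : S -> bool) := forall y, ~ X y -> locst s y.

Definition middle (e : {set G}) : S := curve g e 2^-1.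

Definition jumps s := [set e in edges G | ~~ `[< lc s (middle e) >]]%SET.

Lemma off_locstW s y : off_locst s -> off_locst_near g s y.
Proof. by move=> hs; apply: nearW => ?; exact: hs. Qed.

Lemma interior_middle e : interior_of g e (middle e).
Proof. by exists 2^-1 => //; lra. Qed.

Lemma jumpsP s e y : off_locst s -> e \in edges G -> interior_of g e y ->
  (e \in jumps s) <-> ~ lc s y.
Proof.
move=> hs eE ye; have h := lc_edge hS emb eE hs ye (interior_middle e).
rewrite inE eE /=; split; first by move=> /asboolP n /h.
by move=> n; apply/asboolP => /h.
Qed.

(** Near a vertex the function is, up to a constant, the sum of the functions of
    an even number of arms, and it jumps exactly at the edges of these arms. *)
Lemma jumps_cyclic s : off_locst s -> cyclic_set (jumps s).
Proof.
move=> hs; split; first by apply/fintype.subsetP => e; rewrite inE => /andP[].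
move=> v; have [F [N [P [[oN Nx] HX HP Hd [HA HC]]]]] := surface_star hS emb (p v).
have [J [c [Jeven HJ]]] := HC s (off_locstW _ hs).
rewrite -(card_vertex_arms emb (J := J))//.
  by apply/fintype.subsetP => e; rewrite inE => /andP[].
move=> i; have [y [HJy Ny Py]] := Hd i _ (near_join HJ).
have [ye _ /(_ J Jeven) h] := HP i y Ny Py.
have h1 : lc s y -> lc (fun z => \big[addb/false]_(j in J) F j z) y.
  move=> l; apply: eq_lc (lcD l (lc_cst _ c y)).
  by apply: filterS HJy => z Hz Xz; rewrite Hz//; xor_ring.
have h2 : lc (fun z => \big[addb/false]_(j in J) F j z) y -> lc s y.
  move=> l; apply: eq_lc (lcD l (lc_cst _ c y)).
  by apply: filterS HJy => z Hz Xz; rewrite Hz.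
have jP := jumpsP hs (arms_edge i) ye.
split=> [iJ|/jP n]; first by apply/jP => /h1 /h; rewrite iJ.
by apply: contrapT => /negP iJ; apply: n; apply/h2/h.
Qed.

Lemma jumps0_const s : off_locst s -> jumps s = finset.set0 ->
  exists b, forall y, ~ X y -> s y = b.
Proof.
move=> hs j0; apply: (const_off_drawing hS emb hs) => e y eE ye.
by apply: contrapT => n; have /(jumpsP hs eE ye) := n; rewrite j0 inE.
Qed.

(** Near the middle of the edge every function is constant, [s0] or its
    negation, up to values on the drawing; so it is constant on each of the two
    sets, the sides, that [s0] distinguishes. Evaluation at a side commutes with
    Boolean operations. *)
Lemma edge_sides e : e \in edges G -> exists val : bool -> (S -> bool) -> bool,
  [/\ forall i s t, off_locst s -> off_locst t ->
        val i (fun z => s z && t z) = val i s && val i t,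
      forall i s, off_locst s -> val i (fun z => ~~ s z) = ~~ val i s,
      forall i s b, (forall y, ~ X y -> s y = b) -> val i s = b &
      forall s, off_locst s -> (e \in jumps s) = (val false s != val true s)].
Proof.
move=> eE; have ye := interior_middle e; set y := middle e in ye.
have [s0 [n0 o0 nj H]] := interior_decompose hS emb eE ye.
have acc i M : nbhs y M -> exists z, [/\ M z, ~ X z & s0 z = i].
  move=> nM; apply: contrapT => no; apply: n0; exists (~~ i).
  apply: filterS nM => z Mz Xz; apply: contrapT => n.
  by apply: no; exists z; split=> //; case: (s0 z) (i) n => -[].
pose val i s := `[< \forall z \near y, ~ X z -> s0 z = i -> s z = true >].
have valE i s b : (\forall z \near y, ~ X z -> s0 z = i -> s z = b) -> val i s = b.
  case: b => h; first by rewrite /val asboolT.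
  rewrite /val asboolF// => h'; have [z [[/= h1 h2] Xz zi]] := acc i _ (filterI h h').
  by move: (h1 Xz zi) (h2 Xz zi) => ->.
have valP i s : off_locst s -> \forall z \near y, ~ X z -> s0 z = i -> s z = val i s.
  move=> hs; have [d [c Hs]] := H s (off_locstW _ hs).
  have h : \forall z \near y, ~ X z -> s0 z = i -> s z = (d && i) (+) c.
    by apply: filterS Hs => z hz Xz zi; rewrite hz// zi.
  by rewrite (valE i s _ h).
exists val; split=> [i s t hs ht|i s hs|i s b sb|s hs].
- apply: valE; apply: filterS2 (valP i s hs) (valP i t ht) => z h1 h2 Xz zi.
  by rewrite h1// h2.
- by apply: valE; apply: filterS (valP i s hs) => z h Xz zi; rewrite h.
- by apply: valE; apply: nearW => z Xz _; exact: sb.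
apply/idP/idP => [/(jumpsP hs eE ye) n|].
  apply/negP => /eqP vv; apply: n; exists (val true s).
  apply: filterS2 (valP true s hs) (valP false s hs) => z h1 h2 Xz.
  by case E : (s0 z); [exact: h1|rewrite -vv; exact: h2].
move=> vv; apply/(jumpsP hs eE ye) => -[c Hc]; move: vv.
have v i : val i s = c by apply: valE; apply: filterS Hc => z h Xz _; exact: h.
by rewrite !v eqxx.
Qed.

End Sides.

(** * Finiteness of the classes of a closed surface *)

Lemma finite_subcover (S : topologicalType) (V : S -> set S) : compact [set: S] ->
  (forall x, nbhs x (V x)) -> exists L : seq S, forall y, exists2 x, x \in L & V x y.
Proof.
move=> cS nV; apply: contrapT => no.
pose F : set_system S := [set B | exists L : seq S, forall y,
  (forall x, x \in L -> ~ V x y) -> B y].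
have FF : ProperFilter F.
  split; first move=> [L HL].
    apply: no; exists L => y; apply: contrapT => h; apply: (HL y) => x xL Vxy.
    by apply: h; exists x.
  split.
  - by exists [::].
  - move=> A B [L HL] [L' HL']; exists (L ++ L') => y h; split.
      by apply: HL => x xL; apply: h; rewrite mem_cat xL.
    by apply: HL' => x xL; apply: h; rewrite mem_cat xL orbT.
  - by move=> A B AB [L HL]; exists L => y /HL /AB.
have [|x [_ cx]] := cS F FF; first by exists [::].
have [|y [/= h Vy]] := cx (~` V x) (V x) _ (nV x); last exact: h Vy.
by exists [:: x] => y h; apply: h; rewrite mem_head.
Qed.

Section Finiteness.
Variables (R : realType) (S : topologicalType) (hS : closed_surface R S).

Lemma charts : exists (U : S -> set S) (phi : S -> S -> R * R) (psi : S -> R * R -> S),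
  forall x, [/\ open (U x), U x x,
    (forall y, U x y -> cnt (phi x) y) /\ (forall z, cnt (psi x) z),
    forall z, U x (psi x z) &
    (forall y, U x y -> psi x (phi x y) = y) /\ (forall z, phi x (psi x z) = z)].
Proof.
have [_ _ _ _ lp] := hS.
have [U HU] := choice lp.
have H x : exists a : (S -> R * R) * (R * R -> S), [/\ {within U x, continuous a.1},
   continuous a.2, forall z, U x (a.2 z), forall y, U x y -> a.2 (a.1 y) = y & forall z, a.1 (a.2 z) = z].
  by have [_ _ [phi [psi h]]] := HU x; exists (phi, psi).
have [a Ha] := choice H.
exists U, (fun x => (a x).1), (fun x => (a x).2) => x.
have [oU Ux _] := HU x; have [c1 c2 h3 h4 h5] := Ha x.
split=> //; split; first by move=> y Uy; exact: (chart_cnt oU c1 Uy).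
by move=> z; apply/cntP; exact: c2.
Qed.

(** A class is determined by the values of its trivializations over finitely
    many charts at finitely many points, one in each of finitely many small
    connected sets [W y], which are contained in every chart whose compact core
    [K x] they meet. If two cocycles have the same values, the differences of
    their trivializations over the charts vanish at [y]; so for charts whose
    cores meet [W y] these differences agree on [W y], and they glue. *)
Theorem finitely_many_classes : exists (D : finType) (M : nat) (cl : (S -> S -> bool) -> D),
  #|D| = (2 ^ M)%N /\ forall c c', cocycle [set: S] c -> cocycle [set: S] c' -> cl c = cl c' ->
    exists f, trivializes [set: S] (fun x y => c x y (+) c' x y) f.
Proof.
have [_ hausS cS _ _] := hS.
have [U [phi [psi H]]] := charts.
pose V x := [set y | U x y /\ box (phi x x) 1 (phi x y)].
have nV x : \forall y \near x, V x y.
  have [oU Ux [pc _] _ _] := H x.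
  have nU : \forall y \near x, U x y by exact: open_nbhs_nbhs.
  by apply: filterS2 nU (pc x Ux _ (near_in_box _ ltr01)).
have V_near x y : V x y -> \forall z \near y, V x z.
  have [oU Ux [pc _] _ _] := H x; move=> [Uy by_].
  have nU : \forall z \near y, U x z by exact: open_nbhs_nbhs.
  by apply: filterS2 nU (pc y Uy _ (box_nbhs by_)).
pose Q x : set (R * R) := `[(phi x x).1 - 1, (phi x x).1 + 1] `*` `[(phi x x).2 - 1, (phi x x).2 + 1].
pose K x := psi x @` Q x.
have cK x : closed (K x).
  have [_ _ [_ pc] _ _] := H x; apply: compact_closed => //.
  apply: continuous_compact; last by apply: compact_setX; exact: segment_compact.
  by apply: continuous_subspaceT => z; apply/cntP; exact: pc.
have KU x : K x `<=` U x by move=> y [z _ <-]; have [] := H x.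
have VK x : V x `<=` K x.
  move=> y [Uy]; rewrite boxE => /and4P[h1 h2 h3 h4].
  have [_ _ _ _ [pK _]] := H x; exists (phi x y); last exact: pK.
  by split; rewrite /= in_itv /= !ltW.
have [L1 HL1] := finite_subcover cS nV.
(* near [y], membership in a core is only lost, and only inside its chart *)
pose O y := [set w | forall x, x \in L1 -> (K x y -> U x w) /\ (~ K x y -> ~ K x w)].
have nO y : nbhs y (O y).
  suff h (L : seq S) : \forall w \near y, forall x, x \in L ->
      (K x y -> U x w) /\ (~ K x y -> ~ K x w) by exact: h.
  apply: near_seq => x _; have [Kxy|Kxy] := pselect (K x y).
    have [oU _ _ _ _] := H x; have nU : \forall w \near y, U x w.
      by apply: open_nbhs_nbhs; split=> //; exact: KU.
    by apply: filterS nU => w Uw; split.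
  by apply: filterS (near_off (cK x) Kxy) => w Kw; split.
have WE y : exists W : set S, [/\ nbhs y W, W `<=` O y &
    forall s : S -> bool, (forall w, W w -> locst s w) -> forall w, W w -> s w = s y].
  have [oU Uy [pc qc] psiU [pK qK]] := H y.
  have /near_box[e e0 He] : \forall w \near phi y y, O y (psi y w).
    by apply: qc; rewrite pK.
  exists [set w | U y w /\ box (phi y y) e (phi y w)]; split.
  - have nU : \forall z \near y, U y z by exact: open_nbhs_nbhs.
    by apply: filterS2 nU (pc y Uy _ (near_in_box _ e0)).
  - by move=> w [Uw bw]; rewrite -(pK w Uw); exact: He.
  move=> s sl w [Uw bw]; rewrite -(pK w Uw) -[in RHS](pK y Uy).
  apply: (@locst_cvx R (box (phi y y) e) (s \o psi y)) => //.
  - exact: cvx_box.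
  - move=> z bz; apply: locst_comp; first exact: qc.
    by apply: sl; split; rewrite ?qK.
  - exact: box_self.
have [W HW] := choice WE.
have [L2 HL2] := finite_subcover cS (fun y => let: And3 h _ _ := HW y in h).
have triv c x : exists f, cocycle [set: S] c -> trivializes (U x) c f.
  have [cc|nc] := pselect (cocycle [set: S] c); last by exists (fun=> false).
  have [oU Ux [pc qc] psiU [pK qK]] := H x.
  have [|||f Hf] := @cvx_trivial R setT (fun a b => c (psi x a) (psi x b)).
  - exact: openT.
  - by [].
  - move=> a _; have := qc a _ (cc (psi x a) I); apply: filterS => b hb.
    by apply: (@locst_comp _ _ (psi x) (fun w => c (psi x a) w (+) c (psi x b) w)).
  exists (f \o phi x) => _ y Uy.
  have := @locst_comp _ _ (phi x) _ y (pc y Uy) (Hf (phi x y) I).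
  have nU : \forall z \near y, U x z by exact: open_nbhs_nbhs.
  apply: eq_locst; apply: filterS nU => z Uz.
  by rewrite /= !pK.
have triv2 c : exists f : S -> S -> bool, forall x, cocycle [set: S] c -> trivializes (U x) c (f x).
  by have [f Hf] := choice (triv c); exists f.
have [tr Htr] := choice triv2.
pose D := {ffun 'I_(size L1) * 'I_(size L2) -> bool}.

have [[x0 _] _ _ _ _] := hS.
pose cl c : D := [ffun ij : 'I_(size L1) * 'I_(size L2) => tr c (nth x0 L1 ij.1) (nth x0 L2 ij.2)].
exists D, (size L1 * size L2)%N, cl; split.
  by rewrite card_ffun card_bool card_prod !card_ord.
move=> c c' cc cc' clE.
pose T x z := tr c x z (+) tr c' x z.
have T0 x y : x \in L1 -> y \in L2 -> T x y = false.
  move=> xL yL; have := xL; rewrite -index_mem => xi; have := yL; rewrite -index_mem => yi.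
  have := congr1 (fun d : D => d (Ordinal xi, Ordinal yi)) clE; rewrite !ffunE /=.
  by rewrite !nth_index// /T => ->; rewrite addbb.
have Ttriv x : trivializes (U x) (fun x y => c x y (+) c' x y) (T x).
  move=> z Uz; apply: eq_locstW (locstD (Htr c x cc z Uz) (Htr c' x cc' z Uz)) => w.
  by rewrite /T; xor_ring.
have agree x x' z : x \in L1 -> x' \in L1 -> V x z -> V x' z -> T x z = T x' z.
  move=> xL xL' /VK Kz /VK Kz'.
  have [y yL Wyz] := HL2 z; have [_ WO Wc] := HW y.
  have Kxy a : a \in L1 -> K a z -> K a y.
    by move=> aL Ka; apply: contrapT => n; have [_ /(_ n)] := WO z Wyz a aL.
  have WU a w : a \in L1 -> K a z -> W y w -> U a w.
    by move=> aL Ka /WO /(_ a aL)[+ _]; apply; exact: Kxy.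
  have : T x z (+) T x' z = T x y (+) T x' y.
    apply: (Wc (fun w => T x w (+) T x' w)) => // w Ww.
    by apply: trivializes_diff (Ttriv x w (WU x w xL Kz Ww)) (Ttriv x' w (WU x' w xL' Kz' Ww)).
  by rewrite (T0 x y)// (T0 x' y)//; case: (T x z); case: (T x' z).
have aE z : exists x, x \in L1 /\ V x z by have [x xL Vx] := HL1 z; exists x.
have [a Ha] := choice aE.
exists (fun z => T (a z) z) => z _; have [aL Vaz] := Ha z.
apply: eq_locst (Ttriv (a z) z (KU _ _ (VK _ _ Vaz))).
apply: filterS (V_near _ _ Vaz) => w Vw; have [awL Vaw] := Ha w.
by rewrite (agree (a z) (a w)).
Qed.

End Finiteness.

(** * Counting: the edge bound *)

Section SymDiff.
Variable T : finType.
Implicit Types A B : {set T}.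

Definition symd A B : {set T} := [set x | (x \in A) (+) (x \in B)]%SET.

Lemma symdK A : cancel (fun B => symd B A) (fun B => symd B A).
Proof. by move=> B; apply/setP => x; rewrite !inE; xor_ring. Qed.

Lemma symdE A B x : (x \in symd A B) = (x \in A) (+) (x \in B).
Proof. by rewrite inE. Qed.

Lemma odd_symd A B : odd #|symd A B| = odd #|A| (+) odd #|B|.
Proof.
rewrite -(cardsID B A) -(cardsID A B) (finset.setIC B A) !oddD.
have -> : odd #|symd A B| = odd #|A :\: B| (+) odd #|B :\: A|.
  rewrite -oddD -cardsUI.
  have -> : (A :\: B) :&: (B :\: A) = finset.set0.
    by apply/setP => x; rewrite !inE; case: (x \in A); case: (x \in B).
  rewrite cards0 addn0; congr (odd #|pred_of_set _|); apply/setP => x; rewrite !inE.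
  by case: (x \in A); case: (x \in B).
by xor_ring.
Qed.

(** A set is recovered from its invariant and its difference from a fixed
    representative of the sets with this invariant. *)
Lemma card_torsor (B : finType) (A K : {set {set T}}) (h : {set T} -> B) :
  (forall a a', a \in A -> a' \in A -> h a = h a' -> symd a a' \in K) ->
  (#|A| <= #|B| * #|K|)%N.
Proof.
move=> hK.
pose rep b := odflt finset.set0 [pick a in A | h a == b].
have repP a : a \in A -> rep (h a) \in A /\ h (rep (h a)) = h a.
  move=> aA; rewrite /rep; case: pickP => [a' /andP[a'A /eqP]//|/(_ a)].
  by rewrite aA eqxx.
pose f a := (h a, symd a (rep (h a))).
have finj : {in A &, injective f}.
  move=> a a' _ _ [hh e]; rewrite -hh in e.
  exact: (can_inj (symdK (rep (h a)))) e.
rewrite -(card_in_imset finj) -cardsT -cardsX.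
apply/subset_leq_card/fintype.subsetP => _ /imsetP[a aA ->]; rewrite !inE /=.
by have [rA hr] := repP a aA; exact: hK.
Qed.

End SymDiff.

Section SimpleGraph.
Variable G : sgraph.

Lemma edgeP (e : {set G}) : e \in edges G -> exists x y, [/\ adj x y, x != y & e = [set x; y]%SET].
Proof.
rewrite inE => /existsP[x /existsP[y /andP[xy /eqP->]]]; exists x, y; split=> //.
by apply: contraTneq xy => ->; rewrite adj_irrefl.
Qed.

Lemma symd_cyclic (z z' : {set {set G}}) : z \subset edges G -> z' \subset edges G ->
  (forall v, odd #|[set e in z | v \in e]%SET| = odd #|[set e in z' | v \in e]%SET|) ->
  cyclic_set (symd z z').
Proof.
move=> zE zE' par; split.
  apply/fintype.subsetP => e; rewrite inE.
  by case: (boolP (e \in z)) => [/(fintype.subsetP zE)//|_]; case: (boolP (e \in z')) => [/(fintype.subsetP zE')|].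
move=> v; have -> : [set e in symd z z' | v \in e]%SET =
    symd [set e in z | v \in e]%SET [set e in z' | v \in e]%SET.
  apply/setP => e; rewrite !inE.
  by case: (v \in e); rewrite ?andbT ?andbF.
by rewrite odd_symd par addbb.
Qed.

Lemma even_other (T : finType) (A : {set T}) x : ~~ odd #|A| -> x \in A ->
  exists2 y, y \in A & y != x.
Proof.
rewrite (cardsD1 x) => + xA; rewrite xA add1n /= negbK => o.
have /card_gt0P[y] : (0 < #|A :\ x|)%N by rewrite lt0n; apply: contraTneq o => ->.
by rewrite !inE => /andP[yx yA]; exists y.
Qed.

(** An edge [e] of a cyclic set is continued at each of its two ends by another
    one; these differ, as the graph is simple. *)
Lemma cyclic_card3 (z : {set {set G}}) e : cyclic_set z -> e \in z -> (3 <= #|z|)%N.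
Proof.
move=> [zE zev] ez; have [u [v [uv neq eE]]] := edgeP (fintype.subsetP zE _ ez).
have [|e1] := even_other (x := e) (zev u); first by rewrite !inE ez eE !inE eqxx.
rewrite !inE => /andP[e1z ue1] e1e.
have [|e2] := even_other (x := e) (zev v); first by rewrite !inE ez eE !inE eqxx orbT.
rewrite !inE => /andP[e2z ve2] e2e.
have e12 : e1 != e2.
  apply: contraNneq e1e => e12; have [x [y [_ _ e1E]]] := edgeP (fintype.subsetP zE _ e1z).
  rewrite -e12 in ve2; move: ue1 ve2; rewrite e1E eE !inE.
  move=> /orP[/eqP xu|/eqP xu] /orP[/eqP yv|/eqP yv]; subst; rewrite ?eqxx // in neq *.
  by rewrite finset.setUC.
have : (#|[set e; e1; e2]%SET| <= #|z|)%N.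
  apply/subset_leq_card/fintype.subsetP => x; rewrite !inE => /orP[/orP[]|] /eqP-> //.
apply: leq_trans; rewrite !cardsU !cards1.
have -> : [set e] :&: [set e1] = finset.set0.
  by apply/setP => x; rewrite !inE; apply/negP => /andP[/eqP->]; rewrite eq_sym (negbTE e1e).
have -> : ([set e; e1]%SET) :&: [set e2] = finset.set0.
  apply/setP => x; rewrite !inE; apply/negP => /andP[/orP[]/eqP-> /eqP h].
    by rewrite h eqxx in e2e.
  by rewrite h eqxx in e12.
by rewrite !cards0.
Qed.

End SimpleGraph.

Lemma jumpsE (R : realType) (S : topologicalType) (G : sgraph) (g : {set G} -> R -> S) s e :
  (e \in jumps g s) = (e \in edges G) && ~~ `[< jumpless g s (middle g e) >].
Proof. by rewrite inE. Qed.

Section EdgeBound.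
Variables (R : realType) (S : topologicalType) (hS : closed_surface R S).
Variables (G : sgraph) (p : G -> S) (g : {set G} -> R -> S) (emb : embedding p g).

Let X := drawing g.
Let E := edges G.
Let H := off_locst g.

Lemma off_locst_cst b : H (fun=> b).
Proof. by move=> y _; exact: locst_cst. Qed.

Lemma off_locst_and s t : H s -> H t -> H (fun z => s z && t z).
Proof.
by move=> hs ht y Xy; move: (hs y Xy) (ht y Xy); rewrite /locst; apply: filterS2 => z -> ->.
Qed.

Lemma off_locst_neg s : H s -> H (fun z => ~~ s z).
Proof. by move=> hs y Xy; move: (hs y Xy); rewrite /locst; apply: filterS => z ->. Qed.

Definition jump_sets : {set {set {set G}}} :=
  [set z : {set {set G}} | `[< exists2 s, H s & jumps g s = z >]]%SET.

Let sides_ex (e : {set G}) : exists val : bool -> (S -> bool) -> bool, e \in E ->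
  [/\ forall i s t, H s -> H t -> val i (fun z => s z && t z) = val i s && val i t,
      forall i s, H s -> val i (fun z => ~~ s z) = ~~ val i s,
      forall i s b, (forall y, ~ X y -> s y = b) -> val i s = b &
      forall s, H s -> (e \in jumps g s) = (val false s != val true s)].
Proof.
have [eE|eE] := boolP (e \in E); last by exists (fun _ _ => false).
by have [val h] := edge_sides hS emb eE; exists val.
Qed.

(** The [f] faces are the classes of sides of edges that no function locally
    constant off the drawing distinguishes; the values on them determine the
    jumps. Some function is true exactly at the sides of a given face, as finite
    conjunctions of functions are allowed, and its jumps form a cyclic set. For
    a face with at most two sides this function would have no jumps by
    [cyclic_card3], so it would be constant and all sides would belong to this
    face. *)
Lemma card_jump_sets : (1 < #|E|)%N -> exists2 f, (3 * f <= 2 * #|E|)%N & (#|jump_sets| <= 2 ^ f)%N.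
Proof.
move=> E2; have [val valP] := choice sides_ex.
pose v (q : {set G} * bool) s := val q.1 q.2 s.
pose Q : {set {set G} * bool} := [set q | q.1 \in E]%SET.
have QE q : (q \in Q) = (q.1 \in E) by rewrite inE.
have cardQ : #|Q| = (2 * #|E|)%N.
  have -> : Q = finset.setX E [set: bool]%SET by apply/setP => q; rewrite !inE andbT.
  by rewrite cardsX cardsT card_bool mulnC.
pose r q q' := `[< forall s, H s -> v q s = v q' s >].
have req : {in Q & &, equivalence_rel r}.
  move=> a b c _ _ _; split; first by apply/asboolP.
  by move=> /asboolP ab; apply/asboolP/asboolP => h s hs; rewrite -h// ab.
have part := equivalence_partitionP req.
set C := equivalence_partition r Q in part.
have CE D q : D \in C -> q \in D -> q \in Q /\ (forall q', (q' \in D) = (q' \in Q) && r q q').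
  move=> /imsetP[a aQ ->]; rewrite inE => /andP[qQ aq]; split=> // q'; rewrite inE.
  apply: andb_id2l => q'Q; apply/asboolP/asboolP => h s hs; move/asboolP: aq => aq.
    by rewrite -aq// h.
  by rewrite aq// h.
have separate q (L : seq ({set G} * bool)) : q \in Q -> {subset L <= Q} ->
    (forall q', q' \in L -> ~~ r q q') ->
    exists2 s, H s & v q s /\ forall q', q' \in L -> v q' s = false.
  move=> qQ; elim: L => [|a L IH] LQ Lr.
    exists (fun=> true); first exact: off_locst_cst.
    split=> //; rewrite QE in qQ; have [_ _ h _] := valP q.1 qQ.
    by rewrite /v (h q.2 _ true).
  have [||s hs [qs Ls]] := IH; first by move=> x xL; apply: LQ; rewrite inE xL orbT.
    by move=> x xL; apply: Lr; rewrite inE xL orbT.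
  have /asboolPn ra := Lr a (mem_head _ _).
  have aQ : a \in Q by apply: LQ; rewrite mem_head.
  have [t ht [qt at_]] : exists2 t, H t & v q t /\ v a t = false.
    have [t [ht tneq]] : exists t, H t /\ v q t <> v a t.
      apply: contrapT => no; apply: ra => t ht; apply: contrapT => h.
      by apply: no; exists t.
    case qt : (v q t) tneq; first by move=> h; exists t => //; split=> //; apply/negbTE/negP => /esym.
    move=> at_; exists (fun z => ~~ t z); first exact: off_locst_neg.
    rewrite !QE in qQ aQ; have [_ hq _ _] := valP q.1 qQ; have [_ ha _ _] := valP a.1 aQ.
    rewrite /v hq// ha// -/(v q t) -/(v a t) qt; split=> //.
    by case: (v a t) at_.
  exists (fun z => s z && t z); first exact: off_locst_and.
  have and_v x : x \in Q -> v x (fun z => s z && t z) = v x s && v x t.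
    by rewrite QE => xE; have [h _ _ _] := valP x.1 xE; exact: h.
  split; first by rewrite and_v// qs qt.
  move=> x; rewrite inE => /orP[/eqP->|xL]; first by rewrite and_v// at_ andbF.
  rewrite and_v; last by apply: LQ; rewrite inE xL orbT.
  by rewrite Ls.
have C3 D : D \in C -> (3 <= #|D|)%N.
  move=> DC; rewrite ltnNge; apply/negP => D2.
  have D0 : D != finset.set0 by have [_ _ /negP h] := and3P part; apply/eqP => D0; apply: h; rewrite -D0.
  have [q qD] := set0Pn _ D0; have [qQ Dq] := CE D q DC qD.
  have [||s hs [qs Ls]] := separate q (enum (Q :\: D)) qQ.
  - by move=> x; rewrite mem_enum inE => /andP[].
  - by move=> x; rewrite mem_enum inE Dq => /andP[+ xQ]; rewrite xQ.
  have vs x : x \in Q -> v x s = (x \in D).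
    move=> xQ; have [xD|xD] := boolP (x \in D); last by rewrite Ls// mem_enum inE xD.
    by move: xD; rewrite Dq xQ => /asboolP <-.
  have jE e : e \in E -> (e \in jumps g s) = ((e, false) \in D) (+) ((e, true) \in D).
    move=> eE; have [_ _ _ h] := valP e eE; rewrite h// -/(v (e, false) s) -/(v (e, true) s).
    by rewrite !vs ?QE//; case: (_ \in D); case: (_ \in D).
  have jc := jumps_cyclic hS emb hs.
  have jD : (#|jumps g s| <= #|D|)%N.
    pose k e := if (e, false) \in D then (e, false) else (e, true).
    have kinj : injective k by move=> a b; rewrite /k; case: ifP; case: ifP => _ _ [].
    rewrite -(card_imset _ kinj); apply/subset_leq_card/fintype.subsetP => _ /imsetP[e ej ->].
    have eE : e \in E by move: ej; rewrite inE => /andP[].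
    by move: ej; rewrite jE// /k; case: ifP => // ->.
  have j0 : jumps g s = finset.set0.
    apply/eqP; rewrite -cards_eq0 -leqn0 leqNgt; apply/negP => /card_gt0P[e ej].
    by have := leq_trans (cyclic_card3 jc ej) (leq_trans jD D2).
  have [b Hb] := jumps0_const hS emb hs j0.
  have vb x : x \in Q -> v x s = b.
    by rewrite QE => xE; have [_ _ h _] := valP x.1 xE; exact: h.
  have QD : Q \subset D.
    by apply/fintype.subsetP => x xQ; rewrite -vs// vb// -(vb q qQ) qs.
  have := subset_leq_card QD; rewrite cardQ => QD'.
  have E4 : (2 * 2 <= 2 * #|E|)%N by rewrite leq_mul2l.
  by have := leq_trans E4 (leq_trans QD' D2).
exists #|C|.
  rewrite -cardQ (card_partition part) mulnC -sum_nat_const.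
  by apply: leq_sum => D DC; exact: C3.
have sel z : exists s, z \in jump_sets -> H s /\ jumps g s = z.
  have [zj|zj] := boolP (z \in jump_sets); last by exists (fun=> false).
  by move: zj; rewrite inE => /asboolP[s hs js]; exists s.
have [w Hw] := choice sel.
pose F z : {set {set {set G} * bool}} := [set D in C | [exists q in D, v q (w z)]]%SET.
have FE z D q : z \in jump_sets -> D \in C -> q \in D -> (D \in F z) = v q (w z).
  move=> zj DC qD; have [hw _] := Hw z zj; have [qQ Dq] := CE D q DC qD.
  rewrite inE DC /=; apply/existsP/idP => [[x /andP[xD]]|vq]; last by exists q; rewrite qD.
  by move: xD; rewrite Dq => /andP[_ /asboolP->].
have Finj : {in jump_sets &, injective F}.
  move=> z z' zj zj' FF; have [hw jw] := Hw z zj; have [hw' jw'] := Hw z' zj'.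
  rewrite -jw -jw'; apply/setP => e.
  have [eE|eE] := boolP (e \in E); last first.
    by apply/idP/idP => ej; case/negP: eE; move: ej; rewrite inE => /andP[].
  have vv i : v (e, i) (w z) = v (e, i) (w z').
    have qQ : (e, i) \in Q by rewrite QE.
    have cov : (e, i) \in finset.cover C by have [/eqP-> _ _] := and3P part.
    have [D DC qD] := finset.bigcupP cov.
    by rewrite -(FE z D)// -(FE z' D)// FF.
  have [_ _ _ h] := valP e eE; rewrite !h//.
  by rewrite -!/(v (e, _) _) !vv.
rewrite -(card_in_imset Finj) -card_powerset.
apply/subset_leq_card/fintype.subsetP => _ /imsetP[z _ ->]; rewrite powersetE.
by apply/fintype.subsetP => D; rewrite inE => /andP[].
Qed.

End EdgeBound.

(** A set of edges is determined by the parities of its degrees up to a cyclic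
    set, a cyclic set by the class of its cocycle up to a jump set, and a jump
    set by the values on the [f] faces. So there are at most
    [2 ^ #|G| * 2 ^ M * 2 ^ f] sets of edges, where [3 * f <= 2 * #|edges G|].
    This gives the constant [3 * M]; one more covers graphs with a single edge,
    which have no such bound on faces. *)
Theorem edge_bound (R : realType) (S : topologicalType) : closed_surface R S ->
  exists M, forall G : sgraph, graph_embeddable R S G -> (#|edges G| <= 3 * #|G| + M)%N.
Proof.
move=> hS; have [D [M [cl [DM clP]]]] := finitely_many_classes hS.
exists (3 * M).+1%N => G [p [g emb]].
have [E1|E2] := leqP #|edges G| 1; first by apply: leq_trans E1 _; rewrite addnS.
have [f f3 Hf] := card_jump_sets hS emb E2.
pose CY : {set {set {set G}}} := [set z : {set {set G}} | `[< cyclic_set z >]]%SET.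
pose clz z : D := if pselect (cyclic_set z) is left zc then cl (cycle_cocycle hS emb zc)
  else cl (fun _ _ => false).
have cCY : (#|CY| <= #|D| * #|jump_sets g|)%N.
  apply: (card_torsor (h := clz)) => z z' zCY z'CY.
  have zc : cyclic_set z by move: zCY; rewrite inE => /asboolP.
  have zc' : cyclic_set z' by move: z'CY; rewrite inE => /asboolP.
  rewrite /clz; case: pselect => // c; case: pselect => // c' clzz.
  have [h Hh] := clP _ _ (cycle_cocycleP hS emb c) (cycle_cocycleP hS emb c') clzz.
  have [s [hs js]] := cycles_difference Hh.
  rewrite inE; apply/asboolP; exists s => //; apply/setP => e; rewrite symdE jumpsE.
  have [eE|eE] := boolP (e \in edges G); last first.
    have [zE _] := c; have [zE' _] := c'.
    rewrite (contraNF (fintype.subsetP zE e) eE) (contraNF (fintype.subsetP zE' e) eE).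
    by [].
  have := js e (middle g e) eE (interior_middle g e).
  case: asboolP => [l [/(_ l) -> _]|n [_ h']]; first by rewrite addbb.
  by apply/esym; move: h'; case: (e \in z); case: (e \in z') => // /(_ erefl).
pose par (z : {set {set G}}) : {ffun G -> bool} := [ffun v => odd #|[set e in z | v \in e]%SET|].
have cE : (#|powerset (edges G)| <= #|{ffun G -> bool}| * #|CY|)%N.
  apply: (card_torsor (h := par)) => a b; rewrite !powersetE => aE bE pp.
  have ab : cyclic_set (symd a b).
    apply: symd_cyclic => // v.
    by have := congr1 (fun h : {ffun G -> bool} => h v) pp; rewrite !ffunE.
  by rewrite inE; apply/asboolP.
move: cE; rewrite card_powerset card_ffun card_bool => cE.
have : (2 ^ #|edges G| <= 2 ^ (#|G| + (M + f)))%N.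
  apply: leq_trans cE _; rewrite !expnD leq_mul2l; apply/orP; right.
  by apply: leq_trans cCY _; rewrite DM leq_mul2l Hf orbT.
rewrite leq_exp2l// => mle.
lia.
Qed.

(** * Moving the uncoloured vertex of a critical digraph *)

Local Open Scope nat_scope.

Section Token.
Variables (D : digraph) (k : nat).

(** The value [c v] is arbitrary: this stands for a dicolouring of the induced
    subdigraph without [v], and keeps all colourings of one type. *)
Definition colours_minus (v : D) (c : D -> 'I_k) :=
  forall i, acyclic_on [set x : D | (x != v) && (c x == i)]%SET.

Lemma dicolourable_widen j : j <= k -> dicolourable D j -> dicolourable D k.
Proof.
move=> jk [c hc]; exists (fun x => widen_ord jk (c x)) => i s cs sA.
case: s cs sA => [|x s] cs sA; first by case: cs.
apply: (hc (c x) (x :: s) cs) => y ys.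
have := sA y ys; have := sA x (mem_head _ _); rewrite !inE => /eqP <- /eqP h.
by apply/eqP/val_inj; have := congr1 val h.
Qed.

Hypothesis not_col : ~ dicolourable D k.
Hypothesis minus_col : forall v, exists c, colours_minus v c.

Local Notation adj := (@underlying_adj D).

Definition nbr (v : D) : {set D} := [set x | adj v x]%SET.

(** Otherwise [v] could take the colour [i]: a monochromatic cycle leaves [v]
    to an out-neighbour, and returns from an in-neighbour, of this colour. *)
Lemma recolour v c i : colours_minus v c ->
  (exists2 x, arc v x & c x = i) /\ (exists2 x, arc x v & c x = i).
Proof.
move=> hc; pose c' x := if x == v then i else c x.
have main (nx : seq D -> D -> D) :
    (forall s x, directed_cycle s -> x \in s -> nx s x \in s) ->
    (forall s, directed_cycle s -> v \in s -> c (nx s v) = i -> nx s v != v -> False) ->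
    (forall s, directed_cycle s -> v \in s -> nx s v != v) -> False.
  move=> nxs nxi nxv; apply: not_col; exists c' => j s cs sA.
  have [vs|vs] := boolP (v \in s).
    have ji : j = i by have := sA v vs; rewrite inE /c' eqxx => /eqP.
    apply: (nxi s cs vs); last exact: nxv.
    by have := sA _ (nxs s v cs vs); rewrite inE /c' (negbTE (nxv s cs vs)) ji => /eqP.
  apply: (hc j s cs) => x xs; have := sA x xs; rewrite !inE /c'.
  have xv : x != v by apply: contraNneq vs => <-.
  by rewrite (negbTE xv).
split; apply: contrapT => no.
  apply: (main (@next D)) => [s x _|s [_ /andP[cs _]] vs cn _|s [_ /andP[cs _]] vs].
  - by rewrite mem_next.
  - by apply: no; exists (next s v) => //; exact: next_cycle cs vs.
  - by apply/eqP => h; have := next_cycle cs vs; rewrite h arc_irrefl.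
apply: (main (@prev D)) => [s x _|s [_ /andP[cs _]] vs cn _|s [_ /andP[cs _]] vs].
- by rewrite mem_prev.
- by apply: no; exists (prev s v) => //; exact: prev_cycle cs vs.
- by apply/eqP => h; have := prev_cycle cs vs; rewrite h arc_irrefl.
Qed.

Lemma nbr_colours v c : colours_minus v c -> c @: nbr v = [set: 'I_k]%SET.
Proof.
move=> hc; apply/setP => i; rewrite [RHS]inE; apply/imsetP.
have [[x vx xi] _] := recolour i hc; exists x => //.
by rewrite inE /underlying_adj vx.
Qed.

Lemma leq_card_nbr v : k <= #|nbr v|.
Proof.
have [c hc] := minus_col v.
rewrite -[X in X <= _](card_ord k) -cardsT -(nbr_colours hc); exact: leq_imset_card.
Qed.

Definition low : {set D} := [set v | #|nbr v| == k]%SET.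

(** All [k] colours occur around an uncoloured vertex, and a low vertex has only
    [k] neighbours. *)
Lemma low_inj v c : v \in low -> colours_minus v c -> {in nbr v &, injective c}.
Proof.
rewrite inE => /eqP vk hc; apply/imset_injP.
by rewrite (nbr_colours hc) cardsT card_ord vk.
Qed.

Lemma low_digon v x : v \in low -> adj v x -> arc v x && arc x v.
Proof.
move=> vl vx; have [c hc] := minus_col v; have cinj := low_inj vl hc.
have xn : x \in nbr v by rewrite inE.
have [[y vy cy] [z zv cz]] := recolour (c x) hc.
have yn : y \in nbr v by rewrite inE /underlying_adj vy.
have zn : z \in nbr v by rewrite inE /underlying_adj zv orbT.
by rewrite -{1}(cinj _ _ yn xn cy) vy -(cinj _ _ zn xn cz) zv.
Qed.

Definition recol (c : D -> 'I_k) v i x := if x == v then i else c x.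

(** The colour of [u] becomes free at [v], as [u] is the only neighbour of [v]
    which has it. *)
Lemma shift v u c : v \in low -> adj v u -> colours_minus v c ->
  colours_minus u (recol c v (c u)).
Proof.
move=> vl vu hc i s cs sA; have cinj := low_inj vl hc.
have [vs|vs] := boolP (v \in s); last first.
  apply: (hc i s cs) => x xs; have := sA x xs; rewrite !inE /recol => /andP[_].
  by have -> : x == v = false by apply/negbTE; apply: contraNneq vs => <-.
have [_ /andP[cyc _]] := cs; have vn := next_cycle cyc vs.
have nv : next s v != v by apply/eqP => h; move: vn; rewrite h arc_irrefl.
have := sA (next s v); rewrite mem_next => /(_ vs); rewrite !inE /recol (negbTE nv).
move=> /andP[nu /eqP cn]; have := sA v vs; rewrite !inE /recol eqxx => /andP[_ /eqP cu].
move/eqP: nu; apply; apply: cinj; rewrite ?inE//; last by rewrite cn.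
by rewrite /underlying_adj vn.
Qed.

Lemma adjC x y : adj x y = adj y x.
Proof. exact: underlying_sym. Qed.

Lemma move_path v s c : colours_minus v c -> path adj v s -> uniq (v :: s) ->
  all (mem low) (belast v s) -> exists c', [/\ colours_minus (last v s) c',
    map c' (belast v s) = map c s & forall x, x \notin v :: s -> c' x = c x].
Proof.
elim: s v c => [|w s IH] v c hc /=; first by exists c.
move=> /andP[vw ws] /andP[vs us] /andP[vl al].
have [c' [h1 h2 h3]] := IH w _ (shift vl vw hc) ws us al.
have ne x : x \in s -> x != v.
  by move=> xs; apply: contraNneq vs => <-; rewrite inE xs orbT.
exists c'; split=> // [|x].
  rewrite h2 h3// /recol eqxx; congr cons; apply/eq_in_map => x xs.
  by rewrite (negbTE (ne x xs)).
rewrite inE negb_or => /andP[xv xs]; rewrite h3// /recol (negbTE xv) //.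
Qed.

Definition loop v s := [&& path adj v s, adj (last v s) v, uniq (v :: s) & all (mem low) (v :: s)].

(** When the uncoloured vertex moves once around the loop, each vertex of the
    loop takes the colour of its successor. *)
Lemma rotate v s c : loop v s -> colours_minus v c -> exists c',
  [/\ colours_minus v c', map c' s = rot 1 (map c s) & forall x, x \notin v :: s -> c' x = c x].
Proof.
case: s => [|w s]; first by rewrite /loop /= /underlying_adj arc_irrefl.
move=> /and4P[pv lv uv lowv] hc.
have al : all (mem low) (belast v (w :: s)).
  by apply/allP => x /mem_belast; exact: (allP lowv).
have [c' [h1 h2 h3]] := move_path hc pv uv al.
have ll : last v (w :: s) \in low by apply: (allP lowv); exact: mem_last.
exists (recol c' (last v (w :: s)) (c' v)); split; first exact: shift.
- have [cv cs] : c' v = c w /\ map c' (belast w s) = map c s.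
    by move: h2 => /= -[-> ->].
  have -> : map (recol c' (last v (w :: s)) (c' v)) (w :: s) =
      rcons (map c' (belast w s)) (c' v).
    rewrite [w :: s]lastI map_rcons /recol last_rcons eqxx; congr rcons.
    apply/eq_in_map => x xb /=; have [xl|//] := eqVneq x (last w s).
    by move: uv; rewrite cons_uniq [w :: s]lastI rcons_uniq -xl xb /= andbF.
  by rewrite cv cs rot1_cons.
- move=> x xs; rewrite /recol; have [xl|_] := eqVneq x (last v (w :: s)); last exact: h3.
  by move: xs; rewrite xl mem_last.
Qed.

Lemma rotate_n n v s c : loop v s -> colours_minus v c -> n <= size s -> exists c',
  [/\ colours_minus v c', map c' s = rot n (map c s) & forall x, x \notin v :: s -> c' x = c x].
Proof.
move=> vs hc; elim: n => [|n IH] ns; first by exists c; rewrite rot0.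
have [c1 [h1 h2 h3]] := IH (ltnW ns); have [c2 [k1 k2 k3]] := rotate vs h1.
exists c2; split=> // [|x xs]; last by rewrite k3// h3.
by rewrite k2 h2 -rotS// size_map.
Qed.

Lemma two_values (T : eqType) (a b x y z : T) : (x = a \/ x = b) -> (y = a \/ y = b) ->
  (z = a \/ z = b) -> y != x -> z != x -> y = z.
Proof. by move=> [->|->] [->|->] [->|->]; rewrite ?eqxx. Qed.

(** The neighbours of [v] off the loop keep their colours under rotation, and all
    colours must occur around [v]; so rotations preserve the pair of colours at
    the ends of the loop, and consecutive vertices show these two in turn. *)
Lemma alternate v s c x0 : loop v s -> colours_minus v c -> 1 < size s ->
  (forall i, i < size s -> adj v (nth x0 s i) -> i = 0 \/ i = (size s).-1) ->
  ~~ odd (size s) /\ forall i, i.+2 < size s -> c (nth x0 s i) = c (nth x0 s i.+2).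
Proof.
move=> vs hc m2 vnb; have /and4P[pv lv uv lowv] := vs.
set m := size s in m2 vnb *.
have v_low : v \in low by have /andP[] := lowv.
have first_nb : adj v (nth x0 s 0) by case: s pv @m m2 {vs vnb lv uv lowv} => //= w s /andP[].
have last_nb : adj v (nth x0 s m.-1).
  by rewrite /m nth_last adjC; case: s @m m2 lv {vs vnb pv uv lowv first_nb}.
have us : uniq s by have /andP[] := uv.
have m0 : 0 < m by exact: ltnW.
have m1 : m.-1 < m by rewrite ltn_predL.
(* after [n] rotations the ends carry the colours [A n] and [A (n + m.-1)] *)
pose A i := c (nth x0 s (i %% m)).
have key n : n <= m -> [/\ A n = A 0 \/ A n = A m.-1, A (n + m.-1) = A 0 \/ A (n + m.-1) = A m.-1 &
    A n != A (n + m.-1)].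
  move=> nm; have [c' [h1 h2 h3]] := rotate_n vs hc nm.
  have c'A i : i < m -> c' (nth x0 s i) = A (n + i).
    move=> im; rewrite -(nth_map _ (c x0))// h2 /rot nth_cat size_drop size_map -/m nth_drop /A.
    case: ltnP => h; last first.
      have mni : m <= n + i by rewrite -leq_subLR.
      have lt_n : i - (m - n) < n by rewrite ltn_subLR// subnK.
      rewrite nth_take// (nth_map x0); last exact: leq_trans lt_n nm.
      rewrite -[in RHS](subnK mni) modnDr modn_small; last first.
        by rewrite ltn_subLR// -addnS leq_add.
      by rewrite subnBA// addnC.
    have nim : n + i < m by rewrite -ltn_subRL.
    by rewrite (nth_map x0)// modn_small.
  have cinj := low_inj v_low h1.
  have pos i : i < m -> adj v (nth x0 s i) -> A (n + i) = A 0 \/ A (n + i) = A m.-1.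
    move=> im iv; have : A (n + i) \in c @: nbr v by rewrite (nbr_colours hc) inE.
    move=> /imsetP[y]; rewrite inE => vy yE.
    have [ys|ys] := boolP (y \in s).
      have yi : index y s < m by rewrite index_mem.
      have := vnb _ yi; rewrite nth_index// => /(_ vy) [] e.
        by left; rewrite yE /A mod0n -e nth_index.
      by right; rewrite yE /A modn_small -?e ?nth_index.
    have yv : y != v by apply: contraTneq vy => ->; rewrite /underlying_adj arc_irrefl.
    have c'y : c' y = c y by apply: h3; rewrite inE negb_or yv.
    have : y = nth x0 s i by apply: cinj; rewrite ?inE// c'y c'A.
    by move=> e; rewrite e mem_nth in ys.
  split.
  - by have := pos 0 m0 first_nb; rewrite addn0.
  - exact: pos.
  - rewrite -[n in A n]addn0 -!c'A//.
    apply/eqP => /cinj; rewrite !inE => /(_ first_nb last_nb)/eqP.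
    by rewrite (nth_uniq x0 m0 m1 us) => /eqP e; have := ltn_predK m2; rewrite -e => h; move: m2; rewrite -h.
have step i : i.+2 <= m -> A i = A i.+2.
  move=> im.
  have [h1 h2 h3] := key i.+1 (ltnW im); have [k1 k2 k3] := key i.+2 im.
  have e1 j : A (j.+1 + m.-1) = A j by rewrite /A addSnnS prednK// modnDr.
  by rewrite e1 in h2 h3; rewrite e1 in k2 k3; apply: (two_values h1 h2 k1); rewrite // eq_sym.
have Asmall i : i < m -> A i = c (nth x0 s i) by move=> im; rewrite /A modn_small.
split=> [|i im]; last first.
  by rewrite -(Asmall _ im) -step ?Asmall// ltnW// ltnW.
apply/negP => mo; have [_ _ /negP] := key 0 (leq0n _); apply; rewrite add0n.
have two j : j.*2 <= m -> A 0 = A j.*2.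
  elim: j => [//|j IH] jm; rewrite doubleS in jm *.
  by rewrite -step// IH// ltnW// ltnW.
have mm : m.-1 = m./2.*2 by rewrite -[in LHS](odd_double_half m) mo.
by rewrite mm -two// -mm leq_pred.
Qed.

End Token.

(** * Loops of low vertices *)

(** A maximal run [B] of elements outside [P] is bounded by two elements of [P],
    and a third one lies on one of the two sides, so the hypothesis applies to
    the first such run. *)
Lemma all_of_runs (T : eqType) (P : pred T) (x0 : T) (s : seq T) :
  P (head x0 s) -> P (last x0 s) -> 2 < count P s ->
  (forall A x B y C, s = A ++ x :: B ++ y :: C -> P x -> P y -> ~~ has P B ->
     has P A || has P C -> B = [::]) -> all P s.
Proof.
move=> Ph Pl cP H; apply/negPn/negP; rewrite -has_predC => hn.
pose i := find (predC P) s.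
have iS : i < size s by rewrite -has_find.
have Pi : ~~ P (nth x0 s i) by exact: (nth_find x0 hn).
have i0 : 0 < i.
  rewrite lt0n; apply/eqP => i0; move: Pi; rewrite i0 nth0.
  by rewrite Ph.
have Pbef j : j < i -> P (nth x0 s j).
  by move=> ji; have := before_find x0 ji; rewrite /= => /negbFE.
pose d := drop i s.
have hd : has P d.
  have ds : d != [::] by rewrite -size_eq0 size_drop subn_eq0 -ltnNge.
  apply/hasP; exists (last x0 s) => //.
  have -> : last x0 s = last x0 d.
    by rewrite -{1}(cat_take_drop i s) last_cat -/d; case: (d) ds.
  by case: (d) ds => //= a l _; exact: (mem_last a l).
pose j := find P d.
have jd : j < size d by rewrite -has_find.
have Pj : P (nth x0 d j) by exact: nth_find.
have sE : s = take i.-1 s ++ nth x0 s i.-1 :: take j d ++ nth x0 d j :: drop j.+1 d.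
  rewrite -drop_nth// cat_take_drop /d -[in drop i s](prednK i0) -drop_nth ?cat_take_drop//.
  by rewrite (leq_ltn_trans (leq_pred _)).
have Bn : ~~ has P (take j d).
  apply/hasPn => x /(nthP x0)[l]; rewrite size_take jd => lj.
  by rewrite nth_take// => <-; rewrite (before_find x0 lj).
have Px : P (nth x0 s i.-1) by apply: Pbef; rewrite ltn_predL.
have hAC : has P (take i.-1 s) || has P (drop j.+1 d).
  move: cP; rewrite {1}sE count_cat /= count_cat /= Px Pj.
  have -> : count P (take j d) = 0 by apply/eqP; rewrite eqn0Ngt -has_count.
  rewrite !has_count; case: (count P (take _ _)) => [|//].
  by case: (count P (drop _ _)).
have B0 := H _ _ _ _ _ sE Px Pj Bn hAC.
have j0 : j = 0.
  by have := congr1 size B0; rewrite size_take jd.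
by move: Pj; rewrite j0 /d nth_drop addn0 (negbTE Pi).
Qed.

Section Gallai.
Variables (D : digraph) (k : nat).
Hypothesis not_col : ~ dicolourable D k.
Hypothesis minus_col : forall v, exists c : D -> 'I_k, colours_minus v c.

Local Notation adj := (@underlying_adj D).
Local Notation low := (low D k).
Local Notation loop := (@loop D k).

Lemma loop_infix v A s B x : loop v (A ++ s ++ B) -> s != [::] -> adj v (head x s) ->
  adj v (last x s) -> loop v s.
Proof.
move=> /and4P[p _ u l] s0 vh vl; case: s s0 vh vl p u l => // a s _ va vl p u l; rewrite /= in va vl.
move: p; rewrite cat_path /= cat_path => /and3P[_ _ /andP[p _]].
apply/and4P; split; first by rewrite /= va p.
- by rewrite (adjC _ v).
- move: u; rewrite cons_uniq => /andP[vn].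
  have vas : v \notin a :: s by apply: contra vn => h; rewrite !mem_cat h orbT.
  by rewrite cat_uniq => /and3P[_ _]; rewrite cat_uniq => /and3P[us _ _]; rewrite cons_uniq vas us.
- by move: l; rewrite /= all_cat /= all_cat => /and5P[-> _ -> -> _].
Qed.

Lemma alternate_parity v s (c : D -> 'I_k) x0 : loop v s -> colours_minus v c -> 1 < size s ->
  (forall i, i < size s -> adj v (nth x0 s i) -> i = 0 \/ i = (size s).-1) ->
  forall i j, odd i = odd j -> i < size s -> j < size s -> c (nth x0 s i) = c (nth x0 s j).
Proof.
move=> vs hc s2 vnb; have [_ st] := alternate not_col vs hc s2 vnb.
have up n i : i + n.*2 < size s -> c (nth x0 s i) = c (nth x0 s (i + n.*2)).
  elim: n => [|n IH]; first by rewrite addn0.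
  by rewrite doubleS !addnS => h; rewrite -st// IH// ltnW// ltnW.
move=> i j; wlog ij : i j / i <= j.
  by move=> W oij hi hj; have [ij|/ltnW ji] := leqP i j; [exact: W|apply/esym/W].
move=> oij _ hj; have eo : ~~ odd (j - i) by rewrite oddB// oij addbb.
have e : j = i + ((j - i)./2).*2 by rewrite even_halfK// subnKC.
by rewrite e; apply: up; rewrite -e.
Qed.

(** The form in which [alternate] asks for the neighbours of [v] on a loop. *)
Lemma no_inner v x s y : (forall t, t \in s -> ~~ adj v t) ->
  forall i, i < size (x :: rcons s y) -> adj v (nth x (x :: rcons s y) i) ->
  i = 0 \/ i = (size (x :: rcons s y)).-1.
Proof.
move=> sn [|i]; first by left.
rewrite /= size_rcons ltnS => is_; rewrite nth_rcons; case: ltngtP => [h vi|h|->]; last by right.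
  by have := sn _ (mem_nth x h); rewrite vi.
by rewrite ltnNge -ltnS is_ in h.
Qed.

(** Three consecutive neighbours [x], [y], [z] of [v] on a loop: the colours
    alternate from [x] to [y] and from [y] to [z]. After a rotation by one they
    must still alternate before [y], so [x] and [z] have the same colour unless
    [x] and [y] are adjacent on the loop. *)
Lemma first_gap v x s1 y s2 z : loop v ((x :: rcons s1 y) ++ rcons s2 z) ->
  adj v y -> (forall t, t \in s1 -> ~~ adj v t) -> (forall t, t \in s2 -> ~~ adj v t) ->
  s1 = [::].
Proof.
set s := _ ++ _ => vs vy n1 n2.
have [c hc] := minus_col v; have /and4P[pv lv uv lowv] := vs.
have v_low : v \in low by have /andP[] := lowv.
have vx : adj v x by have /andP[] := pv.
have vz : adj v z by move: lv; rewrite /s last_cat last_rcons adjC.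
have L1 : loop v (x :: rcons s1 y).
  by apply: (@loop_infix v [::] _ (rcons s2 z) x); rewrite //= last_rcons.
have L2 : loop v (y :: rcons s2 z).
  apply: (@loop_infix v (x :: s1) _ [::] x); rewrite //= ?last_rcons//.
  by rewrite cats0 -cat_rcons.
apply/eqP; rewrite -size_eq0; apply/negPn/negP => s10.
have sz1 : size (x :: rcons s1 y) = (size s1).+2 by rewrite /= size_rcons.
have sz2 : size (y :: rcons s2 z) = (size s2).+2 by rewrite /= size_rcons.
have g1 : 1 < size (x :: rcons s1 y) by rewrite sz1.
have g2 : 1 < size (y :: rcons s2 z) by rewrite sz2.
have [e1 _] := alternate not_col L1 hc g1 (no_inner n1).
have [e2 _] := alternate not_col L2 hc g2 (no_inner n2).
rewrite sz1 /= negbK in e1; rewrite sz2 /= negbK in e2.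
have [c' [h1 h2 h3]] := rotate not_col vs hc.
have szs : size s = (size s1).+2 + (size s2).+1 by rewrite /s size_cat sz1 size_rcons.
have c'E i : i.+1 < size s -> c' (nth x s i) = c (nth x s i.+1).
  move=> is_; rewrite -(nth_map _ (c x)) ?(ltnW is_)// h2.
  move: is_; rewrite /s /= => is_.
  rewrite rot1_cons nth_rcons size_map -ltnS (nth_map x) //.
  by rewrite is_.
have s1s i : i < (size s1).+2 -> nth x s i = nth x (x :: rcons s1 y) i.
  by move=> h; rewrite /s nth_cat sz1 h.
have s2s i : nth x s ((size s1).+1 + i) = nth x (y :: rcons s2 z) i.
  have -> : s = (x :: s1) ++ y :: rcons s2 z by rewrite /s /= cat_rcons.
  by rewrite nth_cat /= ltnNge leq_addr /= addKn.
have a1 : c' (nth x s (size s1).-1) = c' (nth x s (size s1).+1).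
  rewrite !s1s ?leqnn//; last by rewrite ltnS (leq_trans (leq_pred _)).
  apply: (alternate_parity L1 h1 g1 (no_inner n1)); rewrite ?sz1//.
    by rewrite -[in RHS](prednK (n := size s1)) ?lt0n//= negbK.
  by rewrite ltnS (leq_trans (leq_pred _)).
have i1 : (size s1).-1.+1 < size s.
  by rewrite szs prednK ?lt0n//; exact: leq_trans (leqnSn _) (leq_addr _ _).
have i2 : (size s1).+2 < size s by rewrite szs -[X in X < _]addn0 ltn_add2l.
rewrite !c'E// prednK ?lt0n// in a1.
have a2 : c (nth x s (size s1)) = c x.
  rewrite s1s ?leqnSn//; apply: (alternate_parity L1 hc g1 (no_inner n1) (j := 0)); rewrite ?sz1//=.
  by rewrite (negbTE e1).
have a3 : c (nth x s (size s1).+2) = c z.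
  rewrite -[(size s1).+2]addn1 s2s.
  have zE : z = nth x (y :: rcons s2 z) (size s2).+1 by rewrite /= nth_rcons ltnn eqxx.
  rewrite [in RHS]zE.
  have sd a : a < size (y :: rcons s2 z) -> nth x (y :: rcons s2 z) a = nth y (y :: rcons s2 z) a.
    exact: set_nth_default.
  rewrite !sd ?sz2//; apply: (alternate_parity L2 hc g2 (no_inner n2)); rewrite ?sz2//=.
have xz : x = z.
  by apply: (low_inj not_col v_low hc); rewrite ?inE//; rewrite -a2 a1 a3.
have : uniq s by have /andP[] := uv.
by rewrite /s /= mem_cat mem_rcons inE xz mem_rcons inE eqxx orbT.
Qed.

Lemma loop_rev v s : loop v s -> loop v (rev s).
Proof.
case: s => // a s /and4P[p l u lw]; apply/and4P; split.
- have h := rev_path adj v (rcons (a :: s) v).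
  have e : path (fun x y => adj y x) v (rcons (a :: s) v).
    by rewrite (eq_path (e' := adj)) => [|x y]; [rewrite rcons_path p|exact: adjC].
  move: h; rewrite e last_rcons belast_rcons rev_cons rcons_path.
  by case/andP.
- by rewrite rev_cons last_rcons adjC; have /andP[] := p.
- by move: u; rewrite !cons_uniq mem_rev rev_uniq.
- by move: lw; rewrite /= all_rev.
Qed.

(** The other three vertices form a loop at [a] of odd length, on which [a] would
    have only its two neighbours, against [alternate]. *)
Lemma four_cycle u a b w : adj u a -> adj a b -> adj b w -> adj w u -> uniq [:: u; a; b; w] ->
  all (mem low) [:: u; a; b; w] -> adj a w.
Proof.
move=> ua ab bw wu un lo; apply/negPn/negP => naw.
have [c hc] := minus_col a.
have L : loop a [:: b; w; u].
  apply/and4P; split=> //=; first by rewrite ab bw wu.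
    move: un; rewrite /= !inE !negb_or !andbT => /and3P[/and3P[h1 h2 h3] /andP[h4 h5] h6].
    by rewrite h4 h5 h6 (eq_sym a) h1 (eq_sym b) h2 (eq_sym w) h3.
  by move: lo => /= /and5P[-> -> -> -> _].
have [] := alternate not_col L hc (x0 := a) _ _ => // -[|[|[|]]] //= _; [by left| |by right].
by rewrite (negbTE naw).
Qed.

(** A run of non-neighbours is bounded by two neighbours of [v], and a third
    neighbour beyond one of them gives, after reversal if it comes first, the
    situation of [first_gap]. *)
Lemma loop_all v s (x0 : D) : loop v s -> 2 < count (adj v) s -> all (adj v) s.
Proof.
move=> vs cs; have /and4P[pv lv _ _] := vs.
have s0 : s != [::] by case: (s) cs.
apply: (@all_of_runs _ _ x0) => //.
- by case: (s) s0 pv => //= a l _ /andP[].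
- by case: (s) s0 lv => //= a l _; rewrite adjC.
move=> A x B y C sE vx vy Bn /orP[hA|hC].
- (* the last neighbour in [A]; reverse the loop *)
  have hrA : has (adj v) (rev A) by rewrite has_rev.
  move E : (rev A) hrA => rA hrA; case/split_find: hrA E => z A1 A2 vz nz rAE.
  have AE : A = rev A2 ++ z :: rev A1.
    by rewrite -(revK A) rAE rev_cat rev_rcons.
  have L : loop v ((z :: rcons (rev A1) x) ++ rcons B y).
    apply: (@loop_infix v (rev A2) _ C x0) => //=; last by rewrite last_cat last_rcons.
    by move: vs; rewrite sE AE -!cat_rcons -!catA /= -!cats1 -!catA.
  have := loop_rev L; rewrite rev_cat rev_rcons rev_cons rev_rcons revK => L'.
  have : rev B = [::].
    apply: (@first_gap v y (rev B) x A1 z) => //.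
    + by move: L'; rewrite /= -cats1 -[rcons (rev B) x]cats1 -!catA.
    + by move=> t; rewrite mem_rev => tB; exact: (hasPn Bn).
    + by move=> t tA; exact: (hasPn nz).
  by move=> /(congr1 rev); rewrite revK.
case/split_find: hC sE => z C1 C2 vz nz sE.
apply: (@first_gap v x B y C1 z) => //.
- apply: (@loop_infix v A _ C2 x0) => //=; last by rewrite last_cat last_rcons.
  by move: vs; rewrite sE -!cat_rcons -!catA /= -!cats1 -!catA.
- by move=> t tB; exact: (hasPn Bn).
- by move=> t tC; exact: (hasPn nz).
Qed.

End Gallai.

(** * Sparsity of low vertices *)

Section Density.
Variables (D : digraph) (k : nat).
Hypothesis not_col : ~ dicolourable D k.
Hypothesis minus_col : forall v, exists c : D -> 'I_k, colours_minus v c.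

Local Notation adj := (@underlying_adj D).
Local Notation low := (low D k).
Implicit Types A B K T : {set D}.

Definition path_in A v s := [&& path adj v s, uniq (v :: s) & all (mem A) (v :: s)].

Lemma longest_path A : A != finset.set0 -> exists v s, path_in A v s /\
  forall v' s', path_in A v' s' -> size s' <= size s.
Proof.
move=> /set0Pn[a aA].
pose P n := `[< exists v s, path_in A v s /\ size s = n >].
have P0 : exists n, P n.
  by exists 0; apply/asboolP; exists a, [::]; split=> //; rewrite /path_in /= aA.
have Pb n : P n -> n <= #|D|.
  move=> /asboolP[v [s [/and3P[_ u _] <-]]].
  by rewrite (leq_trans (leqnSn _))// -[_.+1]/(size (v :: s)) -(card_uniqP u) max_card.
case: (ex_maxnP P0 Pb) => n /asboolP[v [s [vs sn]]] nmax.
exists v, s; split=> // v' s' vs'; rewrite sn; apply: nmax.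
by apply/asboolP; exists v', s'.
Qed.

Definition clique (L : seq D) := forall x y, x \in L -> y \in L -> x != y -> adj x y.

(** By induction along the path: if [a] is adjacent to the vertex [b] and [w]
    follows [b], then [four_cycle] applies to [u], [a], [b], [w]. *)
Lemma hub_clique u s : all (adj u) s -> path adj u s -> uniq (u :: s) ->
  all (mem low) (u :: s) -> clique (u :: s).
Proof.
move=> us ps un lo.
have main i j : i < j -> j < size s -> adj (nth u s i) (nth u s j).
  elim: j => // j IH; rewrite ltnS leq_eqVlt => ij js.
  have cons : adj (nth u s j) (nth u s j.+1).
    by have /(pathP u) := ps => /(_ j.+1 js).
  move: ij => /orP[/eqP->//|ij]; have js' := ltnW js.
  have is_ := ltn_trans ij js'.
  have nm l : l < size s -> nth u s l \in s by exact: mem_nth.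
  have nu l : l < size s -> adj u (nth u s l) by move=> /nm; exact: (allP us).
  have neu l : l < size s -> u != nth u s l.
    by move=> /nm ls; apply: contraTneq ls => <-; case/andP: un.
  have us' : uniq s by case/andP: un.
  apply: (@four_cycle D k not_col minus_col u _ (nth u s j)).
  - exact: nu.
  - exact: IH.
  - exact: cons.
  - by rewrite adjC nu.
  - rewrite /= !inE !negb_or !neu//= !nth_uniq// (ltn_eqF ij) (ltn_eqF (ltnW ij : i < j.+1)).
    by rewrite (ltn_eqF (ltnSn j)).
  - have lo' x : x \in u :: s -> x \in low by exact: (allP lo).
    by rewrite /= !lo' ?mem_head// inE nm ?orbT.
move=> x y; wlog xy : x y / index x s <= index y s.
  move=> W xs ys xy; have [h|/ltnW h] := leqP (index x s) (index y s); first exact: W.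
  by rewrite adjC; apply: W; rewrite // eq_sym.
rewrite !inE => /orP[/eqP->|xs] /orP[/eqP->|ys] neq.
- by rewrite eqxx in neq.
- exact: (allP us).
- by rewrite adjC; exact: (allP us).
have := main (index x s) (index y s); rewrite index_mem ys !nth_index// => -> //.
rewrite ltn_neqAle xy andbT; apply: contraNneq neq => e.
by rewrite -(nth_index u xs) e nth_index.
Qed.

Lemma clique_path w L : clique (w :: L) -> uniq (w :: L) -> path adj w L.
Proof.
elim: L w => // a L IH w cl /= /andP[wL /andP[aL uL]].
apply/andP; split.
  by apply: cl; rewrite ?inE ?eqxx ?orbT//; apply: contraNneq wL => ->; rewrite mem_head.
apply: IH; last by rewrite /= aL.
by move=> x y xL yL; apply: cl; rewrite inE ?xL ?yL orbT.
Qed.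

(** The end [v] of a longest path has all its neighbours on the path; by
    [loop_all] they form an initial segment, and with [v] a clique. *)
Lemma longest_end A v s : A \subset low -> path_in A v s ->
  (forall v' s', path_in A v' s' -> size s' <= size s) -> 2 < #|nbr v :&: A| ->
  exists S1 z S2, [/\ s = rcons S1 z ++ S2, clique (v :: rcons S1 z) &
    nbr v :&: A = [set x in rcons S1 z]%SET].
Proof.
move=> Alow /and3P[pv uv Av] smax d3.
have nbs x : x \in nbr v :&: A -> x \in s.
  rewrite !inE => /andP[vx xA]; apply: contrapT => /negP xs.
  have xv : x != v by apply: contraTneq vx => ->; rewrite /underlying_adj arc_irrefl.
  suff /smax : path_in A x (v :: s) by rewrite /= ltnn.
  rewrite /path_in /= adjC vx pv /= inE negb_or xv xs xA /=.
  by rewrite -[_ && uniq s]/(uniq (v :: s)) uv -[(v \in A) && _]/(all (mem A) (v :: s)).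
have hs : has (adj v) (rev s).
  have /card_gt0P[x xN] : 0 < #|nbr v :&: A| by exact: leq_trans d3.
  apply/hasP; exists x; first by rewrite mem_rev nbs.
  by move: xN; rewrite !inE => /andP[].
move E : (rev s) hs => rs hs; case/split_find: hs E => z A1 A2 vz nz rE.
have sE : s = rcons (rev A2) z ++ rev A1.
  by rewrite -(revK s) rE rev_cat rev_rcons cat_rcons.
have nS2 x : x \in rev A1 -> ~~ adj v x by rewrite mem_rev => xA; exact: (hasPn nz).
have lw : all (mem low) (v :: s).
  by apply/allP => x /(allP Av); exact: (fintype.subsetP Alow).
have L : loop k v (rcons (rev A2) z).
  apply/and4P; split.
  - by move: pv; rewrite sE cat_path => /andP[].
  - by rewrite last_rcons adjC.
  - by move: uv; rewrite sE -cat_cons cat_uniq => /andP[].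
  - by move: lw; rewrite sE -cat_cons all_cat => /andP[].
have sub x : x \in nbr v :&: A -> x \in rcons (rev A2) z.
  move=> xN; have := nbs x xN; rewrite sE mem_cat => /orP[//|/nS2].
  by move: xN; rewrite !inE => /andP[->].
have cnt : 2 < count (adj v) (rcons (rev A2) z).
  apply: leq_trans d3 _; rewrite -size_filter.
  apply: leq_trans (card_size _); apply/subset_leq_card/fintype.subsetP => x xN.
  rewrite mem_filter sub// andbT; by move: xN; rewrite !inE => /andP[].
have al := loop_all not_col minus_col v L cnt.
have /and4P[pL _ uL lL] := L.
exists (rev A2), z, (rev A1); split=> //; first exact: hub_clique.
apply/setP => x; apply/idP/idP => [/sub xs|]; first by rewrite inE.
rewrite inE => xs; rewrite inE; apply/andP; split; first by rewrite inE; exact: (allP al).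
by apply: (allP Av); rewrite inE sE mem_cat xs orbT.
Qed.

(** At the end [v] of a longest path, [longest_end] gives a clique that ends in
    [z]. Permuting it gives longest paths that end at any vertex of the clique
    but [z], whose neighbours then also lie in the clique. *)
Lemma terminal_block A : A \subset low -> A != finset.set0 ->
  (exists2 v, v \in A & #|nbr v :&: A| <= 2) \/
  exists K z, [/\ K \subset A, z \in K, 3 < #|K|, clique (enum K) &
    forall w, w \in K -> w != z -> nbr w :&: A = K :\ w].
Proof.
move=> Alow A0; have [v [s [vs smax]]] := longest_path A0.
have [d2|d3] := leqP #|nbr v :&: A| 2.
  by left; exists v => //; have /and3P[_ _ /andP[]] := vs.
right; have [S1 [z [S2 [sE cl NE]]]] := longest_end Alow vs smax d3.
have /and3P[pv uv Av] := vs.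
pose K : {set D} := [set x in v :: rcons S1 z]%SET.
have KE x : (x \in K) = (x \in v :: rcons S1 z) by rewrite inE.
have uK : uniq (v :: rcons S1 z) by move: uv; rewrite sE -cat_cons cat_uniq => /andP[].
have KA : K \subset A.
  apply/fintype.subsetP => x; rewrite KE => xK; apply: (allP Av).
  by rewrite sE -cat_cons mem_cat xK.
have cardK : #|K| = #|nbr v :&: A|.+1.
  rewrite cardsE (card_uniqP uK) NE cardsE /=.
  by move: uK => /= /andP[_ /card_uniqP->].
have clK : clique (enum K) by move=> x y; rewrite !mem_enum !KE; exact: cl.
have zK : z \in K by rewrite KE inE mem_rcons mem_head orbT.
exists K, z; split=> //; first by rewrite cardK.
move=> w wK wz.
have KN : K :\ w \subset nbr w :&: A.
  apply/fintype.subsetP => x; rewrite 2!inE => /andP[xw xK].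
  rewrite inE (fintype.subsetP KA _ xK) andbT inE.
  by apply: cl; rewrite -?KE// eq_sym.
apply/eqP; rewrite finset.eqEsubset KN andbT; apply/fintype.subsetP => y yN.
have yw : y != w.
  by apply: contraTneq yN => ->; rewrite !inE /underlying_adj arc_irrefl.
rewrite 2!inE yw /=; apply: contrapT => /negP yK.
have wv : w != v.
  apply: contraNneq yK => wv; move: yN; rewrite wv NE inE => ys.
  by rewrite KE inE ys orbT.
pose r := rem w (v :: S1).
have wS : w \in v :: S1.
  by move: wK; rewrite KE !inE mem_rcons inE (negbTE wz).
have perm : perm_eq (v :: S1) (w :: r) by exact: perm_to_rem.
have subK x : x \in w :: r -> x \in v :: rcons S1 z.
  by rewrite -(perm_mem perm) !inE mem_rcons inE => /orP[->//|->]; rewrite !orbT.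
pose s' := rcons r z ++ S2.
have perm' : perm_eq (v :: s) (w :: s').
  by rewrite sE /s' -!cat_cons perm_cat2r -!rcons_cons -!cats1 perm_cat2r.
have ps' : path_in A w s'.
  have u' : uniq (w :: s') by rewrite -(perm_uniq perm').
  rewrite /path_in u' -(perm_all _ perm') Av !andbT.
  rewrite cat_path; apply/andP; split.
    apply: clique_path; last by move: u'; rewrite /s' -cat_cons cat_uniq => /andP[].
    have sub a : a \in w :: rcons r z -> a \in v :: rcons S1 z.
      move=> h; have : a \in rcons (w :: r) z by exact: h.
      rewrite {h} mem_rcons in_cons => /orP[/eqP->|ar]; last exact: subK.
      by rewrite inE mem_rcons mem_head orbT.
    by move=> a c ha hc; apply: cl; exact: sub.
  rewrite last_rcons; move: pv; rewrite sE cat_path last_rcons.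
  by case/andP.
have smax' v' t : path_in A v' t -> size t <= size s'.
  by move=> /smax; have := perm_size perm' => -[->].
have d3' : 2 < #|nbr w :&: A|.
  apply: leq_trans (subset_leq_card KN); have := cardsD1 w K.
  by rewrite wK add1n cardK => -[<-].
have [T1 [t [T2 [s'E cl' NE']]]] := longest_end Alow ps' smax' d3'.
have yT : y \in rcons T1 t by move: yN; rewrite NE' inE.
have uS : uniq (v :: S1) by move: uK; rewrite -rcons_cons rcons_uniq => /andP[].
have vr : v \in r by rewrite mem_rem_uniq// !inE eqxx eq_sym wv.
have vT : v \in rcons T1 t.
  have [le|/ltnW le] := leqP (size (rcons T1 t)) (size (rcons r z)).
    have eT : rcons T1 t = take (size (rcons T1 t)) (rcons r z).
      by rewrite -(takel_cat S2 le) -/s' s'E take_size_cat.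
    exfalso; move/negP: yK; apply; rewrite KE; move: yT; rewrite eT => /mem_take.
    rewrite mem_rcons inE => /orP[/eqP->|yr]; first by rewrite inE mem_rcons mem_head orbT.
    by apply: subK; rewrite inE yr orbT.
  have er : rcons r z = take (size (rcons r z)) (rcons T1 t).
    by rewrite -(takel_cat T2 le) -s'E /s' take_size_cat.
  by apply: (@mem_take (size (rcons r z))); rewrite -er mem_rcons inE vr orbT.
have yv : v != y.
  by apply: contraNneq yK => <-; rewrite KE mem_head.
have vy : adj v y by apply: cl' => //; rewrite inE ?vT ?yT orbT.
have : y \in nbr v :&: A by move: yN; rewrite !inE vy => /andP[].
by rewrite NE inE => ys; move: yK; rewrite KE inE ys orbT.
Qed.

(** Ordered pairs are counted, so each edge inside [A] counts twice in
    [adjacencies A A]. *)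
Definition adjacencies A T := \sum_(u in A) #|nbr u :&: T|.

Lemma adjacencies1 u A : #|nbr u :&: A| = \sum_(v in A) (adj u v : nat).
Proof.
rewrite -sum1_card big_mkcond [RHS]big_mkcond /=; apply: eq_bigr => v _.
by rewrite !inE; case: (v \in A); rewrite ?andbT ?andbF//; case: adj.
Qed.

Lemma adjacenciesC A T : adjacencies A T = adjacencies T A.
Proof.
rewrite /adjacencies (eq_bigr _ (fun u _ => adjacencies1 u T)) exchange_big /=.
by apply: eq_bigr => v _; rewrite adjacencies1; apply: eq_bigr => u _; rewrite adjC.
Qed.

Lemma adjacencies_split A T B : T \subset A -> adjacencies A B = adjacencies T B + adjacencies (A :\: T) B.
Proof.
move=> TA; rewrite /adjacencies (big_setID T) /=.
by have -> : A :&: T = T by apply/finset.setIidPr.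
Qed.

Lemma adjacencies_remove A T : T \subset A ->
  adjacencies A A + adjacencies T T = adjacencies (A :\: T) (A :\: T) + (adjacencies T A).*2.
Proof.
move=> TA; have := adjacencies_split A TA; have := adjacencies_split T TA.
have := adjacencies_split (A :\: T) TA.
rewrite (adjacenciesC (A :\: T) A) (adjacenciesC (A :\: T) T) (adjacenciesC A T); lia.
Qed.

End Density.

(** Terminal blocks have at most six vertices; they are removed one after the
    other, at the cost of at most [8/3] edges per vertex. A block of at most five
    vertices is removed without the vertex [z] that it shares with the rest. From
    a block of six this would take 15 edges with five vertices, which is too
    many; but then [z] has at most one further neighbour, and removing the whole
    block takes at most 16 edges with six vertices. *)
Lemma low_density (D : digraph) (A : {set D}) : ~ dicolourable D 6 ->
  (forall v, exists c : D -> 'I_6, colours_minus v c) ->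
  (forall K : {set D}, K \subset low D 6 -> clique (enum K) -> #|K| <= 6) ->
  A \subset low D 6 -> 3 * adjacencies A A <= 16 * #|A|.
Proof.
move=> ncol mcol noK; move: {2}#|A| (leqnn #|A|) => n.
elim: n A => [|n IH] A An Alow.
  have A0 : A = finset.set0 by apply/eqP; rewrite -cards_eq0 -leqn0.
  by rewrite A0 /adjacencies big_set0 muln0.
have [->|A0] := eqVneq A finset.set0; first by rewrite /adjacencies big_set0 muln0.
have deg v : v \in A -> #|nbr v :&: A| <= 6.
  move=> vA; have := fintype.subsetP Alow v vA; rewrite inE => /eqP <-.
  exact: subset_leq_card (finset.subsetIl _ _).
have step (T : {set D}) : T \subset A -> T != finset.set0 ->
    3 * (adjacencies T A).*2 <= 3 * adjacencies T T + 16 * #|T| -> 3 * adjacencies A A <= 16 * #|A|.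
  move=> TA T0 hT; have := adjacencies_remove TA.
  have cA : #|A| = #|T| + #|A :\: T|.
    by rewrite -(cardsID T A); have -> : A :&: T = T by apply/finset.setIidPr.
  have T1 : 0 < #|T| by rewrite card_gt0.
  have := IH (A :\: T); have sub : A :\: T \subset low D 6.
    exact: fintype.subset_trans (finset.subsetDl _ _) Alow.
  move=> /(_ _ sub) h e; have {}h : 3 * adjacencies (A :\: T) (A :\: T) <= 16 * #|A :\: T|.
    by apply: h; lia.
  clear -hT h e cA; lia.
have [[v vA d2]|[K [z [KA zK K4 clK KN]]]] := terminal_block ncol mcol Alow A0.
  apply: (step [set v]%SET).
  - by rewrite finset.sub1set.
  - by rewrite -card_gt0 cards1.
  rewrite /adjacencies !big_set1 cards1.
  have -> : nbr v :&: [set v]%SET = finset.set0.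
    apply/setP => x; rewrite !inE; apply/negP => /andP[+ /eqP xv].
    by rewrite xv /underlying_adj arc_irrefl.
  by rewrite cards0; lia.
have K6 : #|K| <= 6 by apply: noK => //; exact: fintype.subset_trans KA Alow.
have cKw w : w \in K -> #|K :\ w| = #|K|.-1 by move=> wK; rewrite (cardsD1 w K) wK.
have adjK u v : u \in K -> v \in K -> u != v -> underlying_adj u v.
  by move=> uK vK; apply: clK; rewrite mem_enum.
have inner (T : {set D}) u : u \in T -> T \subset K -> #|nbr u :&: T| = #|T|.-1.
  move=> uT TK; have -> : nbr u :&: T = T :\ u.
    apply/setP => x; rewrite !inE; have [->|xu] := eqVneq x u.
      by rewrite /underlying_adj arc_irrefl.
    have [xT|xT] := boolP (x \in T); last by rewrite andbF.
    by rewrite adjK// ?(fintype.subsetP TK)// eq_sym.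
  by rewrite (cardsD1 u T) uT.
have pTT (T : {set D}) : T \subset K -> adjacencies T T = #|T| * #|T|.-1.
  move=> TK; rewrite /adjacencies (eq_bigr (fun=> #|T|.-1)) ?sum_nat_const// => u uT.
  exact: inner.
have pKz : adjacencies (K :\ z) A = #|K|.-1 * #|K|.-1.
  rewrite /adjacencies (eq_bigr (fun=> #|K|.-1)) ?sum_nat_const ?cKw// => u.
  by rewrite !inE => /andP[uz uK]; rewrite KN// cKw.
have [K5|K5] := leqP #|K| 5.
  apply: (step (K :\ z)); first exact: fintype.subset_trans (subD1set _ _) KA.
    by rewrite -card_gt0 cKw//; lia.
  rewrite pKz pTT ?subD1set// cKw//.
  by move: #|K| K4 K5 => [|[|[|[|[|[|m]]]]]].
have KK : #|K| = 6 by apply/eqP; rewrite eqn_leq K6.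
apply: (step K) => //; first by rewrite -card_gt0 KK.
have -> : adjacencies K A = #|nbr z :&: A| + adjacencies (K :\ z) A.
  by rewrite /adjacencies (big_setD1 z).
rewrite pKz pTT// KK; have := deg z (fintype.subsetP KA z zK).
by move: #|nbr z :&: A|; lia.
Qed.

(** * The order of critical digraphs *)

Section Critical.
Variables (D : digraph) (k : nat).
Hypothesis crit : dicritical k.+1 D.

Lemma dichromatic_dicolourable (H : digraph) : dicolourable H (dichromatic_number H).
Proof. by rewrite /dichromatic_number; case: ex_minnP => n /asboolP. Qed.

Lemma critical_not_dicolourable : ~ dicolourable D k.
Proof.
move=> h; have [chi _] := crit; move: chi; rewrite /dichromatic_number.
case: ex_minnP => n _ /(_ k (asboolT h)) + nk.
by rewrite nk ltnn.
Qed.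

(** Extend a dicolouring of the proper subdigraph induced by the other vertices. *)
Lemma critical_minus v : 0 < k -> exists c : D -> 'I_k, colours_minus v c.
Proof.
move=> k0; have [_ sub] := crit.
pose V : {set D} := [set x | x != v]%SET.
pose E : {set D * D} := [set a | [&& arc a.1 a.2, a.1 != v & a.2 != v]]%SET.
have EP x y : (x, y) \in E -> [/\ arc x y, x \in V & y \in V].
  by rewrite !inE /= => /and3P.
pose H := Subdigraph EP.
have pH : proper_subdigraph H.
  move=> [VT _]; have : v \in V by rewrite [V]VT inE.
  by rewrite inE eqxx.
have hk : dichromatic_number H <= k by rewrite -ltnS; exact: sub.
have [c hc] := dicolourable_widen hk (dichromatic_dicolourable H).
pose o : 'I_k := Ordinal k0.
pose c' x := if insub x is Some y then c y else o.
exists c' => i s [s0 /andP[cs us]] sA.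
have sV x : x \in s -> x \in V by move=> /sA; rewrite !inE => /andP[].
have [t st] : exists t : seq H, s = map val t.
  elim: s {s0 cs us sA} sV => [|x s IH] sV; first by exists [::].
  have [t ->] := IH (fun y ys => sV y (mem_behead (s := x :: s) ys)).
  by exists (exist _ x (sV x (mem_head _ _)) :: t).
apply: (hc i t).
  split; first by move: s0; rewrite st; case: (t).
  rewrite /ucycle -(map_inj_uniq val_inj) -st us andbT.
  move: cs; rewrite st cycle_map; apply: sub_cycle => x y /= xy.
  by rewrite /sub_arc !inE /= xy; have := valP x; have := valP y; rewrite !inE => -> ->.
move=> x xt; have : val x \in s by rewrite st map_f.
by move=> /sA; rewrite !inE /c' valK => /andP[].
Qed.

End Critical.

Lemma degree_sum (D : digraph) : \sum_(v : D) #|nbr v| <= 2 * #|edges (underlying D)|.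
Proof.
pose P : {set D * D} := [set a | underlying_adj a.1 a.2]%SET.
have -> : \sum_(v : D) #|nbr v| = #|P|.
  rewrite -sum1_card (eq_bigl (fun a => underlying_adj a.1 a.2)) => [|a]; last by rewrite inE.
  rewrite -(pair_big_dep xpredT (fun u v => underlying_adj u v) (fun _ _ => 1)) /=.
  by apply: eq_bigr => v _; rewrite sum1_card; apply: eq_card => x; rewrite inE.
(* an adjacent pair is an edge with an orientation *)
pose f (a : D * D) := ([set a.1; a.2]%SET, enum_rank a.1 < enum_rank a.2).
have finj : {in P &, injective f}.
  move=> [u v] [u' v'] _ _ [/= e lt].
  have h3 : u \in [set u'; v']%SET by rewrite -e !inE eqxx.
  have h4 : v \in [set u'; v']%SET by rewrite -e !inE eqxx orbT.
  have : u' \in [set u; v]%SET by rewrite e !inE eqxx.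
  have : v' \in [set u; v]%SET by rewrite e !inE eqxx orbT.
  move: lt h3 h4; rewrite !inE => lt h3 h4 /orP[/eqP v'E|/eqP v'E] /orP[/eqP u'E|/eqP u'E]; subst u' v'.
  - by move: h4; rewrite orbb => /eqP->.
  - have -> // : u = v; apply/enum_rank_inj/val_inj => /=.
    by move: lt; case: (ltngtP (enum_rank u) (enum_rank v)).
  - by [].
  - by move: h3; rewrite orbb => /eqP->.
rewrite -(card_in_imset finj) mulnC -card_bool -cardsT -cardsX.
apply/subset_leq_card/fintype.subsetP => _ /imsetP[[u v] uv ->]; rewrite !inE /= andbT.
apply/existsP; exists u; apply/existsP; exists v; rewrite eqxx andbT.
by move: uv; rewrite inE.
Qed.

(** The degree sum is at most [6 * #|D| + 2 * M]. For [k > 6] this suffices, as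
    all degrees are at least [7]. For [k = 6] it leaves at most [2 * M] vertices
    that are not low, with degree sum at most [14 * M]. By [low_density] a low
    vertex has on average at least [2/3] neighbours among them, so there are at
    most [21 * M] low vertices. The sparsity requires that the low vertices
    contain no clique on seven vertices. Low vertices are joined by digons, so
    seven of them that form a clique need seven colours; if the order exceeds
    seven, they remain when some other vertex is deleted. *)
Lemma critical_order (D : digraph) (k M : nat) : 6 <= k -> dicritical k.+1 D ->
  #|edges (underlying D)| <= 3 * #|D| + M -> #|D| <= 7 + 23 * M.
Proof.
move=> k6 crit mb; have k0 : 0 < k by exact: leq_trans k6.
have ncol := critical_not_dicolourable crit.
have mcol v : exists c : D -> 'I_k, colours_minus v c by exact: critical_minus.
have deg v := leq_card_nbr ncol mcol v.
have dsum := degree_sum D.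
have sum_deg : \sum_(v : D) #|nbr v| <= 6 * #|D| + 2 * M by lia.
have [k7|k6'] := ltnP 6 k.
  have : 7 * #|D| <= \sum_(v : D) #|nbr v|.
    rewrite -sum1_card big_distrr /=; apply: leq_sum => v _.
    by rewrite muln1; exact: leq_trans (deg v).
  by move: (\sum_(v : D) _) sum_deg; lia.
have {k6 k6'} kE : k = 6 by apply/eqP; rewrite eqn_leq k6' k6.
subst k; have [|n8] := leqP #|D| 7; first by move=> h; apply: leq_trans h (leq_addr _ _).
pose L := low D 6.
have noK (K : {set D}) : K \subset L -> clique (enum K) -> #|K| <= 6.
  move=> KL cl; rewrite leqNgt; apply/negP => K7.
  have [w Kw] : exists w, 6 < #|K :\ w|.
    have [KT|KT] := eqVneq K finset.setT.
      have /card_gt0P[w _] : 0 < #|D| by exact: leq_trans n8.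
      by exists w; move: n8; rewrite KT -cardsT (cardsD1 w [set: D]%SET) inE.
    have /existsP[w wK] : [exists w, w \notin K].
      apply: contraNT KT => /existsPn h; rewrite -finset.subTset.
      by apply/fintype.subsetP => w _; have := h w; rewrite negbK.
    by exists w; move: K7; rewrite (cardsD1 w K) (negbTE wK).
  have [c hc] := mcol w.
  have cinj : {in K :\ w &, injective c}.
    move=> x y; rewrite !inE => /andP[xw xK] /andP[yw yK] cxy.
    apply/eqP/negPn/negP => xy.
    have axy : underlying_adj x y by apply: cl; rewrite ?mem_enum.
    have /andP[a1 a2] := low_digon ncol mcol (fintype.subsetP KL x xK) axy.
    apply: (hc (c x) [:: x; y]).
      by split=> //; rewrite /ucycle /= a1 a2 inE xy.
    by move=> a; rewrite !inE => /orP[] /eqP->; rewrite ?xw ?yw ?cxy eqxx.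
  have := max_card (c @: (K :\ w)); rewrite card_ord (card_in_imset cinj).
  by rewrite leqNgt Kw.
have dens := low_density ncol mcol noK (subxx L).
have lowE v : v \in L -> #|nbr v| = 6 by rewrite inE => /eqP.
pose B : {set D} := ~: L.
have cB : #|D| = #|L| + #|B| by rewrite -(cardsC L).
have sumE : \sum_(v : D) #|nbr v| = 6 * #|L| + \sum_(v in B) #|nbr v|.
  rewrite (bigID (mem L)) /=; congr (_ + _).
    by rewrite (eq_bigr (fun=> 6)) ?sum_nat_const ?[6 * _]mulnC// => v; exact: lowE.
  by apply: eq_bigl => v; rewrite finset.in_setC.
have degB : 7 * #|B| <= \sum_(v in B) #|nbr v|.
  rewrite -sum1_card big_distrr /=; apply: leq_sum => v vB; rewrite muln1.
  by rewrite ltn_neqAle deg andbT; move: vB; rewrite !inE eq_sym.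
have split_low : 6 * #|L| = adjacencies L L + adjacencies L B.
  rewrite /adjacencies -big_split /= mulnC -sum_nat_const; apply: eq_bigr => v vL.
  by rewrite -(lowE v vL) -(cardsID L (nbr v)) finset.setDE.
have LB : adjacencies L B <= \sum_(v in B) #|nbr v|.
  by rewrite adjacenciesC; apply: leq_sum => v _; exact: subset_leq_card (finset.subsetIl _ _).
move: (\sum_(v in B) #|nbr v|) sumE degB LB => sB; move: (\sum_(v : D) #|nbr v|) sum_deg => sD.
clear -cB dens split_low; lia.
Qed.

(** Digraphs on initial segments of the natural numbers are encoded by
    functions on pairs, made irreflexive in the decoding. *)
Lemma finitely_many_of_order (P : digraph -> Prop) N :
  (forall D, P D -> #|D| <= N) -> finitely_many_up_to_iso P.
Proof.
move=> PN.
pose code := {n : 'I_N.+1 & {ffun 'I_n * 'I_n -> bool}}.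
pose rl (n : nat) (f : {ffun 'I_n * 'I_n -> bool}) : rel 'I_n := fun x y => (x != y) && f (x, y).
have rl_irr n f : irreflexive (@rl n f) by move=> x; rewrite /rl eqxx.
pose dec (t : code) : digraph := Digraph (rl_irr (tag t) (tagged t)).
exists #|{: code}|, (fun i => dec (enum_val i)) => D /PN; rewrite -ltnS => Dn.
pose n : 'I_N.+1 := Ordinal Dn.
pose f : {ffun 'I_n * 'I_n -> bool} := [ffun a => arc (enum_val a.1 : D) (enum_val a.2)].
pose t : code := Tagged (fun n : 'I_N.+1 => {ffun 'I_n * 'I_n -> bool}) f.
exists (enum_rank t); rewrite enum_rankK; exists (fun x : D => enum_rank x : 'I_n); split.
  by exists (fun i : 'I_n => enum_val i); [exact: enum_rankK|exact: enum_valK].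
move=> x y; rewrite /= /rl ffunE /= !enum_rankK.
by rewrite (inj_eq enum_rank_inj); have [->|//] := eqVneq x y; rewrite arc_irrefl.
Qed.

Theorem corollary3p13 (R : realType) (S : topologicalType)
  (hS : closed_surface R S) (k : nat) (hk : (6 <= k)%N) :
  finitely_many_up_to_iso (fun D => dicritical k.+1 D /\ embeddable R S D).
Proof.
have [M HM] := edge_bound hS.
apply: (@finitely_many_of_order _ (7 + 23 * M)) => D [crit emb].
exact: (critical_order hk crit (HM (underlying D) emb)).
Qed.
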